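(* Let $n\ge2$ and $\lambda$ a partition. The uncrowding map $\Upsilon$ is a crystal isomorphism \[\Upsilon\colon \mathrm{MVT}^n(\lambda)\to\bigsqcup_{\mu\supseteq\lambda}B(\mu)\times\mathcal F^c_{\mu/\lambda},\] where $f_i(b\times F)=(f_ib)\times F$ and $e_i(b\times F)=(e_ib)\times F$. Consequently \[\mathrm{MVT}^n(\lambda)\cong\bigoplus_{\mu\supseteq\lambda}B(\mu)^{\oplus|\mathcal F^c_{\mu/\lambda}|},\] so that the number $M^\mu_\lambda$ of highest weight elements of weight $\mu$ in $\mathrm{MVT}^n(\lambda)$ equals $|\mathcal F^c_{\mu/\lambda}|$, and \[\overline{G}_\lambda(\mathbf x;\alpha)=\sum_{\mu\supseteq\lambda}\alpha^{|\mu|-|\lambda|}|\mathcal F^c_{\mu/\lambda}|\,s_\mu(\mathbf x).\]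
   Context: A multiset-valued tableau of shape $\lambda$ with entries at most $n$ is a filling $T$ of the boxes of the Young diagram of $\lambda$ (English convention) by finite nonempty multisets of integers in $\{1,\dots,n\}$ such that for a box $A$ immediately left of a box $B$ in a row, $\max A\le\min B$, and for a box $C$ immediately below a box $A$ in a column, $\max A<\min C$. $\mathrm{MVT}^n(\lambda)$ is the set of these ($\mathrm{MVT}^\infty(\lambda)$ allows all positive integers); $\mathrm{wt}(T)=\prod_j x_j^{m_j}$ with $m_j$ the number of occurrences of $j$; $|T|=\sum m_j$. Reading word: for a column $C$, $\mathrm{rd}(C)$ first reads the smallest entry of each box, boxes from bottom to top, then the remaining entries of each box (one copy of its minimum removed) from smallest to largest, boxes from top to bottom; $\mathrm{rd}(T)=\mathrm{rd}(C_1)\cdots\mathrm{rd}(C_k)$, columns left to right. For $i\in\{1,\dots,n-1\}$, write $+$ for each letter $i$, $-$ for each letter $i+1$ of $\mathrm{rd}(T)$, cancel pairs $-+$ successively until $+\cdots+-\cdots-$ remains. $e_iT$: $0$ if no uncanceled $-$; else with $\mathsf b$ the box of the leftmost uncanceled $-$: if the box immediately above $\mathsf b$ contains $i$, remove an $i+1$ from $\mathsf b$ and add $i$ to the box above, otherwise replace that $i+1$ in $\mathsf b$ by $i$. $f_iT$: $0$ if no uncanceled $+$; else with $\mathsf b$ the box of the rightmost uncanceled $+$: if the box immediately below $\mathsf b$ contains $i+1$, remove the $i$ from $\mathsf b$ and add $i+1$ to the box below, otherwise replace that $i$ in $\mathsf b$ by $i+1$. $B(\mu)$ is the $U_q(\mathfrak{sl}_n)$-highest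 weight crystal on semistandard Young tableaux of shape $\mu$ with entries in $\{1,\dots,n\}$ (standard crystal operators); $\cong$ is crystal isomorphism, $\bigoplus$ disjoint union, $B^{\oplus m}$ is $m$ copies. $\mathcal F^c_{\mu/\lambda}$ (column flagged tableaux) is the set of increasing tableaux of shape $\mu/\lambda$, i.e. fillings of the boxes of $\mu$ not in $\lambda$ by positive integers strictly increasing along rows and down columns, such that every entry in column $c$ is strictly less than $c$. Uncrowding: let $T\in\mathrm{MVT}^n(\lambda)$ with columns $C_1,\dots,C_{\lambda_1}$. For $j\le\lambda_1$ let $\lambda_{\ge j}$ be the subdiagram of $\lambda$ formed by columns $j,\dots,\lambda_1$; all diagrams at step $j$ are placed left-justified starting at column $j$. Start with $b_{\lambda_1+1}\times F_{\lambda_1+1}=\emptyset\times\emptyset$. For $j=\lambda_1,\lambda_1-1,\dots,1$: let $b_j$ be the RSK (row) insertion tableau of the word $\mathrm{rd}(C_j)\mathrm{rd}(C_{j+1})\cdots\mathrm{rd}(C_{\lambda_1})$, of shape $\mu_j$; $F_j$ is the filling of $\mu_j/\lambda_{\ge j}$ obtained by keeping every entry of $F_{j+1}$ in the same box (same row and same column of the plane) and filling each remaining box of $\mu_j/\lambda_{\ge j}$, lying in plane column $c$, with the entry $c-j$. Then $\Upsilon(T)=b_1\times F_1$. The weak symmetric Grothendieck function is $\overline{G}_\lambda(\mathbf x;\alpha)=\sum_{T\in\mathrm{MVT}^\infty(\lambda)}\alpha^{|T|-|\lambda|}\mathrm{wt}(T)$; $s_\mu$ is the Schur function.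
   Formalization: The equality of the number of highest weight elements of weight μ with |F^c_{μ/λ}| is stated only for μ with at most n parts; otherwise it can fail (n=2, λ=μ=(1,1,1): MVT^2(λ) is empty while F^c_{λ/λ} has one element). *)

(* Defs.v *)
From HB Require Import structures.
From mathcomp Require Import all_boot all_order all_algebra finmap multiset.
From mathcomp Require Import mathcomp_extra boolp classical_sets functions.
From mathcomp Require Import cardinality fsbigop.

Set Implicit Arguments.
Unset Strict Implicit.
Unset Printing Implicit Defensive.

Local Open Scope mset_scope.
Local Open Scope classical_set_scope.
Local Open Scope nat_scope.

(* Rows and columns are numbered from 0: the box in row r and column c below *)
(* is the box in row r + 1 and column c + 1 of the usual numbering. Letters  *)
(* are the positive integers.                                                *)

Definition is_part (mu : seq nat) : bool := sorted geq mu && (0 \notin mu).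

Definition in_diag (mu : seq nat) (r c : nat) : bool := c < nth 0 mu r.

Definition included (lam mu : seq nat) : Prop :=
  forall r, nth 0 lam r <= nth 0 mu r.

Definition parts_above (lam : seq nat) : set (seq nat) :=
  [set mu | is_part mu /\ included lam mu].

(* 0 for an infinite set *)
Definition fincard (T : choiceType) (A : set T) : nat := #|` fset_set A|%fset.

(* A labelled word is a sequence of pairs (letter, box of that letter). The  *)
(* stack st holds, top first, the letters of the prefix read so far that are *)
(* not cancelled: a letter i (+) cancels with the letter i+1 (-) on top of   *)
(* the stack if there is one.                                                *)
Definition sig_step (A : Type) (i : nat) (st : seq (nat * A)) (x : nat * A) :=
  if x.1 == i.+1 then x :: st
  else if x.1 == i then
    if st is y :: st' then (if y.1 == i.+1 then st' else x :: st) else [:: x]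
  else st.

Definition signature (A : Type) (i : nat) (w : seq (nat * A)) :=
  rev (foldl (sig_step i) [::] w).

Definition leftmost_minus (A : Type) (i : nat) (w : seq (nat * A)) : option A :=
  ohead [seq x.2 | x <- signature i w & x.1 == i.+1].

Definition rightmost_plus (A : Type) (i : nat) (w : seq (nat * A)) : option A :=
  ohead (rev [seq x.2 | x <- signature i w & x.1 == i]).

(* The element 0 is None. The operators are given on a type of raw objects B *)
(* and the crystal is the subset elts of B; weights are monomials            *)
(* \prod_j x_j ^ (m j), represented by the multiset m. As the crystals here  *)
(* are seminormal, eps_i and phi_i are the lengths of the e_i- and           *)
(* f_i-strings, so they are determined by the operators.                     *)
Record crystal (B : Type) := Crystal {
  elts : set B;
  cre : nat -> B -> option B;
  crf : nat -> B -> option B;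
  crwt : B -> {mset nat}
}.

Definition crystal_stable (n : nat) (B : Type) (X : crystal B) : Prop :=
  forall i x y, 1 <= i < n -> elts X x ->
    (cre X i x = Some y -> elts X y) /\ (crf X i x = Some y -> elts X y).

Definition crystal_iso (n : nat) (B C : Type) (X : crystal B) (Y : crystal C)
    (psi : B -> C) : Prop :=
  [/\ crystal_stable n X, crystal_stable n Y,
      set_bij (elts X) (elts Y) psi,
      forall x, elts X x -> crwt Y (psi x) = crwt X x
    & forall i x, 1 <= i < n -> elts X x ->
        cre Y i (psi x) = omap psi (cre X i x) /\
        crf Y i (psi x) = omap psi (crf X i x)].

Definition highest_weight (n : nat) (B : Type) (X : crystal B) : set B :=
  [set x | elts X x /\ forall i, 1 <= i < n -> cre X i x = None].

Definition crystal_times (B C : Type) (X : crystal B) (S : set C) :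
    crystal (B * C) :=
  {| elts := elts X `*` S;
     cre := fun i p => omap (fun b => (b, p.2)) (cre X i p.1);
     crf := fun i p => omap (fun b => (b, p.2)) (crf X i p.1);
     crwt := fun p => crwt X p.1 |}.

Definition crystal_sum (I B : Type) (D : set I) (X : I -> crystal B) :
    crystal (I * B) :=
  {| elts := [set p | D p.1 /\ elts (X p.1) p.2];
     cre := fun i p => omap (pair p.1) (cre (X p.1) i p.2);
     crf := fun i p => omap (pair p.1) (crf (X p.1) i p.2);
     crwt := fun p => crwt (X p.1) p.2 |}.

Definition crystal_copies (B : Type) (m : nat) (X : crystal B) :
    crystal (nat * B) :=
  crystal_sum `I_m (fun=> X).

Definition filling : Type := seq (seq nat).

Definition entry (t : filling) (r c : nat) : nat := nth 0 (nth [::] t r) c.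

Definition SSYT (mu : seq nat) : set filling :=
  [set t | [/\ shape t = mu,
    forall r c, in_diag mu r c -> 0 < entry t r c,
    forall r c, in_diag mu r c.+1 -> entry t r c <= entry t r c.+1
  & forall r c, in_diag mu r.+1 c -> entry t r c < entry t r.+1 c]].

Definition SSYT_le (n : nat) (mu : seq nat) : set filling :=
  [set t | SSYT mu t /\ forall x, x \in flatten t -> x <= n].

Definition ssyt_wt (t : filling) : {mset nat} := seq_mset (flatten t).

Definition ssyt_rd (t : filling) : seq (nat * (nat * nat)) :=
  flatten [seq [seq (entry t r c, (r, c)) | c <- iota 0 (size (nth [::] t r))]
          | r <- rev (iota 0 (size t))].

Definition set_entry (t : filling) (p : nat * nat) (x : nat) : filling :=
  set_nth [::] t p.1 (set_nth 0 (nth [::] t p.1) p.2 x).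

Definition ssyt_e (i : nat) (t : filling) : option filling :=
  omap (fun p => set_entry t p i) (leftmost_minus i (ssyt_rd t)).

Definition ssyt_f (i : nat) (t : filling) : option filling :=
  omap (fun p => set_entry t p i.+1) (rightmost_plus i (ssyt_rd t)).

Definition Bcrystal (n : nat) (mu : seq nat) : crystal filling :=
  {| elts := SSYT_le n mu; cre := ssyt_e; crf := ssyt_f; crwt := ssyt_wt |}.

(* a finite multiset is represented by its weakly increasing enumeration *)
Definition mbox : Type := seq nat.
Definition mtab : Type := seq (seq mbox).

Definition box_min (A : mbox) : nat := head 0 A.
Definition box_max (A : mbox) : nat := last 0 A.

(* [::] outside the diagram *)
Definition box (T : mtab) (r c : nat) : mbox := nth [::] (nth [::] T r) c.

Definition mtab_entries (T : mtab) : seq nat := flatten (flatten T).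

Definition MVT (lam : seq nat) : set mtab :=
  [set T | [/\ shape T = lam,
    forall r c, in_diag lam r c ->
      [/\ sorted leq (box T r c), box T r c <> [::] & 0 \notin box T r c],
    forall r c, in_diag lam r c.+1 -> box_max (box T r c) <= box_min (box T r c.+1)
  & forall r c, in_diag lam r.+1 c -> box_max (box T r c) < box_min (box T r.+1 c)]].

Definition MVT_le (n : nat) (lam : seq nat) : set mtab :=
  [set T | MVT lam T /\ forall x, x \in mtab_entries T -> x <= n].

Definition mvt_wt (T : mtab) : {mset nat} := seq_mset (mtab_entries T).

Definition mvt_size (T : mtab) : nat := size (mtab_entries T).

Definition ncols (T : mtab) : nat := head 0 (shape T).
Definition col_height (T : mtab) (c : nat) : nat := count (ltn c) (shape T).

Definition mvt_rd_col (T : mtab) (c : nat) : seq (nat * (nat * nat)) :=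
  [seq (box_min (box T r c), (r, c)) | r <- rev (iota 0 (col_height T c))] ++
  flatten [seq [seq (x, (r, c)) | x <- behead (box T r c)]
          | r <- iota 0 (col_height T c)].

Definition mvt_rd_from (T : mtab) (j : nat) : seq (nat * (nat * nat)) :=
  flatten [seq mvt_rd_col T c | c <- iota j (ncols T - j)].

Definition mvt_rd (T : mtab) : seq (nat * (nat * nat)) := mvt_rd_from T 0.

Definition set_box (T : mtab) (r c : nat) (A : mbox) : mtab :=
  set_nth [::] T r (set_nth [::] (nth [::] T r) c A).

Definition remove_from (x r c : nat) (T : mtab) : mtab :=
  set_box T r c (rem x (box T r c)).

Definition add_to (x r c : nat) (T : mtab) : mtab :=
  set_box T r c (sort leq (x :: box T r c)).

Definition mvt_e (i : nat) (T : mtab) : option mtab :=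
  if leftmost_minus i (mvt_rd T) is Some (r, c) then
    let T' := remove_from i.+1 r c T in
    Some (if (0 < r) && (i \in box T r.-1 c) then add_to i r.-1 c T'
          else add_to i r c T')
  else None.

Definition mvt_f (i : nat) (T : mtab) : option mtab :=
  if rightmost_plus i (mvt_rd T) is Some (r, c) then
    let T' := remove_from i r c T in
    Some (if i.+1 \in box T r.+1 c then add_to i.+1 r.+1 c T'
          else add_to i.+1 r c T')
  else None.

Definition MVTcrystal (n : nat) (lam : seq nat) : crystal mtab :=
  {| elts := MVT_le n lam; cre := mvt_e; crf := mvt_f; crwt := mvt_wt |}.

Definition in_skew (mu lam : seq nat) (r c : nat) : bool :=
  nth 0 lam r <= c < nth 0 mu r.

(* A filling of mu/lam is the list of its rows, where row r lists only the   *)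
(* entries of the boxes of mu/lam, i.e. those in columns lam_r, lam_r+1, ... *)
Definition skew_entry (lam : seq nat) (F : filling) (r c : nat) : nat :=
  entry F r (c - nth 0 lam r).

(* empty unless lam is included in mu *)
Definition colflag (mu lam : seq nat) : set filling :=
  [set F | [/\ included lam mu,
    shape F = [seq nth 0 mu r - nth 0 lam r | r <- iota 0 (size mu)],
    forall r c, in_skew mu lam r c -> 0 < skew_entry lam F r c < c.+1,
    forall r c, in_skew mu lam r c -> in_skew mu lam r c.+1 ->
      skew_entry lam F r c < skew_entry lam F r c.+1
  & forall r c, in_skew mu lam r c -> in_skew mu lam r.+1 c ->
      skew_entry lam F r c < skew_entry lam F r.+1 c]].

Definition flagged_sum (n : nat) (lam : seq nat) :
    crystal (seq nat * (filling * filling)) :=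
  crystal_sum (parts_above lam)
    (fun mu => crystal_times (Bcrystal n mu) (colflag mu lam)).

(* insertion of x in a row: the bumped entry, if any, and the new row *)
Fixpoint row_insert (x : nat) (s : seq nat) : option nat * seq nat :=
  if s is y :: s' then
    if x < y then (Some y, x :: s')
    else let: (o, s'') := row_insert x s' in (o, y :: s'')
  else (None, [:: x]).

Fixpoint tab_insert (x : nat) (t : filling) : filling :=
  if t is s :: t' then
    match row_insert x s with
    | (None, s') => s' :: t'
    | (Some y, s') => s' :: tab_insert y t'
    end
  else [:: [:: x]].

Definition insertion_tableau (w : seq nat) : filling :=
  foldl (fun t x => tab_insert x t) [::] w.

Definition uncrowd_b (T : mtab) (j : nat) : filling :=
  insertion_tableau [seq x.1 | x <- mvt_rd_from T j].

(* uncrowd_F T k is the filling F_j for the column j = ncols T - k, as a     *)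
(* function of the row and column of the plane, equal to None outside        *)
(* mu_j / lam_{>= j}, where mu_j is the shape of uncrowd_b T j placed with   *)
(* its first column in column j.                                             *)
Fixpoint uncrowd_F (T : mtab) (k : nat) : nat -> nat -> option nat :=
  if k is k'.+1 then
    let j := ncols T - k in
    fun r c =>
      if [&& j <= c, c < j + nth 0 (shape (uncrowd_b T j)) r
           & nth 0 (shape T) r <= c]
      then (if uncrowd_F T k' r c is Some x then Some x else Some (c - j))
      else None
  else fun _ _ => None.

(* the element b_1 x F_1 of the component indexed by the shape of b_1 *)
Definition uncrowd (T : mtab) : seq nat * (filling * filling) :=
  let lam := shape T in
  let b := uncrowd_b T 0 in
  let mu := shape b in
  (mu, (b, [seq [seq odflt 0 (uncrowd_F T (ncols T) r c)
                | c <- iota (nth 0 lam r) (nth 0 mu r - nth 0 lam r)]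
           | r <- iota 0 (size mu)])).

(* Formal power series in x_1, x_2, ... over Z[alpha], with alpha = 'X, as   *)
(* functions of coefficients: m : {mset nat} stands for \prod_j x_j ^ (m j). *)
Definition fps : Type := {mset nat} -> {poly int}.

Definition fps_mono (m : {mset nat}) : fps := fun m' => ((m' == m)%:R)%R.

Definition fps_scale (a : {poly int}) (f : fps) : fps := fun m => (a * f m)%R.

Definition fps_summable (I : choiceType) (D : set I) (f : I -> fps) : Prop :=
  forall m, finite_set [set i | D i /\ f i m <> 0%R].

(* meaningful only for summable families: the library sum over a set is 0    *)
(* when its support is infinite                                              *)
Definition fps_sum (I : choiceType) (D : set I) (f : I -> fps) : fps :=
  fun m => (\sum_(i \in D) f i m)%R.

Definition schur (mu : seq nat) : fps :=
  fps_sum (SSYT mu) (fun t => fps_mono (ssyt_wt t)).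

Definition weakG (lam : seq nat) : fps :=
  fps_sum (MVT lam)
    (fun T => fps_scale ('X ^+ (mvt_size T - sumn lam))%R (fps_mono (mvt_wt T))).

Definition weakG_term (lam mu : seq nat) : fps :=
  fps_scale ('X ^+ (sumn mu - sumn lam) * (fincard (colflag mu lam))%:R)%R
    (schur mu).

Definition hw_number (n : nat) (lam mu : seq nat) : nat :=
  fincard [set T | highest_weight n (MVTcrystal n lam) T /\
                   forall j, mvt_wt T j.+1 = nth 0 mu j].

(* Main.v *)
Require Import Defs.
From mathcomp Require Import all_boot all_order all_algebra finmap multiset.
From mathcomp Require Import mathcomp_extra boolp classical_sets functions.
From mathcomp Require Import cardinality fsbigop zify.

Set Implicit Arguments.
Unset Strict Implicit.
Unset Printing Implicit Defensive.

Local Open Scope nat_scope.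

(* The operators e_i and f_i on multiset-valued tableaux change one letter of
   the reading word exactly as the crystal operators on words do, and they do
   so inside a single column word. Row insertion commutes with the operators
   on words: a word and the reading word of its insertion tableau are related
   by a simulation for all e_i (Knuth moves on three letters are such), and
   two tableaux related by a simulation are raised together to the same
   highest weight tableau, hence are equal. So uncrowding commutes with e_i
   and f_i, the shapes of all b_j, and therefore the flagged filling, being
   constant along the way; and it is enough to see that it is bijective on
   highest weight elements. In a highest weight multiset-valued tableau every
   letter of row r (from 1) is r. With M(j,r) the number of entries of row r in
   the columns >= j, the shape of b_j is M(j,_), and the highest weight
   condition is M(j,r+1) - 1 <= M(j+1,r). A box (r,c) of mu/lambda appears at
   the last step j with c < j + M(j,r) (rows and columns from 0), it is filled
   with c - j, and the conditions on M turn into those of a column flagged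
   tableau. *)

(** * The crystal of words *)

(** On words only [e_i] is defined. The two conditions of [word_eP], [eps] zero before the critical
    letter and [phi] zero after it, are the same for the letter [i] on which [f_i] acts; so [f_i]
    enters as the converse of [word_e i], single-valued by [word_e_inj]. The shapes of all [b_j]
    stay fixed because dropping whole columns on the left keeps a critical letter critical: the word
    from column [j] on is either untouched or itself raised by [e_i]. This requires that an operator
    change one letter in place. The clauses that move an entry to a neighbouring box do so because
    the non-minimal entries of a box end where those of the box beneath it begin. Every reduction to
    highest weight is an induction on the sum of the letters, which [e_i] lowers by one. The
    infinite alphabet of the power series is handled one monomial at a time, since a monomial bounds
    its letters. *)

Fixpoint phi (i : nat) (w : seq nat) : nat :=
  if w is x :: w' then (x == i) + (phi i w' - (x == i.+1)) else 0.

(** Truncated subtraction does the bracketing: a leading [i.+1] consumes one uncancelled [i] behind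
    it in [phi], and counts in [eps] only if none is left. *)
Fixpoint eps (i : nat) (w : seq nat) : nat :=
  if w is x :: w' then eps i w' + ((x == i.+1) - phi i w') else 0.

Fixpoint word_e (i : nat) (w : seq nat) : option (seq nat) :=
  if w is x :: w' then
    if (x == i.+1) && (phi i w' == 0) then Some (i :: w')
    else omap (cons x) (word_e i w')
  else None.

(** Tensor product rule: the uncancelled [i.+1] of [u] cancel with the uncancelled [i] of [v], and
    nothing else interacts. *)
Lemma phi_cat i u v : phi i (u ++ v) = phi i u + (phi i v - eps i u).
Proof. by elim: u => [|x u IH] /=; [lia | rewrite IH; lia]. Qed.

Lemma eps_cat i u v : eps i (u ++ v) = eps i v + (eps i u - phi i v).
Proof. by elim: u => [|x u IH] /=; [lia | rewrite IH phi_cat; lia]. Qed.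

Lemma phi_eps_count i w :
  phi i w + count_mem i.+1 w = eps i w + count_mem i w.
Proof.
elim: w => [|x w] //=; move: (count_mem _ w) (count_mem _ w) => a b IH.
by case: (x == i) (x == i.+1) => [] []; lia.
Qed.

(** The critical letter lies in [u] exactly when [v] has too few uncancelled [i] for the [i.+1] that
    [u] leaves over. *)
Lemma word_e_cat i u v :
  word_e i (u ++ v) =
  if phi i v < eps i u then omap (cat^~ v) (word_e i u)
  else omap (cat u) (word_e i v).
Proof.
elim: u => [|x u IH] /=; first by case: (word_e i v).
rewrite IH phi_cat.
case: (x =P i.+1) => [->|_] /=.
- case: (ltnP (phi i v) (eps i u)) => h.
    have -> : phi i v < eps i u + (1 - phi i u) by lia.
    have -> : (phi i u + (phi i v - eps i u) == 0) = (phi i u == 0) by lia.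
    by case: (phi i u == 0); case: (word_e i u).
  case: (phi i u =P 0) => [->|hu].
    case: ifP => h1; case: ifP => h2 //; try lia.
    by case: (word_e i v).
  have -> : (phi i u + (phi i v - eps i u) == 0) = false by lia.
  have -> : (phi i v < eps i u + (1 - phi i u)) = false by lia.
  by case: (word_e i v).
- rewrite sub0n addn0; case: ifP => _; first by case: (word_e i u).
  by case: (word_e i v).
Qed.

Lemma word_eP i w w' :
  word_e i w = Some w' <->
  exists w1 w2, [/\ w = w1 ++ i.+1 :: w2, w' = w1 ++ i :: w2,
                    eps i w1 = 0 & phi i w2 = 0].
Proof.
split.
- elim: w w' => [|x w IH] w' //=.
  case: ifP => [/andP[/eqP-> /eqP h] [<-]|hx].
    by exists [::], w.
  case E: (word_e i w) => [v|] //= [<-].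
  have [w1 [w2 [e1 e2 h1 h2]]] := IH _ E.
  exists (x :: w1), w2; rewrite e1 e2; split=> //=.
  move: hx; rewrite e1 phi_cat /= h1 h2.
  by rewrite (_ : (i.+1 == i) = false); lia.
- case=> w1 [w2 [-> -> h1 h2]].
  by rewrite word_e_cat h1 ltn0 /= h2 !eqxx.
Qed.

Lemma word_e_None i w : (word_e i w == None) = (eps i w == 0).
Proof.
elim: w => [|x w IH] //=; case: ifP => [/andP[-> /eqP->]|hx] /=.
  by rewrite subn0 addn1.
have -> : (x == i.+1) - phi i w = 0 by lia.
by rewrite addn0 -IH; case: (word_e i w).
Qed.

Lemma eps_gt0P i w : reflect (exists w', word_e i w = Some w') (0 < eps i w).
Proof.
rewrite lt0n -word_e_None; case: (word_e i w) => [v|]; constructor.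
  by exists v.
by case.
Qed.

Lemma word_e_sumn i w w' : word_e i w = Some w' -> sumn w = (sumn w').+1.
Proof. by case/word_eP=> w1 [w2 [-> -> _ _]]; rewrite !sumn_cat /=; lia. Qed.

Lemma word_e_phi i w w' : word_e i w = Some w' -> 0 < phi i w'.
Proof.
by case/word_eP=> w1 [w2 [_ -> h1 _]]; rewrite phi_cat /= eqxx h1; lia.
Qed.

Lemma cat_cons_eq (T : Type) (a b : T) (u1 u2 v1 v2 : seq T) :
  u1 ++ a :: u2 = v1 ++ b :: v2 ->
  [\/ [/\ u1 = v1, a = b & u2 = v2],
      exists z, v1 = u1 ++ a :: z /\ u2 = z ++ b :: v2
    | exists z, u1 = v1 ++ b :: z /\ v2 = z ++ a :: u2].
Proof.
elim: u1 v1 => [|x u1 IH] [|y v1] /=.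
- by case=> -> ->; constructor 1.
- by case=> -> ->; constructor 2; exists v1.
- by case=> -> <-; constructor 3; exists u1.
- case=> -> /IH[[-> -> ->]|[z [-> ->]]|[z [-> ->]]].
  + by constructor 1.
  + by constructor 2; exists z.
  + by constructor 3; exists z.
Qed.

(* The two unequal positions cannot both be critical: the left-hand one would *)
(* leave an uncancelled i+1, or the right-hand one an uncancelled i.          *)
Lemma critical_unique i x (u1 u2 v1 v2 : seq nat) :
  (x == i) || (x == i.+1) -> u1 ++ x :: u2 = v1 ++ x :: v2 ->
  eps i u1 = 0 -> phi i u2 = 0 -> eps i v1 = 0 -> phi i v2 = 0 ->
  u1 = v1 /\ u2 = v2.
Proof.
move=> hx e h1 h2 h3 h4.
have [[-> _ ->] //|[z [ev eu]]|[z [eu ev]]] := cat_cons_eq e.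
- move: h2 h3; rewrite ev eu phi_cat eps_cat /=.
  by case/orP: hx => /eqP->; rewrite ?eqxx; lia.
- move: h1 h4; rewrite ev eu phi_cat eps_cat /=.
  by case/orP: hx => /eqP->; rewrite ?eqxx; lia.
Qed.

Lemma word_e_inj i a b c :
  word_e i a = Some c -> word_e i b = Some c -> a = b.
Proof.
move=> /word_eP[a1 [a2 [-> -> h1 h2]]] /word_eP[b1 [b2 [-> e h3 h4]]].
have hi : (i == i) || (i == i.+1) by rewrite eqxx.
by have [-> ->] := critical_unique hi e h1 h2 h3 h4.
Qed.

(** A cancelled letter has a partner. This lemma and its mirror [phi0_mem_before] supply the
    partners from which contradictions between neighbouring boxes are drawn. *)
Lemma eps0_mem_after i w1 w2 :
  eps i (w1 ++ i.+1 :: w2) = 0 -> i \in w2.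
Proof.
move=> h; have {h} : 0 < phi i w2.
  by move: h; rewrite eps_cat /= eqxx; lia.
elim: w2 => [|x w IH] //=; rewrite inE [i == x]eq_sym.
by case: (x == i) => //= h; apply: IH; lia.
Qed.

Lemma phi0_mem_before i w1 w2 :
  phi i (w1 ++ i :: w2) = 0 -> i.+1 \in w1.
Proof.
move=> h; have {h} : 0 < eps i w1.
  by move: h; rewrite phi_cat /= eqxx; lia.
elim: w1 => [|x w IH] //=; rewrite inE [_ == x]eq_sym.
by case: (x == i.+1) => //= h; apply: IH; lia.
Qed.

Lemma phi_notin i w : i \notin w -> phi i w = 0.
Proof.
by elim: w => [|x w IH] //=; rewrite inE negb_or => /andP[h /IH->]; lia.
Qed.

Lemma eps_sorted i s : sorted leq s -> eps i s = count_mem i.+1 s.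
Proof.
elim: s => [|x s IH] //= hp; rewrite IH ?(path_sorted hp) // addnC.
congr (_ + _); case: (x =P i.+1) => [ex|//].
rewrite phi_notin //; apply/negP=> hi.
by have /allP/(_ _ hi) := order_path_min leq_trans hp; rewrite ex ltnn.
Qed.

(** * Labelled words and the bracketing stack *)

Definition letters (A : Type) (w : seq (nat * A)) : seq nat := map fst w.

Lemma letters_cat (A : Type) (u v : seq (nat * A)) :
  letters (u ++ v) = letters u ++ letters v.
Proof. exact: map_cat. Qed.

Section Signature.
Variables (A : Type) (i : nat).
Implicit Types (w st : seq (nat * A)).

Definition critical x a w :=
  exists w1 w2, [/\ w = w1 ++ (x, a) :: w2, eps i (letters w1) = 0
                  & phi i (letters w2) = 0].

Let stack w := foldl (sig_step i) [::] w.

(* M lists the labels of the uncancelled letters i+1 from right to left, *)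
(* and P those of the uncancelled letters i.                             *)
Let stackP w : exists M P,
  [/\ stack w = map (pair i.+1) M ++ map (pair i) P,
      size M = eps i (letters w), size P = phi i (letters w),
      forall M' a, M = rcons M' a -> critical i.+1 a w
    & forall P' a, P = a :: P' -> critical i a w].
Proof.
rewrite /stack; elim/last_ind: w => [|w [x b] IH].
  by exists [::], [::]; split=> // -[].
have [M [P [hst hM hP cM cP]]] := IH.
rewrite foldl_rcons hst /letters map_rcons -cats1 eps_cat phi_cat /= -/(letters w).
rewrite -hM -hP.
(* Appending [x] keeps a critical letter critical, unless [x] is an [i] with no uncancelled [i.+1]
   behind that letter to cancel with. *)
have ext y a : critical y a w -> ((x == i) = false \/
    forall w1 w2, w = w1 ++ (y, a) :: w2 -> eps i (letters w1) = 0 ->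
      0 < eps i (letters w2)) -> critical y a (rcons w (x, b)).
  move=> [w1 [w2 [-> e1 e2]]] h; exists w1, (rcons w2 (x, b)).
  split; rewrite ?rcons_cat ?rcons_cons //.
  rewrite /letters map_rcons -cats1 phi_cat -/(letters w2) e2 /=.
  by case: h => [->|h]; [lia | have := h _ _ erefl e1; lia].
rewrite /sig_step /=; case: (x =P i.+1) => [ex|nx].
  have xi : (x == i) = false by lia.
  exists (b :: M), P; rewrite xi ex; split=> //=; [lia | lia | | ].
    move=> [|c M'] a /= [e].
      move=> eM; exists w, [::]; rewrite -cats1 e; split=> //.
      by rewrite -hM eM.
    by move=> eM; rewrite -{2}ex; apply: ext (cM _ _ eM) (or_introl xi).
  by move=> P' a eP; rewrite -ex; apply: ext (cP _ _ eP) (or_introl xi).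
case: (x =P i) => [ex|nx'] /=; last first.
  exists M, P; split=> //; [lia | lia | |].
    by move=> M' a e; apply: ext; [apply: cM e | left; apply/eqP].
  by move=> P' a e; apply: ext; [apply: cP e | left; apply/eqP].
case: M hst hM cM ext => [|c M] hst hM cM ext /=.
  have -> : (if map (pair i) P is y :: st'
             then if y.1 == i.+1 then st' else (x, b) :: map (pair i) P
             else [:: (x, b)]) = (x, b) :: map (pair i) P.
    by case: (P) => //= p P'; case: eqP => //; lia.
  exists [::], (b :: P); rewrite ex /=; split=> //; [lia | by case |].
  move=> P' a [<- _]; exists w, [::]; rewrite -cats1; split=> //.
rewrite eqxx; exists M, P; split=> //=; [lia | lia | |].
  move=> M' a eM; have eM' : c :: M = rcons (c :: M') a by rewrite eM.
  apply: ext; [exact: cM eM' | right=> w1 w2 ew e1].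
  move: hM; rewrite eM /= size_rcons ew letters_cat eps_cat /= e1 eqxx; lia.
move=> P' a eP; apply: ext; [exact: cP eP | right=> w1 w2 ew e1].
move: hM; rewrite ew letters_cat eps_cat /= e1.
by rewrite (_ : (i == i.+1) = false); lia.
Qed.

Lemma leftmost_minusP w :
  if leftmost_minus i w is Some a then critical i.+1 a w
  else eps i (letters w) = 0.
Proof.
rewrite /leftmost_minus /signature -/(stack w).
have [M [P [-> <- _ cM _]]] := stackP w.
rewrite filter_rev map_rev filter_cat map_cat rev_cat.
have -> : [seq x.2 | x <- [seq (i, a) | a <- P] & x.1 == i.+1] = [::].
  by elim: (P) => //= a l IH; have -> : (i == i.+1) = false by lia.
have -> : [seq x.2 | x <- [seq (i.+1, a) | a <- M] & x.1 == i.+1] = M.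
  by elim: (M) => //= a l IH; rewrite eqxx /= IH.
case: (lastP M) cM => [|M' a] //= cM; rewrite rev_rcons /=; exact: cM erefl.
Qed.

Lemma rightmost_plusP w :
  if rightmost_plus i w is Some a then critical i a w
  else phi i (letters w) = 0.
Proof.
rewrite /rightmost_plus /signature -/(stack w).
have [M [P [-> _ <- _ cP]]] := stackP w.
rewrite filter_rev map_rev revK filter_cat map_cat.
have -> : [seq x.2 | x <- [seq (i.+1, a) | a <- M] & x.1 == i] = [::].
  by elim: (M) => //= a l IH; have -> : (i.+1 == i) = false by lia.
have -> : [seq x.2 | x <- [seq (i, a) | a <- P] & x.1 == i] = P.
  by elim: (P) => //= a l IH; rewrite eqxx /= IH.
by case: P cP => [|a P] //= cP; apply: cP erefl.
Qed.

End Signature.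

(** * Crystal equivalence of words *)

(** Only a forward match for [e_i] is asked: equal [eps] makes [e_i] defined on both sides at once,
    which gives symmetry, and with equal content it gives equal [phi]. *)
Definition simulation (R : seq nat -> seq nat -> Prop) : Prop :=
  forall u v, R u v ->
    [/\ perm_eq u v, forall i, eps i u = eps i v
      & forall i u', word_e i u = Some u' ->
          exists2 v', word_e i v = Some v' & R u' v'].

(** The union of all simulations. To prove an equivalence it is enough to exhibit one relation that
    the operators [e_i] preserve. *)
Definition ceq (u v : seq nat) : Prop := exists2 R, simulation R & R u v.

Lemma ceq_perm u v : ceq u v -> perm_eq u v.
Proof. by case=> R sR /sR[]. Qed.

Lemma ceq_eps u v i : ceq u v -> eps i u = eps i v.
Proof. by case=> R sR /sR[]. Qed.

Lemma ceq_phi u v i : ceq u v -> phi i u = phi i v.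
Proof.
move=> h; have := phi_eps_count i u; have := phi_eps_count i v.
by rewrite (ceq_eps i h) !(permP (ceq_perm h)); lia.
Qed.

Lemma ceq_word_e u v i u' : ceq u v -> word_e i u = Some u' ->
  exists2 v', word_e i v = Some v' & ceq u' v'.
Proof.
by case=> R sR /sR[_ _ h] /h[v' ev hv]; exists v' => //; exists R.
Qed.

Lemma ceq_refl u : ceq u u.
Proof.
exists eq => // {}u _ <-; split=> // i u' e; by exists u'.
Qed.

Lemma ceq_sym u v : ceq u v -> ceq v u.
Proof.
move=> h; exists (fun a b => ceq b a) => // {h u v} u v h; split.
- by rewrite perm_sym; apply: ceq_perm.
- by move=> i; rewrite (ceq_eps i h).
- move=> i u' eu.
  have /eps_gt0P[v' ev] : 0 < eps i v.
    by rewrite (ceq_eps i h); apply/eps_gt0P; exists u'.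
  have [u'' eu' h'] := ceq_word_e h ev.
  by exists v' => //; move: eu'; rewrite eu => -[->].
Qed.

Lemma ceq_trans v u w : ceq u v -> ceq v w -> ceq u w.
Proof.
move=> h1 h2.
exists (fun a c => exists2 b, ceq a b & ceq b c); last by exists v.
move=> {u v w h1 h2} u w [v h1 h2]; split.
- exact: perm_trans (ceq_perm h1) (ceq_perm h2).
- by move=> i; rewrite (ceq_eps i h1) (ceq_eps i h2).
- move=> i u' /(ceq_word_e h1)[v' /(ceq_word_e h2)[w' ew h2'] h1'].
  by exists w' => //; exists v'.
Qed.

(** By the tensor product rule the factor in which [e_i] acts depends on [eps] and [phi] alone, so
    it is the same factor on both sides. *)
Lemma ceq_cat u u' v v' : ceq u u' -> ceq v v' -> ceq (u ++ v) (u' ++ v').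
Proof.
move=> h1 h2.
exists (fun a b => exists a1 a2 b1 b2,
  [/\ a = a1 ++ a2, b = b1 ++ b2, ceq a1 b1 & ceq a2 b2]); last first.
  by exists u, v, u', v'.
move=> _ _ {u u' v v' h1 h2} [a1 [a2 [b1 [b2 [-> -> h1 h2]]]]]; split.
- exact: perm_cat (ceq_perm h1) (ceq_perm h2).
- by move=> i; rewrite !eps_cat (ceq_eps i h1) (ceq_eps i h2) (ceq_phi i h2).
- move=> i w; rewrite !word_e_cat (ceq_eps i h1) (ceq_phi i h2).
  case: ifP => _.
    case E: (word_e i a1) => [c|] //= [<-].
    have [d -> hd] := ceq_word_e h1 E.
    by exists (d ++ b2) => //; exists c, a2, d, b2.
  case E: (word_e i a2) => [c|] //= [<-].
  have [d -> hd] := ceq_word_e h2 E.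
  by exists (b1 ++ d) => //; exists a1, c, b1, d.
Qed.

(** * Knuth moves and row insertion *)

Definition knuth (u v : seq nat) : Prop :=
  exists x y z,
    [/\ u = [:: y; z; x], v = [:: y; x; z] & x < y <= z] \/
    [/\ u = [:: x; z; y], v = [:: z; x; y] & x <= y < z].

Lemma knuth_perm u v : knuth u v -> perm_eq u v.
Proof.
case=> x [y [z [[-> -> _]|[-> -> _]]]].
  by rewrite perm_cons (perm_catC [:: z] [:: x]).
by rewrite (perm_catCA [:: x] [:: z] [:: y]).
Qed.

Lemma knuth_eps u v i : knuth u v -> eps i u = eps i v.
Proof.
by case=> x [y [z [[-> -> h]|[-> -> h]]]] /=;
  case: (x =P i.+1) => hx; case: (y =P i.+1) => hy; case: (z =P i.+1) => hz;
  case: (x =P i) => hx'; case: (y =P i) => hy'; case: (z =P i) => hz' //=; lia.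
Qed.

(** Both kinds of moves have to be in one relation: with [j = i + 1], [e_i] takes the pair [jji],
    [jij] of the first kind to the pair [iji], [jii] of the second kind. *)
Lemma knuth_word_e u v i u' : knuth u v -> word_e i u = Some u' ->
  exists2 v', word_e i v = Some v' & knuth u' v'.
Proof.
case=> x [y [z [[-> -> h]|[-> -> h]]]] /=.
- case: (x =P i.+1) => hx; case: (y =P i.+1) => hy; case: (z =P i.+1) => hz;
  case: (x =P i) => hx'; case: (y =P i) => hy'; case: (z =P i) => hz'; try lia;
  move=> //= -[<-]; eexists; try reflexivity; subst;
  do 3 eexists; solve [left; split; [reflexivity| reflexivity | lia]
                | right; split; [reflexivity|reflexivity| lia]].
- case: (x =P i.+1) => hx; case: (y =P i.+1) => hy; case: (z =P i.+1) => hz;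
  case: (x =P i) => hx'; case: (y =P i) => hy'; case: (z =P i) => hz'; try lia;
  move=> //= -[<-]; eexists; try reflexivity; subst;
  do 3 eexists; solve [left; split; [reflexivity| reflexivity | lia]
                | right; split; [reflexivity|reflexivity| lia]].
Qed.

Lemma knuth_ceq u v : knuth u v -> ceq u v.
Proof.
move=> h; exists knuth => // {u v h} u v h; split.
- exact: knuth_perm.
- by move=> i; apply: knuth_eps.
- by move=> i u'; apply: knuth_word_e.
Qed.

Definition tab_word (t : filling) : seq nat := flatten (rev t).

Lemma tab_word_cons s t : tab_word (s :: t) = tab_word t ++ s.
Proof. by rewrite /tab_word rev_cons flatten_rcons. Qed.

(** Provides the third letter of the Knuth move by which the bumped entry passes to the front of the
    row. *)
Lemma row_insert_Some x s y s' : sorted leq s ->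
  row_insert x s = (Some y, s') ->
  exists h s'', [/\ s' = h :: s'', h <= x & x < y].
Proof.
case: s => [|z s] //= hs; case: ifP => [hx [<- <-]|hx].
  by exists x, s; split.
case E: (row_insert x s) => [o s1] [eo <-]; exists z, s1; split=> //; first by lia.
elim: s o s1 E eo {hs} => [|a s IH] o s1 /=; first by case=> <-.
case: ifP => [ha [<- _ [<-]] //|_].
by case E: (row_insert x s) => [o' s2] [<- _]; apply: IH E.
Qed.

Lemma ceq_row_insert x s : sorted leq s ->
  let: (o, s') := row_insert x s in
  ceq (rcons s x) (if o is Some y then y :: s' else s').
Proof.
elim: s => [|y s IH] /= hs; first exact: ceq_refl.
have hs' := path_sorted hs; case: ifP => hx.
(* Here [y] is bumped at once: [x] travels left by moves from [yzx] to [yxz] until it stands just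
   behind [y]. *)
- elim: s y hx hs {IH hs'} => [|z s IH] y hx /=; first by move=> _; apply: ceq_refl.
  move=> /andP[hyz hs].
  have hxz : x < z by apply: leq_trans hx hyz.
  have := ceq_cat (ceq_refl [:: y]) (IH _ hxz hs).
  move/ceq_trans; apply.
  have hk : knuth [:: y; z; x] [:: y; x; z].
    by exists x, y, z; left; split=> //; rewrite hx hyz.
  exact: ceq_cat (knuth_ceq hk) (ceq_refl s).
- have := IH hs'; case E: (row_insert x s) => [[z|] s'] hc; last first.
    exact: ceq_cat (ceq_refl [:: y]) hc.
  have := ceq_cat (ceq_refl [:: y]) hc; move/ceq_trans; apply.
  (* The bumped [z] has reached the head [h] of the new tail and still has to pass [y]; the move
     from [yzh] to [zyh] needs [y <= h < z]. *)
  have [h [s'' [es hhx hxz]]] := row_insert_Some hs' E.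
  have hyh : y <= h.
    move: E es hs; case: (s) => [|a s0] //=; case: ifP => _.
      by case=> _ <- [<- _] _; lia.
    case: (row_insert x s0) => o s1 [_ <-] [<- _] /andP[] //.
  rewrite es; have hk : knuth [:: y; z; h] [:: z; y; h].
    by exists y, h, z; right; split=> //; lia.
  exact: ceq_cat (knuth_ceq hk) (ceq_refl s'').
Qed.

(** Rows are read from bottom to top, so a bumped entry put in front of its row stands right behind
    the word of the lower rows, ready to be inserted there. *)
Lemma ceq_tab_insert x t : all (sorted leq) t ->
  ceq (rcons (tab_word t) x) (tab_word (tab_insert x t)).
Proof.
elim: t x => [|s t IH] x; first by move=> _; apply: ceq_refl.
move=> /= /andP[hs ht]; have := ceq_row_insert x hs.
case: (row_insert x s) => [[y|] s'] hc; rewrite !tab_word_cons rcons_cat;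
  apply: (ceq_trans (ceq_cat (ceq_refl _) hc)); last exact: ceq_refl.
by rewrite -cat_rcons; apply: ceq_cat (IH y ht) (ceq_refl _).
Qed.

(** * Semistandard tableaux *)

Definition row_above (s u : seq nat) : bool :=
  (size u <= size s) && all (fun c => nth 0 s c < nth 0 u c) (iota 0 (size u)).

Lemma row_aboveP s u :
  reflect (size u <= size s /\ forall c, c < size u -> nth 0 s c < nth 0 u c)
          (row_above s u).
Proof.
apply: (iffP andP) => -[h1 h2]; split=> //.
  by move=> c hc; apply: (allP h2); rewrite mem_iota.
by apply/allP=> c; rewrite mem_iota => /h2.
Qed.

Definition tableau (t : filling) : bool :=
  [&& all (sorted leq) t, [::] \notin t & sorted row_above t].

Lemma tableau_cons s t :
  tableau (s :: t) =
  [&& sorted leq s, s != [::], row_above s (head [::] t) & tableau t].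
Proof.
rewrite /tableau /= inE negb_or [_ == s]eq_sym; case: t => [|u t] /=.
  by rewrite /row_above /= !andbT.
by case: (sorted leq s) (s != [::]) (row_above s u) => [] [] []; rewrite ?andbF.
Qed.

Lemma row_insert_NoneE x s s' :
  row_insert x s = (None, s') -> s' = rcons s x /\ all (leq^~ x) s.
Proof.
elim: s s' => [|y s IH] s' /=; first by case=> <-.
case: ifP => // hx; case: (row_insert x s) IH => o s1 IH [eo <-].
by have [|-> ->] := IH s1; rewrite ?eo //; split=> //; lia.
Qed.

Lemma row_insert_SomeE x s y s' :
  row_insert x s = (Some y, s') ->
  exists s1 s2, [/\ s = s1 ++ y :: s2, s' = s1 ++ x :: s2,
                    all (leq^~ x) s1 & x < y].
Proof.
elim: s s' => [|z s IH] s' //=.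
case: ifP => [hx [<- <-]|hx]; first by exists [::], s.
case: (row_insert x s) IH => o s1 IH [eo <-].
have [|a [b [-> -> ha hxy]]] := IH s1; first by rewrite eo.
by exists (z :: a), b; split=> //=; lia.
Qed.

Lemma nth_subst (T : Type) (d : T) s1 x y s2 c :
  nth d (s1 ++ y :: s2) c =
  if c == size s1 then y else nth d (s1 ++ x :: s2) c.
Proof.
rewrite !nth_cat; case: ltngtP => [//|h|->]; last by rewrite subnn.
by rewrite -[c - size s1]prednK ?subn_gt0.
Qed.

Lemma sorted_row_insert x s : sorted leq s -> sorted leq (row_insert x s).2.
Proof.
elim: s => [|y s IH] //= hs; case: ifP => hx /=.
  case: s hs {IH} => //= z s /andP[h1 ->].
  by rewrite andbT; lia.
have := IH (path_sorted hs); have hx' : y <= x by lia.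
case: s hs {IH} => [|z s] /=; first by rewrite hx'.
case: ifP => _ /= => [|/andP[h1 h2]]; first by rewrite hx'.
by case: (row_insert x s) => o s' /= ->; rewrite h1.
Qed.

(* Bumping y out of column k of a row and into the next one puts it weakly *)
(* to the left of column k.                                               *)
Lemma tableau_tab_insert x t : tableau t -> tableau (tab_insert x t).
Proof.
suff H y : tableau t -> tableau (tab_insert y t) /\
    forall s1 s2 x, x < y -> all (leq^~ x) s1 ->
      row_above (s1 ++ y :: s2) (head [::] t) ->
      row_above (s1 ++ x :: s2) (head [::] (tab_insert y t)).
  by move=> ht; case: (H x ht).
elim: t y => [|u t IH] y.
  move=> _; split=> // s1 s2 x0 hxy hs1 _ /=.
  by case: s1 hs1 => [|a s1] /=; rewrite /row_above /=; lia.
rewrite tableau_cons => /and4P[hu nu hut ht] /=.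
have hs := sorted_row_insert y hu.
case E: (row_insert y u) hs => [[z|] u'] /= hs.
- have [a [b [eu eu' ha hyz]]] := row_insert_SomeE E.
  have [htz hz] := IH z ht.
  split.
    rewrite tableau_cons htz hs; rewrite eu' in hs *.
    by rewrite hz ?andbT -?eu //; case: (a).
  move=> s1 s2 x0 hxy hs1 /row_aboveP[hsz hc]; apply/row_aboveP.
  rewrite eu' eu !size_cat /= in hsz hc *; split=> // c hcu.
  have hlt := hc _ hcu.
  rewrite (nth_subst 0 s1 y) (nth_subst 0 a z).
  case: (c =P size s1) => [ec|nc]; case: (c =P size a) => [ec'|nc'].
  + lia.
  + move: hlt; rewrite ec nth_cat ltnn subnn /=; lia.
  (* In column [size a] the lower row now has the smaller entry [y]. Left of the bumped column the
     entry above is at most [x0 < y]. Right of it is impossible: column [size s1] would have an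
     entry at most [y] under the old [y]. *)
  + case: (ltnP c (size s1)) => hcs.
      rewrite nth_cat hcs; apply: leq_ltn_trans hxy.
      by apply: (allP hs1); apply: mem_nth.
    have hk : size s1 < size a + (size b).+1 by lia.
    have := hc _ hk; rewrite nth_cat ltnn subnn /= nth_cat.
    have hsa : size s1 < size a by lia.
    have /(allP ha) : nth 0 a (size s1) \in a by apply: mem_nth.
    rewrite hsa.
    by rewrite /=; lia.
  + by [].
- have [eu' hall] := row_insert_NoneE E.
  split.
    rewrite tableau_cons hs ht eu' -cats1 andbT /=; apply/andP; split.
      by case: (u).
    apply/row_aboveP; have /row_aboveP[h1 h2] := hut.
    rewrite size_cat; split=> [|c hc]; first by lia.
    by rewrite nth_cat (leq_trans hc h1); apply: h2.
  move=> s1 s2 x0 hxy hs1 /row_aboveP[hsz hc]; apply/row_aboveP.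
  (* An entry of [u] under the old [y] would exceed [y], but [y] was appended because no entry of
     [u] exceeds it. *)
  have hk : size u <= size s1.
    rewrite leqNgt; apply/negP=> hk; have := hc _ hk.
    rewrite nth_cat ltnn subnn /= => hh.
    by have := allP hall _ (mem_nth 0 hk); rewrite /=; lia.
  rewrite eu' size_rcons !size_cat /= in hsz *; split; first by lia.
  move=> c; rewrite ltnS leq_eqVlt => /orP[/eqP->|hcu].
    rewrite nth_rcons ltnn eqxx nth_cat; case: ifP => [h|h].
      by apply: leq_ltn_trans hxy; apply: (allP hs1); apply: mem_nth.
    by have -> : size u - size s1 = 0 by lia.
  have := hc _ hcu; rewrite nth_rcons hcu !nth_cat.
  by rewrite (leq_trans hcu hk).
Qed.

Lemma insertion_tableau_rcons w x :
  insertion_tableau (rcons w x) = tab_insert x (insertion_tableau w).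
Proof. by rewrite /insertion_tableau foldl_rcons. Qed.

Lemma tableau_insertion w : tableau (insertion_tableau w).
Proof.
elim/last_ind: w => [|w x IH] //; rewrite insertion_tableau_rcons.
exact: tableau_tab_insert.
Qed.

Lemma ceq_insertion w : ceq w (tab_word (insertion_tableau w)).
Proof.
elim/last_ind: w => [|w x IH]; first exact: ceq_refl.
rewrite insertion_tableau_rcons.
have /and3P[hs _ _] := tableau_insertion w.
apply: ceq_trans (ceq_tab_insert x hs).
by rewrite -!cats1; apply: ceq_cat IH (ceq_refl _).
Qed.

Lemma perm_tab_word t : perm_eq (tab_word t) (flatten t).
Proof. by apply: perm_flatten; rewrite perm_rev. Qed.

Lemma tab_word_inj t1 t2 :
  shape t1 = shape t2 -> tab_word t1 = tab_word t2 -> t1 = t2.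
Proof.
move=> es ew; apply: (can_inj revK).
by rewrite -[rev t1]flattenK -[rev t2]flattenK !shape_rev es -/(tab_word t1) ew.
Qed.

Lemma tableau_part t : tableau t -> is_part (shape t).
Proof.
case/and3P=> _ h0 h; rewrite /is_part; apply/andP; split.
  rewrite sorted_map; apply: sub_sorted h => s u /row_aboveP[h _] //.
by apply: contra h0 => /mapP[s hs /esym/size0nil <-].
Qed.

Lemma part_nth mu r r' : is_part mu -> r <= r' -> nth 0 mu r' <= nth 0 mu r.
Proof.
case/andP=> hs _ hr; case: (ltnP r' (size mu)) => h; last by rewrite nth_default.
have := sorted_leq_nth (leT := geq) (fun y x z h1 h2 => leq_trans h2 h1) leqnn 0 hs.
by apply=> //; rewrite inE; lia.
Qed.

Lemma part_nth_gt0 mu r : is_part mu -> (0 < nth 0 mu r) = (r < size mu).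
Proof.
case/andP=> _ h0; case: (ltnP r (size mu)) => h; last by rewrite nth_default.
by rewrite lt0n; apply: contra h0 => /eqP <-; apply: mem_nth.
Qed.

Lemma nth_shape (T : Type) (t : seq (seq T)) r :
  nth 0 (shape t) r = size (nth [::] t r).
Proof.
case: (ltnP r (size t)) => h; first by rewrite (nth_map [::]).
by rewrite !nth_default ?size_map.
Qed.

Lemma flatten_nth_mem (T : eqType) (t : seq (seq T)) x :
  reflect (exists r, x \in nth [::] t r) (x \in flatten t).
Proof.
apply: (iffP flattenP) => [[s /(nthP [::])[r hr <-] hx]|[r hx]].
  by exists r.
exists (nth [::] t r) => //; apply: mem_nth; rewrite ltnNge.
by apply: contraL hx => h; rewrite nth_default.
Qed.

Lemma SSYT_tableau mu t : is_part mu ->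
  SSYT mu t <-> [/\ shape t = mu, tableau t & 0 \notin flatten t].
Proof.
move=> hmu; split.
- case=> es h0 hr hc; rewrite /in_diag -es in h0 hr hc.
  have hsz r : nth 0 mu r = size (nth [::] t r) by rewrite -es nth_shape.
  split=> //.
    apply/and3P; split.
    + apply/(all_nthP [::]) => r hrt; apply/(sortedP 0) => c hcs.
      by apply: hr; rewrite nth_shape.
    + apply: contraL hmu => /(nthP [::])[r hrt e]; rewrite /is_part negb_and.
      rewrite negbK -es; apply/orP; right; apply/mapP; exists (nth [::] t r).
        exact: mem_nth.
      by rewrite e.
    + apply/(sortedP [::]) => r hrt; apply/row_aboveP; split.
        by rewrite -!hsz; apply: part_nth.
      by move=> c hcs; apply: hc; rewrite nth_shape.
  apply/negP => /flatten_nth_mem[r /(nthP 0)[c hc' e]].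
  by have := h0 r c; rewrite nth_shape /entry e => /(_ hc').
- case=> es /and3P[h1 h2 h3] h0; split=> //.
  + move=> r c; rewrite /in_diag -es nth_shape => h; rewrite lt0n.
    apply: contra h0 => /eqP e; apply/flatten_nth_mem; exists r.
    by rewrite -e; apply: mem_nth.
  + move=> r c; rewrite /in_diag -es nth_shape => h.
    case: (ltnP r (size t)) => hr; last by rewrite nth_default in h.
    by have /(all_nthP [::])/(_ _ hr)/(sortedP 0) := h1; apply.
  + move=> r c; rewrite /in_diag -es nth_shape => h.
    case: (ltnP r.+1 (size t)) => hr; last by rewrite nth_default in h.
    by have /(sortedP [::])/(_ _ hr)/row_aboveP[_] := h3; apply.
Qed.

Definition row_labels (t : filling) r :=
  [seq (entry t r c, (r, c)) | c <- iota 0 (size (nth [::] t r))].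

Lemma letters_row_labels t r : letters (row_labels t r) = nth [::] t r.
Proof. by rewrite /letters -map_comp -/(mkseq _ _) mkseq_nth. Qed.

Lemma letters_flatten (A : Type) (w : seq (seq (nat * A))) :
  letters (flatten w) = flatten (map (@letters A) w).
Proof. exact: map_flatten. Qed.

Lemma letters_ssyt_rd t : letters (ssyt_rd t) = tab_word t.
Proof.
rewrite letters_flatten -map_comp /tab_word; congr flatten.
rewrite (eq_map (letters_row_labels t)) map_rev; congr rev.
by rewrite -/(mkseq _ _) mkseq_nth.
Qed.

(** A box holds one letter here, so its label fixes the position in the word. For multiset-valued
    tableaux this fails and [mvt_rd_pos] takes over. *)
Lemma uniq_labels_ssyt_rd t : uniq (unzip2 (ssyt_rd t)).
Proof.
rewrite /ssyt_rd /unzip2 map_flatten -map_comp.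
have -> : [seq ([eta map snd] \o row_labels t) r | r <- rev (iota 0 (size t))]
  = [seq [seq (r, c) | c <- iota 0 (size (nth [::] t r))] | r <- rev (iota 0 (size t))].
  by apply: eq_map => r; rewrite /= /row_labels -map_comp; apply: eq_map.
apply: allpairs_uniq_dep.
- by rewrite rev_uniq iota_uniq.
- by move=> r _; apply: iota_uniq.
- by move=> [a b] [c d] _ _ /= [-> ->].
Qed.

Lemma ssyt_rd_split T1 s1 x s2 T2 :
  exists w1 w2,
    [/\ ssyt_rd (T1 ++ (s1 ++ x :: s2) :: T2) =
          w1 ++ (x, (size T1, size s1)) :: w2,
        letters w1 = tab_word T2 ++ s1 & letters w2 = s2 ++ tab_word T1].
Proof.
set t := _ ++ _; rewrite /ssyt_rd.
have -> : iota 0 (size t) = iota 0 (size T1) ++ size T1 :: iota (size T1).+1 (size T2).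
  by rewrite /t size_cat iotaD /= add0n.
rewrite rev_cat rev_cons map_cat flatten_cat -cats1 map_cat flatten_cat /= cats0.
have et : nth [::] t (size T1) = s1 ++ x :: s2.
  by rewrite /t nth_cat ltnn subnn.
have -> : [seq (entry t (size T1) c, (size T1, c)) | c <- iota 0 (size (nth [::] t (size T1)))]
  = [seq (entry t (size T1) c, (size T1, c)) | c <- iota 0 (size s1)] ++
    (x, (size T1, size s1)) ::
    [seq (entry t (size T1) c, (size T1, c)) | c <- iota (size s1).+1 (size s2)].
  rewrite et size_cat iotaD map_cat /= add0n; congr (_ ++ (_, _) :: _).
  by rewrite /entry et nth_cat ltnn subnn.
rewrite -!catA /= catA; eexists; eexists; split; first by reflexivity.
- rewrite letters_cat; congr (_ ++ _).
    rewrite letters_flatten -map_comp (eq_map (letters_row_labels t)) map_rev.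
    congr (flatten (rev _)).
    rewrite -[in RHS](mkseq_nth [::] T2) -[(size T1).+1]addn0 iotaDl -map_comp.
    apply: eq_map => r /=; rewrite /t nth_cat ifN; last by lia.
    by rewrite addSn subSn ?leq_addr // addKn.
  rewrite /letters -map_comp -[RHS](mkseq_nth 0 s1).
  rewrite /mkseq; apply/eq_in_map => c; rewrite mem_iota /= => hc.
  by rewrite /entry et nth_cat hc.
- rewrite letters_cat; congr (_ ++ _).
    rewrite /letters -map_comp -[RHS](mkseq_nth 0 s2) -[(size s1).+1]addn0 iotaDl -map_comp.
    apply: eq_map => r /=; rewrite /entry et nth_cat ifN; last by lia.
    by rewrite addSn subSn ?leq_addr // addKn.
  rewrite letters_flatten -map_comp (eq_map (letters_row_labels t)) map_rev.
  congr (flatten (rev _)); rewrite -[RHS](mkseq_nth [::] T1).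
  rewrite /mkseq; apply/eq_in_map => c; rewrite mem_iota /= => hc.
  by rewrite /t nth_cat hc.
Qed.

Lemma uniq_cat_cons (A : eqType) (a b : nat * A) u1 u2 v1 v2 :
  u1 ++ a :: u2 = v1 ++ b :: v2 -> a.2 = b.2 -> uniq (unzip2 (u1 ++ a :: u2)) ->
  [/\ u1 = v1, a = b & u2 = v2].
Proof.
move=> e eab; case: (cat_cons_eq e) => [//|[z [-> ->]]|[z [-> ->]]].
- rewrite /unzip2 !map_cat /= map_cat cat_uniq => /and3P[_ _] /=.
  by rewrite mem_cat /= eab inE eqxx orbT.
- rewrite /unzip2 !map_cat /= -catA /= cat_uniq => /and3P[_ _] /=.
  by rewrite mem_cat /= eab inE eqxx orbT.
Qed.

Lemma split_nth (T : Type) (d : T) s k : k < size s ->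
  exists s1 s2, s = s1 ++ nth d s k :: s2 /\ size s1 = k.
Proof.
move=> h; exists (take k s), (drop k.+1 s); split.
  by rewrite -drop_nth // cat_take_drop.
by rewrite size_takel // ltnW.
Qed.

Lemma ssyt_critical i x p t : critical i x p (ssyt_rd t) ->
  exists T1 s1 s2 T2,
    [/\ t = T1 ++ (s1 ++ x :: s2) :: T2, p = (size T1, size s1),
        eps i (tab_word T2 ++ s1) = 0 & phi i (s2 ++ tab_word T1) = 0].
Proof.
case=> w1 [w2 [ew h1 h2]].
have : (x, p) \in ssyt_rd t by rewrite ew mem_cat inE eqxx orbT.
case/flattenP=> s /mapP[r]; rewrite mem_rev mem_iota /= add0n => hr -> /mapP[c].
rewrite mem_iota /= add0n => hc [ex ep].
have [T1 [T2 [et er]]] := split_nth [::] hr.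
have [s1 [s2 [es ec]]] := split_nth 0 hc.
exists T1, s1, s2, T2.
have et' : t = T1 ++ (s1 ++ x :: s2) :: T2 by rewrite ex /entry -es.
have [v1 [v2 [ev e1 e2]]] := ssyt_rd_split T1 s1 x s2 T2.
have := ew; rewrite et' ev => e.
have epl : p = (size T1, size s1) by rewrite ep er ec.
have hu : uniq (unzip2 (v1 ++ (x, (size T1, size s1)) :: v2)).
  by rewrite -ev uniq_labels_ssyt_rd.
have [ev1 _ ev2] := uniq_cat_cons e (esym epl) hu.
by rewrite -e1 -e2 ev1 ev2; split.
Qed.

Lemma set_nth_cat (T : Type) (d : T) s1 x y s2 :
  set_nth d (s1 ++ x :: s2) (size s1) y = s1 ++ y :: s2.
Proof. by elim: s1 => [|z s1 IH] //=; rewrite IH. Qed.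

Lemma set_entry_cat T1 s1 x s2 T2 y :
  set_entry (T1 ++ (s1 ++ x :: s2) :: T2) (size T1, size s1) y =
  T1 ++ (s1 ++ y :: s2) :: T2.
Proof. by rewrite /set_entry /= nth_cat ltnn subnn /= !set_nth_cat. Qed.

Lemma tab_word_split T1 s1 x s2 T2 :
  tab_word (T1 ++ (s1 ++ x :: s2) :: T2) =
  (tab_word T2 ++ s1) ++ x :: (s2 ++ tab_word T1).
Proof.
by rewrite /tab_word rev_cat rev_cons flatten_cat flatten_rcons -!catA.
Qed.

Lemma shape_split T1 (s1 : seq nat) x y s2 T2 :
  shape (T1 ++ (s1 ++ x :: s2) :: T2) = shape (T1 ++ (s1 ++ y :: s2) :: T2).
Proof. by rewrite /shape !map_cat /= !size_cat. Qed.

Lemma ssyt_e_word i t :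
  if ssyt_e i t is Some t' then
    word_e i (tab_word t) = Some (tab_word t') /\ shape t' = shape t
  else eps i (tab_word t) = 0.
Proof.
rewrite /ssyt_e; have := leftmost_minusP i (ssyt_rd t).
case: leftmost_minus => [p /ssyt_critical[T1 [s1 [s2 [T2 [-> -> h1 h2]]]]]|] /=.
  rewrite set_entry_cat; split; last exact: shape_split.
  rewrite !tab_word_split; apply/word_eP.
  by exists (tab_word T2 ++ s1), (s2 ++ tab_word T1).
by rewrite letters_ssyt_rd.
Qed.

Lemma ssyt_f_word i t :
  if ssyt_f i t is Some t' then
    word_e i (tab_word t') = Some (tab_word t) /\ shape t' = shape t
  else phi i (tab_word t) = 0.
Proof.
rewrite /ssyt_f; have := rightmost_plusP i (ssyt_rd t).
case: rightmost_plus => [p /ssyt_critical[T1 [s1 [s2 [T2 [-> -> h1 h2]]]]]|] /=.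
  rewrite set_entry_cat; split; last exact: shape_split.
  rewrite !tab_word_split; apply/word_eP.
  by exists (tab_word T2 ++ s1), (s2 ++ tab_word T1).
by rewrite letters_ssyt_rd.
Qed.

Lemma phi_sorted i s : sorted leq s -> phi i s = count_mem i s.
Proof.
move=> /(eps_sorted i); have := phi_eps_count i s; lia.
Qed.

(** Above an [i.+1] of [s] stands an entry of [u] that is less than [i.+1] and at least [i], hence
    an [i]. *)
Lemma count_mem_dominated i s u : size s <= size u ->
  (forall c, c < size s -> nth 0 u c < nth 0 s c) -> all (leq i) u ->
  count_mem i.+1 s <= count_mem i u.
Proof.
elim: s u => [|x s IH] [|y u] //= hs h /andP[hy hu].
have := h 0 erefl; rewrite /= => hxy.
have : count_mem i.+1 s <= count_mem i u.
  by apply: IH => // c hc; have := h c.+1; apply.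
move: (count_mem _ _) (count_mem _ _) => a b; lia.
Qed.

Lemma nth_cat_cons (T : Type) (d : T) s x t k :
  nth d (s ++ x :: t) (size s + k.+1) = nth d t k.
Proof. by rewrite nth_cat ltnNge leq_addr addKn. Qed.

Lemma tableau_e_stable i T1 s1 s2 T2 :
  tableau (T1 ++ (s1 ++ i.+1 :: s2) :: T2) ->
  eps i (tab_word T2 ++ s1) = 0 -> phi i (s2 ++ tab_word T1) = 0 ->
  tableau (T1 ++ (s1 ++ i :: s2) :: T2).
Proof.
case/and3P=> h1 h2 h3 hl hr.
move: h1; rewrite all_cat /= => /and3P[a1 hs a2].
have hs' : sorted leq (s1 ++ i :: s2).
  move: hs; rewrite !sorted_cat_cons => /andP[hs1 hs2]; apply/andP; split.
    (* The entry to the left is not [i.+1], since directly before the critical letter it would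
       remain uncancelled. *)
    case: (lastP s1) hs1 hl => [|s1' z] //.
    rewrite -!cats1 -!catA /= !sorted_cat_cons /= !andbT => /andP[-> hz].
    by rewrite catA eps_cat /=; lia.
  by case: (s2) hs2 => //= z s2' /andP[h ->]; rewrite andbT; lia.
apply/and3P; split.
- by rewrite all_cat /= a1 hs' a2.
- move: h2; rewrite !mem_cat !inE !negb_or => /and3P[-> _ ->].
  by case: (s1).
- move: h3; rewrite !sorted_cat_cons => /andP[ha hb]; apply/andP; split; last first.
    case: (T2) hb => //= u T2' /andP[/row_aboveP[h4 h5] ->]; rewrite andbT.
    apply/row_aboveP; move: h4; rewrite !size_cat; split=> // c hc.
    have := h5 c hc; rewrite (nth_subst 0 s1 i.+1 i).
    by case: eqP => // ->; rewrite nth_cat ltnn subnn /=; lia.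
  move: ha; case: (lastP T1) hr a1 => [|T1' u] //.
  rewrite -!cats1 -!catA all_cat /= andbT => hr /andP[_ hu].
  rewrite !sorted_cat_cons /= !andbT => /andP[-> /row_aboveP[h4 h5]].
  apply/row_aboveP; move: h4; rewrite !size_cat /= => h4; split=> // c hc.
  have := h5 c; rewrite (nth_subst 0 s1 i.+1 i) size_cat => /(_ hc).
  case: eqP => // ec; rewrite ec nth_cat ltnn subnn /= ltnS leq_eqVlt.
  case/orP=> // /eqP ei; exfalso.
  (* Each i+1 to the right in this row has an i just above it, so the row  *)
  (* above contains more letters i than can be cancelled.                  *)
  have hk : size s1 < size u by lia.
  have [u1 [u2 [eu eu1]]] := split_nth 0 hk.
  rewrite ei in eu.
  have hcount : count_mem i.+1 s2 <= count_mem i u2.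
    apply: count_mem_dominated.
    - by move: h4; rewrite eu size_cat eu1 /=; lia.
    - move=> d hd; have := h5 (size s1 + d.+1); rewrite size_cat /= => h.
      have : nth 0 u (size s1 + d.+1) < nth 0 (s1 ++ i.+1 :: s2) (size s1 + d.+1).
        by apply: h; lia.
      by rewrite nth_cat_cons eu -eu1 nth_cat_cons.
    - move: hu; rewrite eu sorted_cat_cons => /andP[_] /(order_path_min leq_trans).
      by [].
  move: hr; rewrite cats1 /tab_word rev_rcons /= catA phi_cat.
  rewrite phi_cat phi_sorted; last by case/cat_sorted2: hs => _ /= /path_sorted.
  rewrite eps_sorted; last by case/cat_sorted2: hs => _ /= /path_sorted.
  rewrite (phi_sorted _ hu) {1}eu count_cat /= eqxx; move: hcount.
  move: (count_mem i u2) (count_mem i.+1 s2) => a b; lia.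
Qed.

Definition positive (w : seq nat) : bool := 0 \notin w.

Lemma positive_word_e i w w' :
  0 < i -> word_e i w = Some w' -> positive w' = positive w.
Proof.
move=> hi /word_eP[w1 [w2 [-> -> _ _]]].
by rewrite /positive !mem_cat !inE; case: i hi.
Qed.

Lemma tableau_word_e i t w' : tableau t -> word_e i (tab_word t) = Some w' ->
  exists t', [/\ tab_word t' = w', tableau t' & shape t' = shape t].
Proof.
move=> ht ew; have := ssyt_e_word i t; rewrite /ssyt_e.
have := leftmost_minusP i (ssyt_rd t).
case: leftmost_minus => [p /ssyt_critical[T1 [s1 [s2 [T2 [et ep h1 h2]]]]]|] /=.
  rewrite et ep set_entry_cat -et ew => -[[ew'] es].
  exists (T1 ++ (s1 ++ i :: s2) :: T2); split=> //.
  by apply: tableau_e_stable => //; rewrite -et.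
by move=> _ /eqP; rewrite -word_e_None ew.
Qed.

(** * Highest weight tableaux and rigidity of tableaux *)

Fixpoint yamanouchi (a : nat) (mu : seq nat) : filling :=
  if mu is m :: mu' then nseq m a :: yamanouchi a.+1 mu' else [::].

Lemma shape_yamanouchi a mu : shape (yamanouchi a mu) = mu.
Proof. by elim: mu a => [|m mu IH] a //=; rewrite size_nseq IH. Qed.

Lemma mem_yamanouchi a mu x :
  x \in flatten (yamanouchi a mu) -> a <= x < a + size mu.
Proof.
elim: mu a => [|m mu IH] a //=; rewrite mem_cat => /orP[|/IH]; last by lia.
by rewrite mem_nseq => /andP[_ /eqP->]; lia.
Qed.

Lemma count_yamanouchi a mu r :
  count_mem (a + r) (flatten (yamanouchi a mu)) = nth 0 mu r.
Proof.
elim: mu a r => [|m mu IH] a r; first by rewrite nth_nil.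
rewrite /= count_cat count_nseq; case: r => [|r] /=.
  rewrite addn0 eqxx mul1n (count_memPn _) ?addn0 //.
  by apply/negP=> /mem_yamanouchi; rewrite ltnn.
by rewrite (_ : (a == a + r.+1) = false) ?mul0n -?addSnnS ?IH //; lia.
Qed.

Lemma tableau_gt a s t : tableau (s :: t) -> all (leq a) s ->
  all (leq a.+1) (flatten t).
Proof.
elim: t a s => [|u t IH] a s //=; rewrite tableau_cons => /and4P[_ _ hsu hut] hs.
have hu : all (leq a.+1) u.
  have /row_aboveP[h1 h2] := hsu.
  apply/(all_nthP 0) => c hc; apply: leq_ltn_trans (h2 _ hc).
  by apply: (allP hs); apply: mem_nth; apply: leq_trans h1.
rewrite all_cat hu /=; apply: sub_all (IH _ _ hut hu) => x /=; lia.
Qed.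

(** The first row is read last, so an entry [x > a] in it would be an uncancelled [i.+1] for
    [i = x - 1]. A first row of letters [a] cancels nothing for [i > a], so the lower rows satisfy
    the same hypothesis from [a.+1] on. *)
Lemma tableau_hw a n t : tableau t ->
  (forall x, x \in flatten t -> a <= x <= n) ->
  (forall i, a <= i < n -> eps i (tab_word t) = 0) ->
  t = yamanouchi a (shape t).
Proof.
elim: t a => [|s t IH] a // ht hx he.
move: (ht); rewrite tableau_cons => /and4P[hs ns hst ht'].
have es : s = nseq (size s) a.
  apply/all_pred1P/allP=> x hxs /=.
  have /andP[ha hn] : a <= x <= n by apply: hx; rewrite /= mem_cat hxs.
  rewrite eqn_leq ha andbT leqNgt; apply/negP=> hax.
  have hi : a <= x.-1 < n by lia.
  have := he _ hi; rewrite tab_word_cons eps_cat (eps_sorted _ hs).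
  rewrite prednK; last by lia.
  by move: hxs; rewrite -has_pred1 has_count; lia.
rewrite /= -es; congr cons; apply: IH => //.
- move=> x hxt; have /andP[_ ->] : a <= x <= n.
    by apply: hx; rewrite /= mem_cat hxt orbT.
  rewrite andbT; apply: (allP (tableau_gt ht _)) hxt.
  by rewrite es all_nseq leqnn orbT.
- move=> i hi; have hi' : a <= i < n by lia.
  have := he _ hi'; rewrite tab_word_cons eps_cat.
  rewrite (phi_notin (w := s)); first by lia.
  by rewrite es mem_nseq negb_and; apply/orP; right; lia.
Qed.

Lemma part_eq mu nu : is_part mu -> is_part nu -> nth 0 mu =1 nth 0 nu -> mu = nu.
Proof.
move=> hmu hnu h; apply: (@eq_from_nth _ 0) => [|r _]; last exact: h.
have hsz r : (r < size mu) = (r < size nu) by rewrite -!part_nth_gt0 // h.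
by have := hsz (size mu); have := hsz (size nu); rewrite !ltnn; lia.
Qed.

(* Applying operators e_i raises both tableaux simultaneously to the unique *)
(* highest weight tableau of their common weight.                           *)
Lemma tableau_ceq_inj t1 t2 : tableau t1 -> tableau t2 ->
  positive (tab_word t1) -> ceq (tab_word t1) (tab_word t2) -> t1 = t2.
Proof.
have [m] := ubnP (sumn (tab_word t1)).
elim: m t1 t2 => // m IH t1 t2 hm h1 h2 hp hc.
case: (pselect (exists2 i, 0 < i & 0 < eps i (tab_word t1))).
  case=> i hi /eps_gt0P[w1 e1].
  have [w2 e2 hc'] := ceq_word_e hc e1.
  have [t1' [ew1 h1' es1]] := tableau_word_e h1 e1.
  have [t2' [ew2 h2' es2]] := tableau_word_e h2 e2.
  have et : t1' = t2'.
    apply: IH; rewrite ?ew1 ?ew2 //.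
      by move: hm; rewrite (word_e_sumn e1).
    by rewrite (positive_word_e hi e1).
  (* Equality of the raised tableaux is enough, because [e_i] is injective on words. *)
  apply: tab_word_inj; first by rewrite -es1 -es2 et.
  by apply: word_e_inj e1 _; rewrite e2 -ew1 -ew2 et.
move=> hn.
have he i : 0 < i -> eps i (tab_word t1) = 0.
  by move=> hi; apply/eqP; rewrite -leqn0 leqNgt; apply/negP=> h; apply: hn; exists i.
have hw := ceq_perm hc.
have hw' : perm_eq (flatten t1) (flatten t2).
  rewrite -(permPl (perm_tab_word t1)) -(permPr (perm_tab_word t2)); exact: hw.
(* All [i > 0] are available here, so any bound on the entries can serve as the [n] of [tableau_hw];
   the maximum is taken. *)
have hp' x : x \in flatten t1 -> 1 <= x <= foldr maxn 0 (flatten t1).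
  move=> hx; apply/andP; split.
    rewrite lt0n; apply: contra hp => /eqP <-.
    by rewrite (perm_mem (perm_tab_word t1)).
  elim: (flatten t1) hx => //= y s IHs; rewrite inE => /orP[/eqP->|/IHs]; lia.
have e1 : t1 = yamanouchi 1 (shape t1).
  by apply: tableau_hw h1 hp' _ => i /andP[hi _]; apply: he.
have e2 : t2 = yamanouchi 1 (shape t2).
  apply: tableau_hw h2 _ _ => [x|i /andP[hi _]].
    by rewrite -(perm_mem hw'); apply: hp'.
  by rewrite -(ceq_eps i hc); apply: he.
rewrite e1 e2; congr yamanouchi.
apply: part_eq; try exact: tableau_part.
move=> r; rewrite -(count_yamanouchi 1) -[in RHS](count_yamanouchi 1) -e1 -e2.
exact: (permP hw').
Qed.

Lemma insertion_tab_word t : tableau t -> positive (tab_word t) ->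
  insertion_tableau (tab_word t) = t.
Proof.
move=> ht hp; apply/esym/tableau_ceq_inj => //; first exact: tableau_insertion.
exact: ceq_insertion.
Qed.

Lemma positive_insertion w :
  positive (tab_word (insertion_tableau w)) = positive w.
Proof. by rewrite /positive (perm_mem (ceq_perm (ceq_insertion w))). Qed.

(** Raising the insertion tableau of [w] gives a tableau of the same shape equivalent to [w']. The
    insertion tableau of [w'] is another one, and rigidity identifies the two. *)
Lemma insertion_word_e i w w' : 0 < i -> positive w -> word_e i w = Some w' ->
  word_e i (tab_word (insertion_tableau w)) =
    Some (tab_word (insertion_tableau w')) /\
  shape (insertion_tableau w') = shape (insertion_tableau w).
Proof.
move=> hi hp e; have [v ev hv] := ceq_word_e (ceq_insertion w) e.
have [t' [et ht' es]] := tableau_word_e (tableau_insertion w) ev.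
suff -> : insertion_tableau w' = t' by rewrite ev et es.
apply: tableau_ceq_inj => //; first exact: tableau_insertion.
  by rewrite positive_insertion (positive_word_e hi e).
by rewrite et; apply: ceq_trans hv; apply/ceq_sym/ceq_insertion.
Qed.

Lemma ssyt_eP i t t' :
  ssyt_e i t = Some t' <->
  word_e i (tab_word t) = Some (tab_word t') /\ shape t' = shape t.
Proof.
have := ssyt_e_word i t; case: (ssyt_e i t) => [t''|].
  case=> e es; split=> [[<-] //|[]]; rewrite e => -[ew es'].
  by rewrite (tab_word_inj _ ew) // es es'.
by move/eqP; rewrite -word_e_None => /eqP->; split=> // -[].
Qed.

Lemma ssyt_fP i t t' :
  ssyt_f i t = Some t' <->
  word_e i (tab_word t') = Some (tab_word t) /\ shape t' = shape t.
Proof.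
have := ssyt_f_word i t; case: (ssyt_f i t) => [t''|].
  case=> e es; split=> [[<-] //|[e' es']].
  by rewrite (@tab_word_inj t'' t') ?es ?es' //; apply: word_e_inj e e'.
move=> h; split=> // -[/word_e_phi]; by rewrite h.
Qed.

Lemma ssyt_e_stable i mu t t' : 0 < i -> is_part mu -> SSYT mu t ->
  ssyt_e i t = Some t' -> SSYT mu t'.
Proof.
move=> hi hmu /(SSYT_tableau _ hmu)[es ht h0] /ssyt_eP[e es'].
apply/SSYT_tableau=> //; have [t'' [ew ht' es'']] := tableau_word_e ht e.
have -> : t' = t'' by apply: tab_word_inj; rewrite ?es' ?es''.
split=> //; first by rewrite es''.
have := positive_word_e hi e; rewrite -ew /positive.
by rewrite !(perm_mem (perm_tab_word _)) h0.
Qed.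

(** The tableau conditions are not checked on [t'] directly. The insertion tableau of its word is
    also raised to [t], so injectivity of [e_i] shows that [t'] is that insertion tableau. *)
Lemma ssyt_f_stable i mu t t' : 0 < i -> is_part mu -> SSYT mu t ->
  ssyt_f i t = Some t' -> SSYT mu t'.
Proof.
move=> hi hmu /(SSYT_tableau _ hmu)[es ht h0] /ssyt_fP[e es'].
have hp : positive (tab_word t) by rewrite /positive (perm_mem (perm_tab_word _)).
have hp' : positive (tab_word t') by rewrite -(positive_word_e hi e).
have [] := insertion_word_e hi hp' e; rewrite (insertion_tab_word ht hp) => ew esh.
have -> : t' = insertion_tableau (tab_word t').
  by apply: tab_word_inj; [rewrite es' -esh | apply: word_e_inj e ew].
apply/SSYT_tableau=> //; split; [by rewrite -esh | exact: tableau_insertion |].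
by rewrite -(perm_mem (perm_tab_word _)) -/(positive _) positive_insertion.
Qed.

(** * Reading words of multiset-valued tableaux *)

Definition mins (A : nat -> mbox) (c : nat) (s : seq nat) :=
  [seq (box_min (A r), (r, c)) | r <- s].
Definition rests (A : nat -> mbox) (c : nat) (s : seq nat) :=
  flatten [seq [seq (x, (r, c)) | x <- behead (A r)] | r <- s].

Lemma mvt_rd_colE T c :
  mvt_rd_col T c = mins (box T ^~ c) c (rev (iota 0 (col_height T c))) ++
                   rests (box T ^~ c) c (iota 0 (col_height T c)).
Proof. by []. Qed.

Lemma iota_split r h : r < h ->
  iota 0 h = iota 0 r ++ r :: iota r.+1 (h - r.+1).
Proof. by move=> hr; rewrite -{1}(subnKC hr) addSnnS iotaD add0n. Qed.

Lemma mins_cat A c s s' : mins A c (s ++ s') = mins A c s ++ mins A c s'.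
Proof. exact: map_cat. Qed.

Lemma rests_cat A c s s' : rests A c (s ++ s') = rests A c s ++ rests A c s'.
Proof. by rewrite /rests map_cat flatten_cat. Qed.

Lemma rests_cons A c r s :
  rests A c (r :: s) = [seq (x, (r, c)) | x <- behead (A r)] ++ rests A c s.
Proof. by []. Qed.

(** A column word is cut at the entries of box [(r, c)]: minima of the lower boxes ([col_pre]),
    minimum of the box, minima and then other entries of the higher boxes ([col_mid]), other entries
    of the box, other entries of the lower boxes ([col_suf]). *)
Definition col_pre A c h r := mins A c (rev (iota r.+1 (h - r.+1))).
Definition col_mid A c r := mins A c (rev (iota 0 r)) ++ rests A c (iota 0 r).
Definition col_suf A c h r := rests A c (iota r.+1 (h - r.+1)).

Lemma mvt_rd_col_split T r c : r < col_height T c ->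
  mvt_rd_col T c =
  col_pre (box T ^~ c) c (col_height T c) r ++
  (box_min (box T r c), (r, c)) :: col_mid (box T ^~ c) c r ++
  [seq (x, (r, c)) | x <- behead (box T r c)] ++
  col_suf (box T ^~ c) c (col_height T c) r.
Proof.
move=> hr; rewrite mvt_rd_colE (iota_split hr) rev_cat rev_cons.
by rewrite mins_cat -cats1 mins_cat rests_cat rests_cons -!catA.
Qed.

Lemma mem_mins A c s x r' c' :
  ((x, (r', c')) \in mins A c s) = [&& r' \in s, c' == c & x == box_min (A r')].
Proof.
apply/mapP/idP => [[r hr [-> -> ->]]|/and3P[hr /eqP-> /eqP->]].
  by rewrite hr !eqxx.
by exists r'.
Qed.

Lemma mem_rests A c s x r' c' :
  ((x, (r', c')) \in rests A c s) = [&& r' \in s, c' == c & x \in behead (A r')].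
Proof.
apply/flattenP/idP => [[_ /mapP[r hr ->] /mapP[y hy [-> -> ->]]]|].
  by rewrite hr eqxx hy.
case/and3P=> hr /eqP-> hx; exists [seq (x0, (r', c)) | x0 <- behead (A r')].
  by apply/mapP; exists r'.
by apply: map_f.
Qed.

Lemma mem_box (A : mbox) x : A <> [::] ->
  (x \in A) = (x == box_min A) || (x \in behead A).
Proof. by case: A. Qed.

Lemma box_min_mem (A : mbox) : A <> [::] -> box_min A \in A.
Proof. by case: A => // a A _; rewrite mem_head. Qed.

Lemma box_max_mem (A : mbox) : A <> [::] -> box_max A \in A.
Proof. by case: A => // a A _; rewrite /box_max /= mem_last. Qed.

Lemma box_min_le (A : mbox) x : sorted leq A -> x \in A -> box_min A <= x.
Proof.
case: A => // a A /= h; rewrite inE => /orP[/eqP-> //|].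
exact: (allP (order_path_min leq_trans h)).
Qed.

Lemma box_max_ge (A : mbox) x : sorted leq A -> x \in A -> x <= box_max A.
Proof.
case/lastP: A => // A a h; rewrite /box_max last_rcons mem_rcons inE.
case/orP=> [/eqP-> //|hx].
move: h; rewrite -cats1 sorted_pairwise; last exact: leq_trans.
by rewrite pairwise_cat allrel1r => /and3P[/allP/(_ _ hx)].
Qed.

Lemma sorted_behead (A : mbox) : sorted leq A -> sorted leq (behead A).
Proof. by case: A => //= a A /path_sorted. Qed.

Lemma count_ltn_part lam c r : is_part lam ->
  (r < count (ltn c) lam) = in_diag lam r c.
Proof.
rewrite /is_part /in_diag => /andP[hs _].
elim: lam hs r => [|m lam IH] hs r; first by rewrite nth_nil.
have hs' := path_sorted hs; rewrite /=; case: r => [|r] /=.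
  case: (ltnP c m) => hm //=; rewrite add0n; apply/negbTE; rewrite -leqNgt leqn0.
  rewrite -[_ == 0]negbK -lt0n -has_count; apply/hasPn => x hx /=.
  have /allP/(_ _ hx) : all (geq m) lam.
    by apply: order_path_min hs => a b d h1 h2; apply: leq_trans h2 h1.
  by rewrite /=; lia.
case: (ltnP c m) => hm; rewrite ?add1n ?add0n ?ltnS ?IH //.
rewrite -IH // (_ : count _ _ = 0).
  rewrite ltn0; apply/esym/negbTE; rewrite -leqNgt.
  apply: leq_trans hm; case: (ltnP r (size lam)) => h; last by rewrite nth_default.
  have /allP : all (geq m) lam.
    by apply: order_path_min hs => a b d h1 h2; apply: leq_trans h2 h1.
  by apply; apply: mem_nth.
apply/eqP; rewrite -[_ == 0]negbK -lt0n -has_count; apply/hasPn => x hx /=.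
have /allP/(_ _ hx) : all (geq m) lam.
  by apply: order_path_min hs => a b d h1 h2; apply: leq_trans h2 h1.
by rewrite /=; lia.
Qed.

Lemma in_diagW lam r r' c c' : is_part lam -> r <= r' -> c <= c' ->
  in_diag lam r' c' -> in_diag lam r c.
Proof.
by rewrite /in_diag => hl hr hc h; have := part_nth hl hr; lia.
Qed.

Lemma in_diag_ncols lam r c : is_part lam -> in_diag lam r c -> c < head 0 lam.
Proof. by move=> hl /(in_diagW hl (leq0n r) (leqnn c)); rewrite /in_diag nth0. Qed.

Lemma pairwise_flatten_iota (A : Type) (R : rel A) (F : nat -> seq A) a k :
  (forall c, a <= c < a + k -> pairwise R (F c)) ->
  (forall c c', a <= c -> c < c' -> c' < a + k -> allrel R (F c) (F c')) ->
  pairwise R (flatten [seq F c | c <- iota a k]).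
Proof.
elim: k a => [|k IH] a h1 h2 //=; rewrite pairwise_cat h1 ?IH //=; first last.
- by lia.
- by move=> c c' h3 h4 h5; apply: h2; lia.
- by move=> c hc; apply: h1; lia.
rewrite andbT.
have all_fl ss : all (allrel R (F a)) ss -> allrel R (F a) (flatten ss).
  elim: ss => [|s ss IHs] /=; first by rewrite allrel0r.
  by rewrite allrel_catr => /andP[-> /IHs].
apply: all_fl; rewrite all_map; apply/allP => c; rewrite mem_iota /= => hc.
by apply: h2; lia.
Qed.

Implicit Types (T : mtab).

(* Row condition and column condition of a tableau, seen on its reading word *)
Definition rd_ord (p q : nat * (nat * nat)) : bool :=
  (p.2.2 <= q.2.2) && ((p.2.1 <= q.2.1) ==> (p.1 <= q.1)).

Definition rd_before T c := flatten [seq mvt_rd_col T c' | c' <- iota 0 c].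

Lemma mvt_rd_from_split T j c : j <= c < ncols T ->
  mvt_rd_from T j =
  flatten [seq mvt_rd_col T c' | c' <- iota j (c - j)] ++
  mvt_rd_col T c ++ mvt_rd_from T c.+1.
Proof.
move=> hc; rewrite /mvt_rd_from.
have -> : ncols T - j = (c - j) + (ncols T - c.+1).+1 by lia.
rewrite iotaD map_cat flatten_cat /= subnKC; last by lia.
by [].
Qed.

Lemma mvt_rd_split T c : c < ncols T ->
  mvt_rd T = rd_before T c ++ mvt_rd_col T c ++ mvt_rd_from T c.+1.
Proof. by move=> hc; rewrite /mvt_rd (@mvt_rd_from_split T 0 c) // subn0. Qed.

Definition labelled r c (S : mbox) : seq (nat * (nat * nat)) :=
  [seq (x, (r, c)) | x <- S].

Lemma letters_labelled r c S : letters (labelled r c S) = S.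
Proof. by rewrite /letters -map_comp map_id. Qed.

Lemma cat_notinl (A : eqType) (s1 s2 z w : seq A) p :
  s1 ++ s2 = z ++ p :: w -> p \notin s1 ->
  exists z', z = s1 ++ z' /\ s2 = z' ++ p :: w.
Proof.
elim: s1 z => [|a s1 IH] z /=; first by exists z.
case: z => [|b z] /= [-> e]; rewrite inE negb_or; first by rewrite eqxx.
by case/andP=> _ /(IH _ e)[z' [-> ->]]; exists z'.
Qed.

Lemma cat_notinr (A : eqType) (s1 s2 z w : seq A) p :
  s1 ++ s2 = z ++ p :: w -> p \notin s2 ->
  exists w', w = w' ++ s2 /\ s1 = z ++ p :: w'.
Proof.
elim: s1 z => [|a s1 IH] z /=; first by move=> ->; rewrite mem_cat mem_head orbT.
case: z => [|b z] /= [-> e]; first by exists s1.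
by case/(IH _ e)=> w' [-> ->]; exists w'.
Qed.

Lemma shape_set_box T r c A : in_diag (shape T) r c ->
  shape (set_box T r c A) = shape T.
Proof.
rewrite /in_diag nth_shape => hc.
have hr : r < size T.
  by rewrite ltnNge; apply/negP => h; rewrite nth_default in hc.
apply: (@eq_from_nth _ 0).
  by rewrite !size_map size_set_nth (maxn_idPr _).
move=> k _; rewrite !nth_shape /set_box nth_set_nth /=.
by case: eqP => // ->; rewrite size_set_nth (maxn_idPr _).
Qed.

Lemma box_set_box T r c A r' c' :
  box (set_box T r c A) r' c' = if (r', c') == (r, c) then A else box T r' c'.
Proof.
rewrite /box /set_box nth_set_nth /= xpair_eqE; case: eqP => //= ->.
by rewrite nth_set_nth.
Qed.

Lemma col_eq_off T T' r c : shape T' = shape T ->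
  (forall r', r' != r -> box T' r' c = box T r' c) ->
  [/\ col_pre (box T' ^~ c) c (col_height T' c) r =
        col_pre (box T ^~ c) c (col_height T c) r,
      col_mid (box T' ^~ c) c r = col_mid (box T ^~ c) c r
    & col_suf (box T' ^~ c) c (col_height T' c) r =
        col_suf (box T ^~ c) c (col_height T c) r].
Proof.
move=> es hb; rewrite /col_height es.
by split; rewrite /col_pre /col_mid /col_suf /mins /rests;
  [|congr (_ ++ flatten _)|congr flatten]; apply/eq_in_map => r';
  rewrite ?mem_rev mem_iota => hr /=; rewrite hb //; lia.
Qed.

Lemma mvt_rd_col_eq T T' c : shape T' = shape T ->
  (forall r', box T' r' c = box T r' c) -> mvt_rd_col T' c = mvt_rd_col T c.
Proof.
move=> es hb; rewrite !mvt_rd_colE /col_height es /mins /rests.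
by congr (_ ++ flatten _); apply: eq_map => r; rewrite hb.
Qed.

Lemma perm_rem_cat (x : nat) A1 A2 :
  perm_eq (rem x (A1 ++ x :: A2)) (A1 ++ A2).
Proof.
rewrite -(perm_cons x) perm_sym; apply: (@perm_trans _ (A1 ++ x :: A2)).
  by rewrite -cat1s perm_catCA.
by apply: perm_to_rem; rewrite mem_cat mem_head orbT.
Qed.

Lemma sort_replace x y A1 A2 : sorted leq (A1 ++ y :: A2) ->
  sort leq (y :: rem x (A1 ++ x :: A2)) = A1 ++ y :: A2.
Proof.
move=> hs; apply: (sorted_eq leq_trans anti_leq _ hs).
  exact: sort_sorted leq_total _.
rewrite perm_sort; apply: perm_trans (_ : perm_eq (y :: A1 ++ A2) _).
  by rewrite perm_cons perm_rem_cat.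
by rewrite -cat1s perm_catCA.
Qed.

Lemma rem_replace x A1 A2 : sorted leq (A1 ++ x :: A2) ->
  rem x (A1 ++ x :: A2) = A1 ++ A2.
Proof.
move=> hs; apply: (sorted_eq leq_trans anti_leq _ _ (perm_rem_cat x A1 A2)).
  exact: (subseq_sorted leq_trans (rem_subseq x _) hs).
apply: (subseq_sorted leq_trans _ hs).
by apply: cat_subseq => //; apply: subseq_cons.
Qed.

Lemma sorted_subst x y (A1 A2 : seq nat) : sorted leq (A1 ++ x :: A2) ->
  (forall a, a \in A1 -> a <= y) -> (forall a, a \in A2 -> y <= a) ->
  sorted leq (A1 ++ y :: A2).
Proof.
rewrite !sorted_pairwise; try exact: leq_trans.
rewrite !pairwise_cat !allrel_consr /= => /and4P[/andP[_ ->] -> _ ->] h1 h2.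
by rewrite !andbT; apply/andP; split; apply/allP.
Qed.

Lemma sorted_cat_le x (A1 A2 : seq nat) a : sorted leq (A1 ++ x :: A2) ->
  (a \in A1 -> a <= x) /\ (a \in A2 -> x <= a).
Proof.
rewrite sorted_pairwise; last exact: leq_trans.
rewrite pairwise_cat !allrel_consr /= => /and4P[/andP[h1 _] _ h2 _].
by split=> h; [apply: (allP h1) | apply: (allP h2)].
Qed.

Lemma box_max_cat (A1 A2 : mbox) y : box_max (A1 ++ y :: A2) = last y A2.
Proof. by rewrite /box_max last_cat. Qed.

Lemma eps_rcons i w : eps i (rcons w i.+1) = (eps i w).+1.
Proof. by rewrite -cats1 eps_cat /= eqxx; lia. Qed.

(** For a box [A1 ++ x :: A2], [u1] and [u2] are the parts of the column word before and after [x].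
    The letter [x] does not occur in the definition, so the split survives its replacement. Empty
    [A1] means that [x] is the minimum, which is read early. *)
Definition pos_split T r c (A1 A2 : mbox) (u1 u2 : seq (nat * (nat * nat))) :=
  let A := box T ^~ c in let h := col_height T c in
  if A1 is m :: S1 then
    u1 = col_pre A c h r ++ (m, (r, c)) :: col_mid A c r ++ labelled r c S1 /\
    u2 = labelled r c A2 ++ col_suf A c h r
  else u1 = col_pre A c h r /\
       u2 = col_mid A c r ++ labelled r c A2 ++ col_suf A c h r.

Definition col_letters T c : seq nat := letters (mvt_rd_col T c).

Lemma pos_split_letters T T' r c A1 A2 u1 u2 y :
  pos_split T r c A1 A2 u1 u2 -> r < col_height T c -> shape T' = shape T ->
  (forall r', r' != r -> box T' r' c = box T r' c) ->
  box T' r c = A1 ++ y :: A2 ->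
  col_letters T' c = letters u1 ++ y :: letters u2.
Proof.
move=> hp hr es hb eb; have hr' : r < col_height T' c by rewrite /col_height es.
have [e1 e2 e3] := col_eq_off es hb.
rewrite /col_letters (mvt_rd_col_split hr') e1 e2 e3 eb.
case: A1 hp {eb} => [|m S1] [-> ->] /=; rewrite !letters_cat /= !letters_cat //.
by rewrite -!/(labelled r c _) !letters_labelled -!catA /= -!catA.
Qed.

(* T' arises from T by changing in the reading word the letter i+1 on which *)
(* e_i acts, inside one column.                                             *)
Definition col_step i T T' : Prop :=
  shape T' = shape T /\ exists c u1 u2,
  [/\ c < ncols T,
      forall c', c' != c -> col_letters T' c' = col_letters T c',
      col_letters T c = u1 ++ i.+1 :: u2, col_letters T' c = u1 ++ i :: u2
    & eps i (letters (rd_before T c) ++ u1) = 0 /\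
      phi i (u2 ++ letters (mvt_rd_from T c.+1)) = 0].

Lemma col_letters_off T T' c : shape T' = shape T ->
  (forall r' c', c' != c -> box T' r' c' = box T r' c') ->
  forall c', c' != c -> col_letters T' c' = col_letters T c'.
Proof.
by move=> es hb c' hc; rewrite /col_letters (mvt_rd_col_eq es) // => r; apply: hb.
Qed.

Lemma col_letters_split T r c : r < col_height T c ->
  col_letters T c =
  letters (col_pre (box T ^~ c) c (col_height T c) r) ++ box_min (box T r c) ::
  letters (col_mid (box T ^~ c) c r) ++ behead (box T r c) ++
  letters (col_suf (box T ^~ c) c (col_height T c) r).
Proof.
move=> hr; rewrite /col_letters (mvt_rd_col_split hr) letters_cat /=.
by rewrite -/(labelled _ _ _) 2!letters_cat letters_labelled.
Qed.

Lemma letters_col_midS A c k :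
  letters (col_mid A c k.+1) =
  box_min (A k) :: letters (mins A c (rev (iota 0 k))) ++
  letters (rests A c (iota 0 k)) ++ behead (A k).
Proof.
rewrite /col_mid -addn1 iotaD rev_cat /= add0n rests_cat rests_cons cats0.
by rewrite -/(labelled k c _) !letters_cat letters_labelled.
Qed.

(** In the raising step the entry removed is the first non-minimal one of box [k.+1] and the [y]
    added is the last non-minimal one of box [k]. Both occupy the same place of the column word,
    which is why prefix and suffix are those of [T]. *)
Lemma col_letters_up T T' k c U S x y :
  shape T' = shape T -> k.+1 < col_height T c -> U <> [::] ->
  (forall r', r' != k -> r' != k.+1 -> box T' r' c = box T r' c) ->
  box T k c = U -> box T' k c = rcons U y -> box T' k.+1 c = x :: S ->
  col_letters T' c =
  letters (col_pre (box T ^~ c) c (col_height T c) k.+1 ++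
     (x, (k.+1, c)) :: col_mid (box T ^~ c) c k.+1) ++
  y :: letters (labelled k.+1 c S ++ col_suf (box T ^~ c) c (col_height T c) k.+1).
Proof.
move=> es hk nU ob e1 e2 e3.
have hk' : k.+1 < col_height T' c by rewrite /col_height es.
rewrite (col_letters_split hk') e3 2!letters_cat /= letters_labelled.
rewrite !letters_col_midS e1 e2.
have hmin : box_min (rcons U y) = box_min U by case: (U) nU.
have hbeh : behead (rcons U y) = rcons (behead U) y by case: (U) nU.
have -> : col_pre (box T' ^~ c) c (col_height T' c) k.+1 =
          col_pre (box T ^~ c) c (col_height T c) k.+1.
  rewrite /col_pre /col_height es /mins; apply/eq_in_map => r'.
  by rewrite mem_rev mem_iota => hr; rewrite ob //; apply/eqP; lia.
have -> : col_suf (box T' ^~ c) c (col_height T' c) k.+1 =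
          col_suf (box T ^~ c) c (col_height T c) k.+1.
  rewrite /col_suf /col_height es /rests; congr flatten; apply/eq_in_map => r'.
  by rewrite mem_iota => hr; rewrite ob //; apply/eqP; lia.
have -> : mins (box T' ^~ c) c (rev (iota 0 k)) = mins (box T ^~ c) c (rev (iota 0 k)).
  apply/eq_in_map => r'; rewrite mem_rev mem_iota => hr.
  by rewrite ob //; apply/eqP; lia.
have -> : rests (box T' ^~ c) c (iota 0 k) = rests (box T ^~ c) c (iota 0 k).
  rewrite /rests; congr flatten; apply/eq_in_map => r'; rewrite mem_iota => hr.
  by rewrite ob //; apply/eqP; lia.
by rewrite hmin hbeh -cats1 -!catA /= -!catA.
Qed.

(** In the lowering step the entry removed is the last one of box [k], and the [y] added is a second
    copy of the minimum of box [k.+1], hence its first non-minimal entry: again the same place. *)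
Lemma col_letters_down T T' k c S S1 m y :
  shape T' = shape T -> k.+1 < col_height T c ->
  (forall r', r' != k -> r' != k.+1 -> box T' r' c = box T r' c) ->
  box T' k c = m :: S1 -> box T k.+1 c = y :: S -> box T' k.+1 c = y :: y :: S ->
  col_letters T' c =
  letters (col_pre (box T ^~ c) c (col_height T c) k ++
     (m, (k, c)) :: col_mid (box T ^~ c) c k ++ labelled k c S1) ++
  y :: letters (col_suf (box T ^~ c) c (col_height T c) k).
Proof.
move=> es hk ob e1 e2 e3.
have hk' : k < col_height T' c by rewrite /col_height es ltnW.
rewrite (col_letters_split hk') e1 letters_cat /= letters_cat letters_labelled.
have hio : iota k.+1 (col_height T c - k.+1) =
           k.+1 :: iota k.+2 (col_height T c - k.+2).
  by rewrite -[col_height T c - k.+1]prednK ?subn_gt0 // -subnS.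
have -> : col_pre (box T' ^~ c) c (col_height T' c) k =
          col_pre (box T ^~ c) c (col_height T c) k.
  rewrite /col_pre (_ : col_height T' c = col_height T c); last by rewrite /col_height es.
  rewrite /mins; apply/eq_in_map => r'; rewrite mem_rev hio inE mem_iota.
  case/orP => [/eqP->|hr]; first by rewrite e2 e3.
  by rewrite ob //; apply/eqP; lia.
have -> : col_mid (box T' ^~ c) c k = col_mid (box T ^~ c) c k.
  by rewrite /col_mid /mins /rests; congr (_ ++ flatten _); apply/eq_in_map => r';
    rewrite ?mem_rev mem_iota => hr; rewrite ob //; apply/eqP; lia.
rewrite /col_suf (_ : col_height T' c = col_height T c); last by rewrite /col_height es.
rewrite hio !rests_cons e2 e3 /= -/(labelled _ _ _) letters_cat /=.
rewrite letters_cat !letters_labelled.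
have -> : rests (box T' ^~ c) c (iota k.+2 (col_height T c - k.+2)) =
          rests (box T ^~ c) c (iota k.+2 (col_height T c - k.+2)).
  rewrite /rests; congr flatten; apply/eq_in_map => r'; rewrite mem_iota => hr.
  by rewrite ob //; apply/eqP; lia.
by rewrite -!catA /= -!catA.
Qed.

Lemma mem_split (A : eqType) (x : A) s : x \in s -> exists v1 v2, s = v1 ++ x :: v2.
Proof. by case/splitPr => v1 v2; exists v1, v2. Qed.

Lemma letters_rd_before T T' c :
  (forall c', c' < c -> col_letters T' c' = col_letters T c') ->
  letters (rd_before T' c) = letters (rd_before T c).
Proof.
move=> h; rewrite !letters_flatten -!map_comp; congr flatten.
by apply/eq_in_map => c'; rewrite mem_iota /= add0n => /h.
Qed.

Lemma letters_rd_from T T' j : ncols T' = ncols T ->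
  (forall c', j <= c' -> col_letters T' c' = col_letters T c') ->
  letters (mvt_rd_from T' j) = letters (mvt_rd_from T j).
Proof.
move=> en h; rewrite !letters_flatten -!map_comp en; congr flatten.
by apply/eq_in_map => c'; rewrite mem_iota /= => /andP[/h].
Qed.

(** * The operators on multiset-valued tableaux *)

Section MVT.
Variables (lam : seq nat) (hlam : is_part lam).

Lemma mvt_sorted T r c : MVT lam T -> in_diag lam r c -> sorted leq (box T r c).
Proof. by case=> _ h _ _ /h[]. Qed.

Lemma mvt_nil T r c : MVT lam T -> in_diag lam r c -> box T r c <> [::].
Proof. by case=> _ h _ _ /h[]. Qed.

Lemma box_in_diag T r c x : shape T = lam -> x \in box T r c -> in_diag lam r c.
Proof.
move=> <-; rewrite /in_diag nth_shape ltnNge; apply: contraL => h.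
by rewrite /box nth_default.
Qed.

Lemma mvt_col_lt T r r' c x y : MVT lam T -> r < r' ->
  x \in box T r c -> y \in box T r' c -> x < y.
Proof.
move=> hT hr hx hy; have [es _ _ hc] := hT.
have hd := box_in_diag es hy.
elim: r' y hr hy hd => // r' IH y; rewrite ltnS leq_eqVlt => hr hy hd.
have hd' : in_diag lam r' c by apply: in_diagW hd.
have h1 : box_max (box T r' c) < y.
  by apply: leq_trans (hc _ _ hd) (box_min_le _ hy); apply: mvt_sorted.
apply: leq_ltn_trans h1; case/orP: hr => [/eqP er|hr].
  by rewrite -er in hd' *; apply: box_max_ge (mvt_sorted hT hd') hx.
by apply/ltnW/IH => //; apply/box_max_mem/mvt_nil.
Qed.

Lemma mvt_row_le T r c c' x y : MVT lam T -> c < c' ->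
  x \in box T r c -> y \in box T r c' -> x <= y.
Proof.
move=> hT hr hx hy; have [es _ hc _] := hT.
have hd := box_in_diag es hy.
elim: c' y hr hy hd => // c' IH y; rewrite ltnS leq_eqVlt => hr hy hd.
have hd' : in_diag lam r c' by apply: in_diagW hd.
have h1 : box_max (box T r c') <= y.
  by apply: leq_trans (hc _ _ hd) (box_min_le _ hy); apply: mvt_sorted.
apply: leq_trans h1; case/orP: hr => [/eqP er|hr].
  by rewrite -er in hd' *; apply: box_max_ge (mvt_sorted hT hd') hx.
by apply/IH => //; apply/box_max_mem/mvt_nil.
Qed.

Lemma mvt_le T r r' c c' x y : MVT lam T -> c < c' -> r <= r' ->
  x \in box T r c -> y \in box T r' c' -> x <= y.
Proof.
move=> hT hc hr hx hy; have [es _ _ _] := hT.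
have hd : in_diag lam r c' by apply: in_diagW (box_in_diag es hy).
have hm := box_min_mem (mvt_nil hT hd).
apply: leq_trans (mvt_row_le hT hc hx hm) _.
move: hr; rewrite leq_eqVlt => /orP[/eqP er|hr].
  by apply: box_min_le (mvt_sorted hT hd) _; rewrite er.
exact: ltnW (mvt_col_lt hT hr hm hy).
Qed.

Lemma col_heightE T c r : shape T = lam -> (r < col_height T c) = in_diag lam r c.
Proof. by move=> es; rewrite /col_height es count_ltn_part. Qed.

Lemma mem_mvt_rd_col T x r c c' : MVT lam T ->
  ((x, (r, c')) \in mvt_rd_col T c) = (c' == c) && (x \in box T r c').
Proof.
move=> hT; have [es _ _ _] := hT.
rewrite mem_cat mem_mins mem_rests mem_rev mem_iota /= add0n col_heightE //.
case: eqP => [->|_] /=; last by rewrite !andbF.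
case: (boolP (in_diag lam r c)) => hd /=.
  by rewrite [x \in box _ _ _]mem_box //; apply: mvt_nil hT hd.
by apply/esym/negbTE; apply: contra hd; apply: box_in_diag.
Qed.

Lemma mem_mvt_rd_from T x r c j : MVT lam T ->
  ((x, (r, c)) \in mvt_rd_from T j) = (j <= c) && (x \in box T r c).
Proof.
move=> hT; have [es _ _ _] := hT; apply/flattenP/idP.
  case=> s /mapP[c']; rewrite mem_iota => hc' ->.
  by rewrite mem_mvt_rd_col // => /andP[/eqP-> ->]; rewrite andbT; lia.
case/andP=> hj hx; exists (mvt_rd_col T c); last by rewrite mem_mvt_rd_col // eqxx.
apply/mapP; exists c => //; rewrite mem_iota.
have := in_diag_ncols hlam (box_in_diag es hx); rewrite /ncols es; lia.
Qed.

Lemma pairwise_mvt_rd_from T j : MVT lam T -> pairwise rd_ord (mvt_rd_from T j).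
Proof.
move=> hT; have [es _ _ _] := hT; apply: pairwise_flatten_iota => [c _|c c' _ hc _].
  rewrite /mvt_rd_col pairwise_cat; apply/and3P; split.
  - apply/allrelP => -[x [r c1]] [y [r' c2]].
    rewrite -/(mins (box T ^~ c) c _) -/(rests (box T ^~ c) c _).
    rewrite mem_mins mem_rests mem_rev mem_iota /= add0n col_heightE //.
    case/and3P=> hr /eqP-> /eqP-> /and3P[]; rewrite mem_iota /= add0n col_heightE //.
    move=> hr' /eqP-> hy; rewrite /rd_ord /= leqnn /=; apply/implyP => hrr.
    have hy' := mem_behead hy.
    move: hrr; rewrite leq_eqVlt => /orP[/eqP e|hrr].
      by rewrite e; apply: box_min_le hy'; apply: mvt_sorted.
    apply/ltnW/(mvt_col_lt hT hrr _ hy').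
    by apply/box_min_mem/mvt_nil.
  - rewrite pairwise_map.
    have : pairwise (fun a b => b < a) (rev (iota 0 (col_height T c))).
      rewrite -sorted_pairwise; last by move=> x y z /= h1 h2; apply: ltn_trans h2 h1.
      by rewrite rev_sorted iota_ltn_sorted.
    by apply: sub_pairwise => a b /=; rewrite /rd_ord /=; lia.
  - apply: pairwise_flatten_iota => [r hr|r r' _ hr hr'].
      rewrite pairwise_map; have : sorted leq (behead (box T r c)).
        apply: sorted_behead.
        by apply: mvt_sorted hT _; rewrite -(@col_heightE T).
      rewrite sorted_pairwise; last exact: leq_trans.
      by apply: sub_pairwise => a b /=; rewrite /rd_ord /= !leqnn.
    apply/allrelP => _ _ /mapP[x hx ->] /mapP[y hy ->].
    rewrite /rd_ord /= leqnn /=; apply/implyP=> _; apply/ltnW.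
    exact: mvt_col_lt hT hr (mem_behead hx) (mem_behead hy).
apply/allrelP => -[x [r c1]] [y [r' c2]].
rewrite !mem_mvt_rd_col // => /andP[/eqP-> hx] /andP[/eqP-> hy].
rewrite /rd_ord /= (ltnW hc) /=; apply/implyP => hr.
exact: mvt_le hT hc hr hx hy.
Qed.

Lemma mem_rd_before T x r c j : MVT lam T ->
  ((x, (r, c)) \in rd_before T j) -> (c < j) && (x \in box T r c).
Proof.
move=> hT /flattenP[s /mapP[c']]; rewrite mem_iota /= add0n => hc' ->.
by rewrite mem_mvt_rd_col // => /andP[/eqP-> ->]; rewrite hc'.
Qed.

(** Two cases arise because the minimum of a box is read apart from its other entries. *)
Lemma mvt_rd_pos T r c x w1 w2 : MVT lam T ->
  mvt_rd T = w1 ++ (x, (r, c)) :: w2 ->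
  let A := box T ^~ c in let h := col_height T c in
  exists u1 u2, [/\ w1 = rd_before T c ++ u1, w2 = u2 ++ mvt_rd_from T c.+1
    & (exists S, [/\ box T r c = x :: S, u1 = col_pre A c h r
         & u2 = col_mid A c r ++ labelled r c S ++ col_suf A c h r]) \/
      (exists m S1 S2, [/\ box T r c = m :: S1 ++ x :: S2,
         u1 = col_pre A c h r ++ (m, (r, c)) :: col_mid A c r ++ labelled r c S1
       & u2 = labelled r c S2 ++ col_suf A c h r])].
Proof.
move=> hT ew A h; have [es _ _ _] := hT.
have hx : x \in box T r c.
  have : (x, (r, c)) \in mvt_rd T by rewrite ew mem_cat mem_head orbT.
  by rewrite mem_mvt_rd_from // => /andP[].
have hd := box_in_diag es hx.
have hc : c < ncols T by rewrite /ncols es; apply: in_diag_ncols hd.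
have hr : r < col_height T c by rewrite col_heightE.
case eA: (box T r c) (mvt_nil hT hd) => [//|m S] _.
have ew' : (rd_before T c ++ col_pre A c h r) ++ (m, (r, c)) ::
    col_mid A c r ++ labelled r c S ++ (col_suf A c h r ++ mvt_rd_from T c.+1) =
    w1 ++ (x, (r, c)) :: w2.
  by rewrite -ew (mvt_rd_split hc) (mvt_rd_col_split hr) eA -!catA /= -!catA.
(* The label [(r, c)] occurs only at the minimum and among the other entries of the box, so the
   given cut has to fall there. *)
have npre y : (y, (r, c)) \notin rd_before T c ++ col_pre A c h r.
  rewrite mem_cat negb_or; apply/andP; split.
    by apply/negP=> /(mem_rd_before hT); rewrite ltnn.
  by rewrite mem_mins mem_rev mem_iota ltnn.
have nmid y : (y, (r, c)) \notin col_mid A c r.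
  by rewrite mem_cat mem_mins mem_rests mem_rev mem_iota /= add0n ltnn.
have nsuf y : (y, (r, c)) \notin col_suf A c h r ++ mvt_rd_from T c.+1.
  by rewrite mem_cat mem_rests mem_iota ltnn mem_mvt_rd_from // ltnn.
case: (cat_cons_eq ew') => [[<- [<-] <-]|[z [-> e]]|[z [ez _]]].
- exists (col_pre A c h r), (col_mid A c r ++ labelled r c S ++ col_suf A c h r).
  by split; [|rewrite -!catA|left; exists S; split].
- have [z1 [-> e1]] := cat_notinl e (nmid x).
  have [w3 [-> e3]] := cat_notinr e1 (nsuf x).
  have [S1 [S2 [eS <- <-]]] : exists S1 S2,
      [/\ S = S1 ++ x :: S2, labelled r c S1 = z1 & labelled r c S2 = w3].
    elim: (S) z1 e3 {e1} => [|y S' IH] [|q z2] //= [].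
      by move=> -> <-; exists [::], S'.
    by move=> <- /IH[S1 [S2 [-> <- <-]]]; exists (y :: S1), S2.
  exists (col_pre A c h r ++ (m, (r, c)) :: col_mid A c r ++ labelled r c S1).
  exists (labelled r c S2 ++ col_suf A c h r).
  split; [by rewrite -!catA | by rewrite -!catA | right].
  by exists m, S1, S2; rewrite eS; split.
- by case/negP: (npre x); rewrite ez mem_cat mem_head orbT.
Qed.

Lemma mvt_set1 T T' r c : MVT lam T -> shape T' = lam -> in_diag lam r c ->
  (forall r' c', (r', c') != (r, c) -> box T' r' c' = box T r' c') ->
  [/\ sorted leq (box T' r c), box T' r c <> [::] & 0 \notin box T' r c] ->
  (0 < c -> box_max (box T r c.-1) <= box_min (box T' r c)) ->
  (in_diag lam r c.+1 -> box_max (box T' r c) <= box_min (box T r c.+1)) ->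
  (0 < r -> box_max (box T r.-1 c) < box_min (box T' r c)) ->
  (in_diag lam r.+1 c -> box_max (box T' r c) < box_min (box T r.+1 c)) ->
  MVT lam T'.
Proof.
move=> [es h1 h2 h3] es' hd hb hA hl hr hu hdn; split=> //.
- move=> r' c' hd'; case: (altP ((r', c') =P (r, c))) => [[-> ->] //|ne].
  by rewrite hb //; apply: h1.
- move=> r' c' hd'; case: (altP ((r', c') =P (r, c))) => [[er ec]|ne].
    rewrite er ec in hd' *; rewrite (hb r c.+1) ?hr //.
    by apply/eqP=> -[]; lia.
  case: (altP ((r', c'.+1) =P (r, c))) => [[er ec]|ne'].
    by rewrite (hb r' c') //; move: hl; rewrite -er -ec; apply.
  by rewrite !hb //; apply: h2.
- move=> r' c' hd'; case: (altP ((r', c') =P (r, c))) => [[er ec]|ne].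
    rewrite er ec in hd' *; rewrite (hb r.+1 c) ?hdn //.
    by apply/eqP=> -[]; lia.
  case: (altP ((r'.+1, c') =P (r, c))) => [[er ec]|ne'].
    by rewrite (hb r' c') //; move: hu; rewrite -er -ec; apply.
  by rewrite !hb //; apply: h3.
Qed.

Lemma mem_col_mid T r c y : MVT lam T -> in_diag lam r c ->
  (y \in letters (col_mid (box T ^~ c) c r)) <->
  (exists2 r', r' < r & y \in box T r' c).
Proof.
move=> hT hd; split.
  case/mapP=> -[z [r' c']]; rewrite mem_cat mem_mins mem_rests mem_rev mem_iota /=.
  rewrite add0n => /orP[] /and3P[hr _ hz] ->; exists r' => //.
    rewrite (eqP hz); apply/box_min_mem/mvt_nil => //.
    exact: in_diagW (ltnW hr) (leqnn c) hd.
  exact: mem_behead.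
case=> r' hr hy; apply/mapP; exists (y, (r', c)) => //.
rewrite mem_cat mem_mins mem_rests mem_rev mem_iota /= add0n hr eqxx /= -mem_box //.
by apply: mvt_nil hT _; apply: in_diagW (ltnW hr) (leqnn c) hd.
Qed.

(** The entries of a box in between would lie strictly between [x] and [x.+1]. *)
Lemma mvt_adjacent T r r' c x : MVT lam T -> r' < r ->
  x \in box T r' c -> x.+1 \in box T r c -> r = r'.+1.
Proof.
move=> hT hr hx hx1; apply/eqP; rewrite eqn_leq hr andbT leqNgt; apply/negP=> h.
have [es _ _ _] := hT.
have hd : in_diag lam r'.+1 c by apply: in_diagW (ltnW h) (leqnn c) (box_in_diag es hx1).
have hm := box_min_mem (mvt_nil hT hd).
have := mvt_col_lt hT (ltnSn r') hx hm; have := mvt_col_lt hT h hm hx1; lia.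
Qed.

Lemma mvt_critical i x r c T : MVT lam T -> critical i x (r, c) (mvt_rd T) ->
  exists u1 u2 A1 A2,
  [/\ mvt_rd T = (rd_before T c ++ u1) ++ (x, (r, c)) :: u2 ++ mvt_rd_from T c.+1,
      box T r c = A1 ++ x :: A2, pos_split T r c A1 A2 u1 u2,
      eps i (letters (rd_before T c) ++ letters u1) = 0
    & phi i (letters u2 ++ letters (mvt_rd_from T c.+1)) = 0].
Proof.
move=> hT [w1 [w2 [ew h1 h2]]].
have [u1 [u2 [e1 e2 hpos]]] := mvt_rd_pos hT ew.
rewrite e1 e2 !letters_cat in h1 h2; rewrite e1 e2 in ew; exists u1, u2.
case: hpos => [[S [eb eu1 eu2]]|[m [S1 [S2 [eb eu1 eu2]]]]].
  by exists [::], S; split.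
by exists (m :: S1), S2; split.
Qed.

Lemma mem_rd_left T w1 p w2 q : MVT lam T -> mvt_rd T = w1 ++ p :: w2 ->
  q \in mvt_rd T -> q.2.2 < p.2.2 -> q \in w1.
Proof.
move=> hT ew; have := pairwise_mvt_rd_from 0 hT; rewrite -/(mvt_rd T) ew.
rewrite pairwise_cat => /and3P[_ _] /= /andP[/allP h _].
rewrite mem_cat inE => /or3P[//|/eqP-> | /h /andP[h1 _] h2]; first by rewrite ltnn.
by have := leq_trans h2 h1; rewrite ltnn.
Qed.

Lemma mem_rd_right T w1 p w2 q : MVT lam T -> mvt_rd T = w1 ++ p :: w2 ->
  q \in mvt_rd T -> p.2.2 < q.2.2 -> q \in w2.
Proof.
move=> hT ew; have := pairwise_mvt_rd_from 0 hT; rewrite -/(mvt_rd T) ew.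
rewrite pairwise_cat allrel_consr => /and3P[/andP[/allP h _] _ _].
rewrite mem_cat inE => /or3P[/h /andP[h1 _] h2|/eqP-> | //]; last by rewrite ltnn.
by have := leq_trans h2 h1; rewrite ltnn.
Qed.

(** Fits both halves of a move between vertical neighbours: the donor keeps its minimum, and the
    receiver gains another copy of its own maximum (for [e_i]) or minimum (for [f_i]). *)
Lemma mvt_set1_same T T' r c : MVT lam T -> shape T' = lam -> in_diag lam r c ->
  (forall r' c', (r', c') != (r, c) -> box T' r' c' = box T r' c') ->
  [/\ sorted leq (box T' r c), box T' r c <> [::] & 0 \notin box T' r c] ->
  box_min (box T' r c) = box_min (box T r c) ->
  box_max (box T' r c) <= box_max (box T r c) -> MVT lam T'.
Proof.
move=> hT es' hd ob hb hmin hmax; have [es _ hrow hcol] := hT.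
apply: (mvt_set1 hT es' hd ob hb); rewrite ?hmin.
- by case: (c) hd => // c' hd _; apply: hrow.
- by move=> h; apply: leq_trans hmax (hrow _ _ h).
- by case: (r) hd => // r' hd _; apply: hcol.
- by move=> h; apply: leq_ltn_trans hmax (hcol _ _ h).
Qed.

Lemma mvt_e_spec i T : 0 < i -> MVT lam T ->
  if mvt_e i T is Some T' then MVT lam T' /\ col_step i T T'
  else eps i (letters (mvt_rd T)) = 0.
Proof.
move=> hi hT; have [es hbx hrow hcol] := hT.
rewrite /mvt_e; have := leftmost_minusP i (mvt_rd T).
case: leftmost_minus => [[r c]|//] /(mvt_critical hT).
move=> [u1 [u2 [A1 [A2 [ew eb hpos he hp]]]]].
have hx : i.+1 \in box T r c by rewrite eb mem_cat mem_head orbT.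
have hd := box_in_diag es hx.
have hc : c < ncols T by rewrite /ncols es; apply: in_diag_ncols hd.
have hr : r < col_height T c by rewrite col_heightE.
have hs := mvt_sorted hT hd; rewrite eb in hs.
have eT : col_letters T c = letters u1 ++ i.+1 :: letters u2.
  exact: pos_split_letters hpos hr erefl _ eb.
have hsd A : shape (set_box T r c A) = lam by rewrite shape_set_box es.
(* Non-minimal entries of a box are consecutive in the word, so an [i.+1] just before the critical
   one would stay uncancelled. *)
have last_i1 S z : A1 = rcons S z -> 1 < size A1 -> z != i.+1.
  move=> eA hsz; apply/eqP => ez; move: he hpos hsz; rewrite eA ez.
  case: S {eA} => [|m S] //= he [eu1 _] _; move: he.
  rewrite eu1 letters_cat /= letters_cat letters_labelled.
  by rewrite -rcons_cat -rcons_cons -!rcons_cat eps_rcons.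
have A1_le a : a \in A1 -> a <= i.+1 by case: (sorted_cat_le a hs).
have A2_ge a : a \in A2 -> i.+1 <= a by case: (sorted_cat_le a hs).
case: ifP => [/andP[hr0 hia]|hna].
- have [k er] : exists k, r = k.+1 by exists r.-1; rewrite prednK.
  rewrite {}er /= in hd hr hx eb hia hpos eT hs hsd ew hr0 *.
  have hdk : in_diag lam k c by apply: in_diagW (leqnSn k) (leqnn c) hd.
  (* Were the critical letter the minimum of its box, the [i] of the box above would be read after
     it. Its partner would be an [i.+1] of a higher box in the column, against strictness. *)
  case: A1 eb hs hpos last_i1 A1_le => [|m S1] eb hs hpos last_i1 A1_le.
    case: hpos => _ eu2; exfalso.
    have : i \in letters (col_mid (box T ^~ c) c k.+1).
      by apply/(mem_col_mid _ hT hd); exists k.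
    case/mem_split=> v1 [v2 ev]; move: hp; rewrite eu2 letters_cat ev -!catA /=.
    move/phi0_mem_before=> hv.
    have /(mem_col_mid _ hT hd)[r' hr' hi'] :
        i.+1 \in letters (col_mid (box T ^~ c) c k.+1) by rewrite ev mem_cat hv.
    by have := mvt_col_lt hT hr' hi' hx; rewrite ltnn.
  have hmb : m \in box T k.+1 c by rewrite eb mem_head.
  have em : m = i.+1.
    by apply/eqP; rewrite eqn_leq A1_le ?mem_head //= (mvt_col_lt hT (ltnSn k) hia hmb).
  (* The box begins with two letters [i.+1] and the critical one is the second: a further entry
     before it would be an [i.+1] too, against [last_i1]. *)
  case: (lastP S1) eb hs hpos last_i1 A1_le => [|S z] eb hs hpos last_i1 A1_le; last first.
    have := last_i1 (m :: S) z erefl; rewrite /= size_rcons => /(_ isT) /eqP[].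
    have hz : z \in m :: rcons S z by rewrite inE mem_rcons mem_head orbT.
    apply/eqP; rewrite eqn_leq A1_le //= -em.
    have hz' : z \in box T k.+1 c by rewrite eb mem_cat hz.
    by have := box_min_le (mvt_sorted hT hd) hz'; rewrite eb.
  rewrite /= {}em in eb hs hpos {hmb last_i1 A1_le}; case: hpos => eu1 eu2.
  set T1 := remove_from _ _ _ _.
  have eb1 : box T1 k.+1 c = i.+1 :: A2.
    by rewrite /T1 /remove_from box_set_box eqxx eb /= eqxx.
  have ob1 r' c' : (r', c') != (k.+1, c) -> box T1 r' c' = box T r' c'.
    by move=> h; rewrite /T1 /remove_from box_set_box (negbTE h).
  have hT1 : MVT lam T1.
    have [_ _ h0] := hbx _ _ hd; rewrite eb inE negb_or in h0.
    apply: (mvt_set1_same hT (hsd _) hd ob1); rewrite -/T1 eb1.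
    - by split; [move: hs => /= /andP[]| |case/andP: h0].
    - by rewrite eb.
    - by rewrite eb /box_max.
  have nk : (k, c) != (k.+1, c) by rewrite xpair_eqE; apply/negP=> /andP[/eqP]; lia.
  have eU : box T1 k c = box T k c by apply: ob1.
  set U := box T k c in eU hia *.
  have hU := mvt_sorted hT hdk; have nU := mvt_nil hT hdk; rewrite -/U in hU nU.
  have U_le a : a \in U -> a <= i by move=> ha; have := mvt_col_lt hT (ltnSn k) ha hx.
  have maxU : box_max U = i.
    by apply/eqP; rewrite eqn_leq U_le ?(box_max_ge hU) //; apply: box_max_mem.
  have hUi : sorted leq (rcons U i).
    rewrite sorted_pairwise; last exact: leq_trans.
    rewrite pairwise_rcons -sorted_pairwise; last exact: leq_trans.
    by rewrite hU andbT; apply/allP.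
  have sUi : sort leq (i :: U) = rcons U i.
    apply: (sorted_eq leq_trans anti_leq _ hUi); first exact: sort_sorted leq_total _.
    by rewrite perm_sort perm_sym perm_rcons.
  set T' := add_to _ _ _ _.
  have eb' : box T' k c = rcons U i by rewrite /T' /add_to eU sUi box_set_box eqxx.
  have ob' r' c' : (r', c') != (k, c) -> box T' r' c' = box T1 r' c'.
    by move=> h; rewrite /T' /add_to box_set_box (negbTE h).
  have es1 : shape T1 = lam by case: hT1.
  have es' : shape T' = lam by rewrite /T' /add_to shape_set_box es1.
  split.
    apply: (mvt_set1_same hT1 es' hdk ob'); rewrite eb' ?eU.
    - split=> //; first by case: (U).
      have [_ _ h0] := hbx _ _ hdk; rewrite mem_rcons inE negb_or h0.
      by rewrite eq_sym (gtn_eqF hi).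
    - by case: (U) nU.
    - by rewrite maxU /box_max last_rcons.
  split; first by rewrite es' es.
  exists c, (letters u1), (letters u2); split=> //.
    apply: col_letters_off; first by rewrite es' es.
    move=> r' c' hc'; rewrite ob' ?ob1 //; by rewrite xpair_eqE negb_and hc' orbT.
  rewrite eu1 eu2 cats0; apply: (col_letters_up _ hr nU _ erefl eb' _).
  - by rewrite es' es.
  - move=> r' h1 h2; rewrite ob' ?ob1 //; rewrite xpair_eqE negb_and ?h1 ?h2 //.
  - by rewrite ob' ?eb1 // eq_sym.
(* The critical letter is the first [i.+1] of its box. An earlier copy would either directly precede
   it in the word, or be the minimum and have as partner an [i] of a higher box, necessarily the box
   above, which contains none. *)
have A1_i1 : i.+1 \notin A1.
  apply/negP=> h1.
  case: (lastP A1) h1 last_i1 A1_le hs hpos => [//|S z] h1 h2 h3 h4 hpos.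
  have ez : z = i.+1.
    apply/eqP; rewrite eqn_leq h3 ?mem_rcons ?mem_head //=.
    move: h4; rewrite cat_rcons => /(sorted_cat_le i.+1)[h5 _].
    by move: h1; rewrite mem_rcons inE => /orP[/eqP<-|/h5].
  have := h2 _ _ erefl; rewrite size_rcons ez eqxx.
  case: S h1 h2 h3 h4 hpos => [|m S] // _ _ _ _; last by move=> _ /(_ isT).
  rewrite ez /= => -[eu1 _] _.
  move: he; rewrite eu1 letters_cat /= letters_cat /= cats0 catA.
  move/eps0_mem_after/(mem_col_mid _ hT hd)=> [r' hr' hi'].
  have er := mvt_adjacent hT hr' hi' hx.
  by move: hna; rewrite er /= hi'.
have A1_lei a : a \in A1 -> a <= i.
  move=> ha; have := A1_le _ ha; rewrite leq_eqVlt => /orP[/eqP ea|//].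
  by rewrite -ea ha in A1_i1.
have hs' : sorted leq (A1 ++ i :: A2).
  by apply: sorted_subst hs A1_lei _ => a /A2_ge /ltnW.
set T' := add_to _ _ _ _.
have eb' : box T' r c = A1 ++ i :: A2.
  rewrite /T' /add_to /remove_from !box_set_box eqxx eb.
  exact: sort_replace.
have ob r' c' : (r', c') != (r, c) -> box T' r' c' = box T r' c'.
  by move=> h; rewrite /T' /add_to /remove_from !box_set_box (negbTE h).
have es' : shape T' = lam.
  by rewrite /T' /add_to /remove_from shape_set_box hsd.
have no_i r' : r' < r -> i \notin box T r' c.
  move=> hr'; apply/negP => hi'.
  have er := mvt_adjacent hT hr' hi' hx.
  by move: hna; rewrite er /= hi'.
split; last first.
  split; first by rewrite es' es.
  exists c, (letters u1), (letters u2); split=> //.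
    apply: col_letters_off; first by rewrite es' es.
    by move=> r' c' hc'; apply: ob; rewrite xpair_eqE negb_and hc' orbT.
  apply: pos_split_letters hpos hr _ _ eb'; first by rewrite es' es.
  by move=> r' hr'; apply: ob; rewrite xpair_eqE negb_and hr'.
have max_le : box_max (box T' r c) <= box_max (box T r c).
  by rewrite eb eb' !box_max_cat; case: (A2) => //=.
apply: (mvt_set1 hT es' hd ob).
- split; rewrite eb' //; first by case: (A1).
  have [_ _] := hbx _ _ hd; rewrite eb !mem_cat !inE.
  by rewrite [0 == i]eq_sym (gtn_eqF hi).
- move=> hc0.
  have hdl : in_diag lam r c.-1 by apply: in_diagW (leqnn r) (leq_pred c) hd.
  have hd1 : in_diag lam r c.-1.+1 by rewrite prednK.
  have := hrow _ _ hd1; rewrite prednK // eb eb'.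
  move eA: A1 => AA; case: AA eA => [|m S] eA //= hle.
  (* The new minimum [i] can clash only with an [i.+1] in the left box. That letter is read earlier
     and has a partner [i] in between; by the reading order this lies in the left column above row
     [r]. Then the box to its right has minimum [i], against [no_i]. *)
  rewrite leqNgt; apply/negP => hgt.
  have hq : i.+1 \in box T r c.-1.
    rewrite (_ : i.+1 = box_max (box T r c.-1)); last first.
      by apply/eqP; rewrite eqn_leq hgt.
    exact/box_max_mem/mvt_nil.
  rewrite eA /= in hpos; case: hpos => eu1 eu2.
  have hpw := pairwise_mvt_rd_from 0 hT; rewrite -/(mvt_rd T) ew in hpw.
  move: hpw; rewrite pairwise_cat => /and3P[hrel hpw _].
  have hcl : c.-1 < c by rewrite prednK.
  have hqw : (i.+1, (r, c.-1)) \in rd_before T c ++ u1.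
    apply: (@mem_rd_left _ _ _ _ (i.+1, (r, c.-1)) hT ew _ hcl).
    by rewrite mem_mvt_rd_from // hq.
  have [v1 [v2 ev]] : exists v1 v2,
      rd_before T c ++ u1 = v1 ++ (i.+1, (r, c.-1)) :: v2.
    exact: mem_split.
  have hiv : i \in letters v2.
    move: he; rewrite -letters_cat ev letters_cat; exact: eps0_mem_after.
  case/mapP: hiv => -[z [r' c']] hz /= ez; rewrite -ez in hz.
  move: hpw; rewrite ev pairwise_cat => /and3P[_ _] /= /andP[/allP/(_ _ hz)].
  rewrite /rd_ord /= => /andP[hc' /implyP hr'] _.
  have {hr'} hr' : r' < r by rewrite ltnNge; apply/negP => /hr'; rewrite ltnn.
  have : (i, (r', c')) \in rd_before T c ++ u1.
    by rewrite ev mem_cat inE hz !orbT.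
  rewrite mem_cat => /orP[/(mem_rd_before hT)/andP[hcc hib]|]; last first.
    by rewrite eu1 mem_mins mem_rev mem_iota leqNgt ltnS (ltnW hr').
  have ec : c' = c.-1 by apply/eqP; rewrite eqn_leq hc' andbT -ltnS prednK.
  rewrite ec in hib.
  have hdr : in_diag lam r' c by apply: in_diagW (ltnW hr') (leqnn c) hd.
  have hm := box_min_mem (mvt_nil hT hdr).
  have h1 := mvt_row_le hT hcl hib hm.
  have h2 := mvt_col_lt hT hr' hm hx.
  case/negP: (no_i _ hr'); rewrite (_ : i = box_min (box T r' c)) //.
  by apply/eqP; rewrite eqn_leq h1.
- by move=> h; apply: leq_trans max_le (hrow _ _ h).
- move=> hr0; have hd1 : in_diag lam r.-1.+1 c by rewrite prednK.
  have := hcol _ _ hd1; rewrite prednK // eb eb'.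
  case: (A1) => [|m S] //=; rewrite /box_min /= ltnS leq_eqVlt.
  case/orP=> [/eqP em|//]; have hl : r.-1 < r by rewrite prednK.
  case/negP: (no_i _ hl); rewrite -em; apply/box_max_mem/mvt_nil => //.
  by apply: in_diagW (leq_pred r) (leqnn c) hd.
- by move=> h; apply: leq_ltn_trans max_le (hcol _ _ h).
Qed.

Lemma mvt_f_spec i T : 0 < i -> MVT lam T ->
  if mvt_f i T is Some T' then MVT lam T' /\ col_step i T' T
  else phi i (letters (mvt_rd T)) = 0.
Proof.
move=> hi hT; have [es hbx hrow hcol] := hT.
rewrite /mvt_f; have := rightmost_plusP i (mvt_rd T).
case: rightmost_plus => [[r c]|//] /(mvt_critical hT).
move=> [u1 [u2 [A1 [A2 [ew eb hpos he hp]]]]].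
have hx : i \in box T r c by rewrite eb mem_cat mem_head orbT.
have hd := box_in_diag es hx.
have hc : c < ncols T by rewrite /ncols es; apply: in_diag_ncols hd.
have hr : r < col_height T c by rewrite col_heightE.
have hs := mvt_sorted hT hd; rewrite eb in hs.
have eT : col_letters T c = letters u1 ++ i :: letters u2.
  exact: pos_split_letters hpos hr erefl _ eb.
have hsd A : shape (set_box T r c A) = lam by rewrite shape_set_box es.
have A1_le a : a \in A1 -> a <= i by case: (sorted_cat_le a hs).
have A2_ge a : a \in A2 -> i <= a by case: (sorted_cat_le a hs).
(* The critical letter is the last [i] of its box. A copy directly behind it would be uncancelled;
   if the critical one is the minimum, only an [i.+1] of a higher box could cancel the copy, but
   entries there are less than [i]. *)
have A2_i : i \notin A2.
  apply/negP; case: (A2) hs hpos A2_ge => // a S hs hpos A2_ge hiS.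
  have ea : a = i.
    apply/eqP; rewrite eqn_leq A2_ge ?mem_head // andbT.
    move: hs; rewrite -cat_rcons sorted_cat_cons => /andP[_ /(order_path_min leq_trans)/allP h].
    by move: hiS; rewrite inE => /orP[/eqP-> //|/h].
  case: (A1) hpos => [|m S1] [_ eu2]; move: hp; rewrite eu2 ea; last first.
    by rewrite letters_cat /= eqxx.
  rewrite letters_cat /= -catA /= => /phi0_mem_before /(mem_col_mid _ hT hd)[r' hr' h].
  by have := mvt_col_lt hT hr' h hx; lia.
have A2_gt a : a \in A2 -> i < a.
  move=> ha; rewrite ltn_neqAle A2_ge // andbT; apply/eqP=> e.
  by rewrite e ha in A2_i.
(* Here [col_step] leads from the new tableau back to [T], so the conditions on the columns other
   than [c] have to be carried over from [T]. *)
have step T' : shape T' = lam ->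
    (forall r' c', c' != c -> box T' r' c' = box T r' c') ->
    col_letters T' c = letters u1 ++ i.+1 :: letters u2 -> col_step i T' T.
  move=> es' ob e'; have en : ncols T = ncols T' by rewrite /ncols es es'.
  have eo : forall c', c' != c -> col_letters T c' = col_letters T' c'.
    by apply: col_letters_off => [|r' c' h]; rewrite ?es ?es' // ob.
  split; first by rewrite es es'.
  exists c, (letters u1), (letters u2); split=> //; first by rewrite -en.
  rewrite -(@letters_rd_before T' T) -?(@letters_rd_from T' T) //.
    by move=> c' h; apply: eo; rewrite neq_ltn h orbT.
  by move=> c' h; apply: eo; rewrite neq_ltn h.
case: ifP => hib.
- have hdS := box_in_diag es hib.
  have hrS : r.+1 < col_height T c by rewrite col_heightE.
  have eA2 : A2 = [::].
    case: (A2) A2_gt eb => // a S h e; have := h a (mem_head _ _).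
    have ha : a \in box T r c by rewrite e mem_cat inE mem_head !orbT.
    by have := mvt_col_lt hT (ltnSn r) ha hib; rewrite ltnS leqNgt => /negP.
  rewrite {}eA2 in eb hs hpos {A2_ge A2_i A2_gt}.
  case eS: (box T r.+1 c) (mvt_nil hT hdS) (mvt_sorted hT hdS) => [//|y S] _ hyS.
  have ey : y = i.+1.
    apply/eqP; rewrite eqn_leq; apply/andP; split.
      by move: hib; rewrite eS => /(box_min_le hyS).
    by apply: mvt_col_lt hT (ltnSn r) hx _; rewrite eS mem_head.
  rewrite {}ey in eS hyS.
  (* With empty [A1] the critical [i] would be read right after the minimum [i.+1] of the box below,
     and that letter would end [u1] uncancelled. *)
  case: A1 eb hs hpos A1_le => [|m S1] eb hs hpos A1_le.
    case: hpos => eu1 _; move: he; rewrite eu1 /col_pre.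
    have -> : iota r.+1 (col_height T c - r.+1) =
           r.+1 :: iota r.+2 (col_height T c - r.+2).
      by rewrite -[col_height T c - r.+1]prednK ?subn_gt0 // -subnS.
    rewrite rev_cons /mins map_rcons /letters map_rcons /= eS /=.
    by rewrite -rcons_cat eps_rcons.
  set T1 := remove_from _ _ _ _.
  have eb1 : box T1 r c = m :: S1.
    by rewrite /T1 /remove_from box_set_box eqxx eb rem_replace ?cats0.
  have ob1 r' c' : (r', c') != (r, c) -> box T1 r' c' = box T r' c'.
    by move=> h; rewrite /T1 /remove_from box_set_box (negbTE h).
  have hT1 : MVT lam T1.
    have [_ _ h0] := hbx _ _ hd; rewrite eb mem_cat negb_or in h0.
    apply: (mvt_set1_same hT (hsd _) hd ob1); rewrite -/T1 eb1.
    - by split; [case/cat_sorted2: hs| |case/andP: h0].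
    - by rewrite eb.
    - by rewrite eb box_max_cat /= A1_le // /box_max /= mem_last.
  have nk : (r.+1, c) != (r, c) by rewrite xpair_eqE; apply/negP=> /andP[/eqP]; lia.
  have eS1 : box T1 r.+1 c = i.+1 :: S by rewrite ob1.
  have es1 : shape T1 = lam by case: hT1.
  set T' := add_to _ _ _ _.
  have hsS : sorted leq [:: i.+1, i.+1 & S] by rewrite /= leqnn.
  have eb' : box T' r.+1 c = [:: i.+1, i.+1 & S].
    rewrite /T' /add_to eS1 box_set_box eqxx.
    exact: (sorted_sort leq_trans hsS).
  have ob' r' c' : (r', c') != (r.+1, c) -> box T' r' c' = box T1 r' c'.
    by move=> h; rewrite /T' /add_to box_set_box (negbTE h).
  have es' : shape T' = lam by rewrite /T' /add_to shape_set_box es1.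
  split.
    apply: (mvt_set1_same hT1 es' hdS ob'); rewrite eb' ?eS1 //.
    by split=> //; have [_ _] := hbx _ _ hdS; rewrite eS !inE.
  apply: step => // [r' c' hc'|].
    by rewrite ob' ?ob1 // xpair_eqE negb_and hc' orbT.
  case: hpos => -> ->; rewrite (@col_letters_down T T' r c S S1 m i.+1) ?es' ?es //.
  - by move=> r' h1 h2; rewrite ob' ?ob1 // xpair_eqE negb_and ?h1 ?h2.
  - by rewrite ob' ?eb1 // eq_sym.
have no_i1 r' : r < r' -> i.+1 \notin box T r' c.
  move=> hr'; apply/negP => h; move: hib.
  by rewrite -(mvt_adjacent hT hr' hx h) h.
have hs' : sorted leq (A1 ++ i.+1 :: A2).
  by apply: sorted_subst hs _ A2_gt => a /A1_le /leqW.
set T' := add_to _ _ _ _.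
have eb' : box T' r c = A1 ++ i.+1 :: A2.
  rewrite /T' /add_to /remove_from !box_set_box eqxx eb.
  exact: sort_replace.
have ob r' c' : (r', c') != (r, c) -> box T' r' c' = box T r' c'.
  by move=> h; rewrite /T' /add_to /remove_from !box_set_box (negbTE h).
have es' : shape T' = lam.
  by rewrite /T' /add_to /remove_from shape_set_box hsd.
split; last first.
  apply: step => // [r' c' hc'|].
    by apply: ob; rewrite xpair_eqE negb_and hc' orbT.
  apply: pos_split_letters hpos hr _ _ eb'; first by rewrite es' es.
  by move=> r' hr'; apply: ob; rewrite xpair_eqE negb_and hr'.
have min_ge : box_min (box T r c) <= box_min (box T' r c).
  by rewrite eb eb'; case: (A1) => //=.
apply: (mvt_set1 hT es' hd ob).
- split; rewrite eb' //; first by case: (A1).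
  have [_ _] := hbx _ _ hd; rewrite eb !mem_cat !inE !negb_or.
  by case/and3P=> -> _ ->.
- move=> hc0; apply: leq_trans min_ge.
  have hd1 : in_diag lam r c.-1.+1 by rewrite prednK.
  by have := hrow _ _ hd1; rewrite prednK.
- move=> hdr; have := hrow _ _ hdr; rewrite eb eb' !box_max_cat.
  move eA: A2 => AA; case: AA eA => [|a S] //= eA hle; rewrite ltn_neqAle hle andbT.
  (* Mirror of the argument for [e_i]: an [i] in the right box has a partner [i.+1] read in between,
     in column [c] or [c.+1] below row [r]. In either case column [c] has an [i.+1] below row [r],
     against [no_i1]. *)
  apply/eqP => eD.
  have hq : i \in box T r c.+1 by rewrite eD; apply/box_min_mem/mvt_nil.
  have hqw : (i, (r, c.+1)) \in u2 ++ mvt_rd_from T c.+1.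
    apply: (@mem_rd_right _ _ _ _ (i, (r, c.+1)) hT ew _ (ltnSn c)).
    by rewrite mem_mvt_rd_from // hq.
  have [v1 [v2 ev]] := mem_split hqw.
  have : i.+1 \in letters v1.
    by move: hp; rewrite -letters_cat ev letters_cat; apply: phi0_mem_before.
  case/mapP => -[z [r' c']] hz /= ez; rewrite -ez in hz.
  have hpw := pairwise_mvt_rd_from 0 hT; rewrite -/(mvt_rd T) ew ev in hpw.
  move: hpw; rewrite pairwise_cat pairwise_cons => /and3P[_ _ /andP[/allP hpz hpw]].
  move: hpw; rewrite pairwise_cat allrel_consr => /and3P[/andP[/allP hzq _] _ _].
  have /andP[/= hc1 _] := hpz (i.+1, (r', c')) (mem_subseq (prefix_subseq _ _) hz).
  have /andP[/= hc2 hr2] := hzq _ hz.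
  have hzb : i.+1 \in box T r' c'.
    have : (i.+1, (r', c')) \in mvt_rd T by rewrite ew ev mem_cat inE mem_cat hz !orbT.
    by rewrite mem_mvt_rd_from // => /andP[].
  move: hc2; rewrite leq_eqVlt => /orP[/eqP ec|hc2].
    have hrr : r < r' by rewrite ltnNge; apply: contraL hr2 => ->; rewrite /= ltnn.
    rewrite ec in hzb.
    have hdr' : in_diag lam r' c.
      exact: in_diagW (leqnn r') (leqnSn c) (box_in_diag es hzb).
    have hm := box_min_mem (mvt_nil hT hdr').
    have h1 := mvt_row_le hT (ltnSn c) hm hzb.
    have h2 := mvt_col_lt hT hrr hx hm.
    case/negP: (no_i1 _ hrr); rewrite (_ : i.+1 = box_min (box T r' c)) //.
    by apply/eqP; rewrite eqn_leq h2.
  have ec : c' = c by apply/eqP; rewrite eqn_leq hc1 andbT -ltnS.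
  rewrite ec in hzb; case: (ltngtP r r') => hrr.
  + by case/negP: (no_i1 _ hrr).
  + by have := mvt_col_lt hT hrr hzb hx; rewrite ltnNge leqnSn.
  + rewrite -hrr in hzb; have := mvt_row_le hT (ltnSn c) hzb hq.
    by rewrite ltnn.
- move=> hr0; apply: leq_trans min_ge.
  have hd1 : in_diag lam r.-1.+1 c by rewrite prednK.
  by have := hcol _ _ hd1; rewrite prednK.
- move=> hdS; have := hcol _ _ hdS; rewrite eb eb' !box_max_cat.
  case: (A2) => [|a S] //= hlt; rewrite ltn_neqAle hlt andbT.
  apply/eqP => e; case/negP: (no_i1 _ (ltnSn r)); rewrite e.
  exact/box_min_mem/mvt_nil.
Qed.

End MVT.

(** * Suffix words and uncrowding along a raising step *)

Lemma letters_rd_from_split T j c : j <= c < ncols T ->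
  letters (mvt_rd_from T j) =
  flatten [seq col_letters T c' | c' <- iota j (c - j)] ++
  col_letters T c ++ letters (mvt_rd_from T c.+1).
Proof.
move=> h; rewrite (mvt_rd_from_split h) 2!letters_cat letters_flatten -map_comp.
by [].
Qed.

(** If column [c] is among those kept, the letters dropped all precede the critical one, and [eps]
    of a suffix is at most [eps] of the word; so the critical letter stays critical. *)
Lemma col_step_from i T T' j : col_step i T T' ->
  letters (mvt_rd_from T' j) = letters (mvt_rd_from T j) \/
  word_e i (letters (mvt_rd_from T j)) = Some (letters (mvt_rd_from T' j)).
Proof.
move=> [es [c [u1 [u2 [hc ho e1 e2 [h1 h2]]]]]].
have en : ncols T' = ncols T by rewrite /ncols es.
case: (ltnP c j) => hj; [left | right].
  by apply: letters_rd_from => // c' hc'; apply: ho; rewrite neq_ltn (leq_trans hj hc') orbT.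
have hjc : j <= c < ncols T by rewrite hj.
have hjc' : j <= c < ncols T' by rewrite en.
rewrite (letters_rd_from_split hjc) (letters_rd_from_split hjc') e1 e2.
rewrite (@letters_rd_from T T' c.+1 en); last first.
  by move=> c' hc'; apply: ho; rewrite neq_ltn hc' orbT.
set v := flatten [seq col_letters T' _ | _ <- _].
have -> : flatten [seq col_letters T c' | c' <- iota j (c - j)] = v.
  congr flatten; apply/eq_in_map => c'; rewrite mem_iota => h.
  by rewrite ho // neq_ltn; apply/orP; left; lia.
rewrite -!catA /= !catA; apply/word_eP; exists (v ++ u1).
exists (u2 ++ letters (mvt_rd_from T c.+1)); split=> //.
move: h1; rewrite -(@letters_rd_before T T' c); last first.
  by move=> c' hc'; apply: ho; rewrite neq_ltn hc'.
rewrite /rd_before letters_flatten -map_comp -{1}(subnKC hj) iotaD map_cat.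
by rewrite flatten_cat -catA eps_cat add0n -/v; lia.
Qed.

Lemma col_step_word i T T' : col_step i T T' ->
  word_e i (letters (mvt_rd T)) = Some (letters (mvt_rd T')).
Proof.
move=> h; case: (col_step_from 0 h) => // e.
have [_ [c [u1 [u2 [hc ho e1 e2 _]]]]] := h; exfalso.
have es : shape T' = shape T by case: h.
have hc' : c < ncols T' by rewrite /ncols es.
have h0 : 0 <= c < ncols T by [].
have h0' : 0 <= c < ncols T' by [].
(* The whole words differ in one letter, [i.+1] against [i], so their sums differ. *)
have := congr1 sumn e; rewrite (letters_rd_from_split h0) (letters_rd_from_split h0').
rewrite e1 e2 !sumn_cat /= (@letters_rd_from T T' c.+1); first last.
- by move=> c' h'; apply: ho; rewrite neq_ltn h' orbT.
- by rewrite /ncols es.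
suff -> : [seq col_letters T' c' | c' <- iota 0 (c - 0)] =
          [seq col_letters T c' | c' <- iota 0 (c - 0)] by lia.
apply/eq_in_map => c'; rewrite mem_iota => h'.
by apply: ho; rewrite neq_ltn; apply/orP; left; lia.
Qed.

Lemma col_step_size i T T' c : col_step i T T' ->
  size (col_letters T' c) = size (col_letters T c).
Proof.
move=> [_ [c' [u1 [u2 [_ ho e1 e2 _]]]]].
case: (altP (c =P c')) => [->|/ho-> //].
by rewrite e1 e2 !size_cat.
Qed.

Lemma letters_mvt_rd T :
  letters (mvt_rd T) = flatten [seq col_letters T c | c <- iota 0 (ncols T)].
Proof. by rewrite letters_flatten -map_comp subn0. Qed.

Section MVTWords.
Variables (lam : seq nat) (hlam : is_part lam).

Lemma col_letters_nil T c : shape T = lam -> ncols T <= c -> col_letters T c = [::].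
Proof.
move=> es; rewrite /ncols es => hc.
rewrite /col_letters mvt_rd_colE (_ : col_height T c = 0) //.
apply/eqP; rewrite -leqn0 leqNgt (col_heightE hlam) //; apply/negP.
by move=> /(in_diag_ncols hlam); lia.
Qed.

(* The minima and the intervals between consecutive minima recover the boxes. *)
Lemma col_letters_inj T T' : MVT lam T -> MVT lam T' ->
  (forall c, col_letters T c = col_letters T' c) -> T = T'.
Proof.
move=> hT hT' hcol; have [es _ _ _] := hT; have [es' _ _ _] := hT'.
have eh c : col_height T' c = col_height T c by rewrite /col_height es es'.
have hbox r c : in_diag lam r c -> box T r c = box T' r c.
  move=> hd; set h := col_height T c.
  have hin r' : (r' < h) = in_diag lam r' c by rewrite /h (col_heightE hlam).
  have := hcol c; rewrite /col_letters !mvt_rd_colE eh !letters_cat -/h => /eqP.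
  rewrite eqseq_cat; last by rewrite !size_map.
  case/andP=> /eqP em /eqP er.
  have hmin r' : r' < h -> box_min (box T r' c) = box_min (box T' r' c).
    move=> hr; move: em; rewrite /letters -!map_comp => /eq_in_map; apply.
    by rewrite mem_rev mem_iota.
  set P := fun x => (box_min (box T r c) <= x) &&
     ((r.+1 < h) ==> (x < box_min (box T r.+1 c))).
  have hfil U : MVT lam U ->
      (forall r', r' < h -> box_min (box T r' c) = box_min (box U r' c)) ->
      filter P (letters (rests (box U ^~ c) c (iota 0 h))) = behead (box U r c).
    move=> hU hm; rewrite letters_flatten -map_comp filter_flatten -map_comp.
    have hrh : r < h by rewrite hin.
    have hP r' x : r' < h -> x \in behead (box U r' c) -> P x = (r' == r).
      move=> hr' /mem_behead hx; rewrite /P hm //.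
      have hmr := box_min_mem (mvt_nil hU hd).
      case: (ltngtP r' r) => hrr /=.
      - have := mvt_col_lt hlam hU hrr hx hmr.
        by rewrite ltnNge; case: (_ <= x).
      - have hr1 : r.+1 < h by apply: leq_ltn_trans hr'.
        rewrite hr1 hm //= [x < _]ltnNge.
        have hd1 : in_diag lam r.+1 c by rewrite -hin.
        have hm1 := box_min_mem (mvt_nil hU hd1).
        have -> : box_min (box U r.+1 c) <= x.
          move: hrr; rewrite leq_eqVlt => /orP[/eqP e|hrr].
            by apply: box_min_le (mvt_sorted hU hd1) _; rewrite e.
          exact: ltnW (mvt_col_lt hlam hU hrr hm1 hx).
        by rewrite andbF.
      - rewrite hrr in hx; rewrite (box_min_le (mvt_sorted hU hd) hx) /=.
        apply/implyP => hr1; rewrite hm //.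
        have hd1 : in_diag lam r.+1 c by rewrite -hin.
        exact: (mvt_col_lt hlam hU (ltnSn r) hx (box_min_mem (mvt_nil hU hd1))).
    rewrite (iota_split hrh) map_cat flatten_cat /=.
    have off s : {subset s <= iota 0 h} -> r \notin s ->
        flatten [seq filter P (letters (labelled r' c (behead (box U r' c))))
                | r' <- s] = [::].
      elim: s => //= r' s IH hs; rewrite inE negb_or => /andP[nr hr].
      rewrite letters_labelled IH // ?cats0; last first.
        by move=> z hz; apply: hs; rewrite inE hz orbT.
      have hr' : r' < h by have := hs r' (mem_head _ _); rewrite mem_iota.
      rewrite (@eq_in_filter _ P pred0) ?filter_pred0 // => x hx.
      by rewrite (hP r') // eq_sym (negbTE nr).
    rewrite off /=; first last.
    - by rewrite mem_iota /= add0n ltnn.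
    - by move=> z; rewrite !mem_iota; lia.
    rewrite off ?cats0.
    - rewrite -/(labelled _ _ _) letters_labelled; apply/all_filterP/allP => x hx.
      by rewrite (hP r) ?eqxx.
    - by move=> z; rewrite !mem_iota; lia.
    - by rewrite mem_iota ltnn.
  have eb : behead (box T r c) = behead (box T' r c).
    by rewrite -(hfil T) // -(hfil T') // er.
  have hrh : r < h by rewrite hin.
  have := hmin r hrh; case: (box T r c) (mvt_nil hT hd) eb => // a S _.
  by case: (box T' r c) (mvt_nil hT' hd) => //= b S' _ -> ->.
apply: (@eq_from_nth _ [::]).
  by have := congr1 size es; rewrite -es' !size_map.
move=> r hr; apply: (@eq_from_nth _ [::]).
  by rewrite -!nth_shape es es'.
by move=> c; rewrite -nth_shape es; apply: hbox.
Qed.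

(** No computation of [f_i] is needed: [T] and [mvt_f i T'] are both raised to the word of [T'], so
    they have the same reading word. Their columns have equal lengths, and column words determine
    the tableau. *)
Lemma mvt_fe i T T' : 0 < i -> MVT lam T -> mvt_e i T = Some T' ->
  mvt_f i T' = Some T.
Proof.
move=> hi hT e; have := mvt_e_spec hlam hi hT; rewrite e => -[hT' st].
have := mvt_f_spec hlam hi hT'; case: mvt_f => [T''|h]; last first.
  by have := word_e_phi (col_step_word st); rewrite h.
case=> hT'' st'; congr Some; have := word_e_inj (col_step_word st) (col_step_word st').
have [es _ _ _] := hT; have [es'' _ _ _] := hT''.
have en : ncols T'' = ncols T by rewrite /ncols es es''.
rewrite !letters_mvt_rd en => ew.
have : [seq col_letters T c | c <- iota 0 (ncols T)] =
       [seq col_letters T'' c | c <- iota 0 (ncols T)].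
  rewrite -[LHS]flattenK -[RHS]flattenK ew; congr reshape.
  rewrite /shape -!map_comp; apply: eq_map => c /=.
  by rewrite -(col_step_size c st) (col_step_size c st').
move/eq_in_map => hc; apply: col_letters_inj => // c.
case: (ltnP c (ncols T)) => h; last by rewrite !col_letters_nil ?en.
by rewrite hc // mem_iota.
Qed.

Lemma positive_mvt T j : MVT lam T -> positive (letters (mvt_rd_from T j)).
Proof.
move=> hT; have [es hb _ _] := hT; apply/negP => /mapP[[x [r c]] h /= e0].
move: h; rewrite -e0 (mem_mvt_rd_from hlam) // => /andP[_ h].
by have [_ _ /negP] := hb _ _ (box_in_diag es h).
Qed.

Lemma uncrowd_b_shape i T T' j : 0 < i -> MVT lam T -> col_step i T T' ->
  shape (uncrowd_b T' j) = shape (uncrowd_b T j).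
Proof.
move=> hi hT st; rewrite /uncrowd_b -!/(letters _).
case: (col_step_from j st) => [-> //|e].
by have [] := insertion_word_e hi (positive_mvt j hT) e.
Qed.

Lemma uncrowd_b_step i T T' : 0 < i -> MVT lam T -> col_step i T T' ->
  word_e i (tab_word (uncrowd_b T 0)) = Some (tab_word (uncrowd_b T' 0)).
Proof.
move=> hi hT st; rewrite /uncrowd_b -!/(letters _).
by have [] := insertion_word_e hi (positive_mvt 0 hT) (col_step_word st).
Qed.

(** The flagged filling depends on [T] only through its shape and the shapes of the [b_j]. *)
Lemma uncrowd_step i T T' : 0 < i -> MVT lam T -> col_step i T T' ->
  (uncrowd T').1 = (uncrowd T).1 /\ (uncrowd T').2.2 = (uncrowd T).2.2.
Proof.
move=> hi hT st; have hsh j := uncrowd_b_shape j hi hT st.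
have es : shape T' = shape T by case: st.
have en : ncols T' = ncols T by rewrite /ncols es.
have eF k : uncrowd_F T' k = uncrowd_F T k.
  by elim: k => //= k IH; rewrite en es IH hsh.
by rewrite /uncrowd /= en eF es hsh.
Qed.

Lemma uncrowd_b_e i T : 0 < i -> MVT lam T ->
  ssyt_e i (uncrowd_b T 0) = omap (uncrowd_b ^~ 0) (mvt_e i T).
Proof.
move=> hi hT; have := mvt_e_spec hlam hi hT; case: mvt_e => [T' [hT' st]|h] /=.
  by apply/ssyt_eP; rewrite (uncrowd_b_step hi hT st) (uncrowd_b_shape 0 hi hT st).
have := ssyt_e_word i (uncrowd_b T 0); case: ssyt_e => // t [].
have := ceq_eps i (ceq_insertion (letters (mvt_rd T))); rewrite h => h0 e _.
by have := word_e_None i (tab_word (uncrowd_b T 0)); rewrite e -h0.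
Qed.

Lemma uncrowd_b_f i T : 0 < i -> MVT lam T ->
  ssyt_f i (uncrowd_b T 0) = omap (uncrowd_b ^~ 0) (mvt_f i T).
Proof.
move=> hi hT; have := mvt_f_spec hlam hi hT; case: mvt_f => [T' [hT' st]|h] /=.
  apply/ssyt_fP; rewrite (uncrowd_b_step hi hT' st).
  by rewrite (uncrowd_b_shape 0 hi hT' st).
have := ssyt_f_word i (uncrowd_b T 0); case: ssyt_f => // t [/word_e_phi].
have := ceq_phi i (ceq_insertion (letters (mvt_rd T))).
by rewrite h /uncrowd_b /mvt_rd -/(letters _) => <-.
Qed.

(** * Content of the reading words *)

Lemma sum_nat_widen m R (f : nat -> nat) : m <= R ->
  (forall r, m <= r -> f r = 0) -> \sum_(0 <= r < m) f r = \sum_(0 <= r < R) f r.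
Proof.
move=> hm hf; rewrite [RHS](big_cat_nat (n := m)) //= [X in _ = _ + X]big1_seq ?addn0 //.
by move=> r /andP[_]; rewrite mem_index_iota => /andP[/hf].
Qed.

Lemma count_flatten_iota (a : pred nat) (F : nat -> seq nat) j k :
  count a (flatten [seq F c | c <- iota j k]) = \sum_(j <= c < j + k) count a (F c).
Proof. by rewrite count_flatten sumnE !big_map /index_iota addKn. Qed.

Lemma count_col_letters T c (a : pred nat) : MVT lam T ->
  count a (col_letters T c) = \sum_(0 <= r < size T) count a (box T r c).
Proof.
move=> hT; have [es _ _ _] := hT.
have hh : col_height T c <= size T by rewrite /col_height -(size_map size T) count_size.
rewrite -(sum_nat_widen hh); last first.
  move=> r; rewrite leqNgt (col_heightE hlam) // => hr; case e: (box T r c) => [//|x S].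
  by case/negP: hr; apply: (@box_in_diag lam T r c x); rewrite // e mem_head.
rewrite /col_letters mvt_rd_colE letters_cat count_cat.
rewrite [letters (mins _ _ _)]/letters -map_comp map_rev count_rev.
rewrite letters_flatten -map_comp.
have -> : [seq (fst \o (fun r => (box_min (box T r c), (r, c)))) r
             | r <- iota 0 (col_height T c)]
    = flatten [seq [:: box_min (box T r c)] | r <- iota 0 (col_height T c)].
  by elim: (iota _ _) => //= r s ->.
rewrite !count_flatten_iota -big_split /=; apply: eq_big_nat => r /andP[_ hr].
rewrite -/(labelled _ _ _) letters_labelled.
rewrite add0n (col_heightE hlam) // in hr.
by case: (box T r c) (mvt_nil hT hr) => //= x S _; rewrite addn0.
Qed.

Lemma count_rd_from T j (a : pred nat) : MVT lam T ->
  count a (letters (mvt_rd_from T j)) =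
  \sum_(j <= c < ncols T) \sum_(0 <= r < size T) count a (box T r c).
Proof.
move=> hT; rewrite letters_flatten -map_comp count_flatten_iota.
case: (leqP j (ncols T)) => hj.
  by rewrite subnKC //; apply: eq_big_nat => c _; apply: count_col_letters.
by rewrite !big_geq //; lia.
Qed.

Lemma perm_mvt_rd T : MVT lam T -> perm_eq (letters (mvt_rd T)) (mtab_entries T).
Proof.
move=> hT; have [es _ _ _] := hT; apply/permP => a; rewrite count_rd_from //.
rewrite exchange_big_nat /= /mtab_entries.
have -> : flatten (flatten T) = flatten [seq flatten (nth [::] T r) | r <- iota 0 (size T)].
  have -> : flatten (flatten T) = flatten (map flatten T).
    by elim: (T) => //= s U IH; rewrite flatten_cat IH.
  by rewrite -{1}(mkseq_nth [::] T) /mkseq -map_comp.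
rewrite count_flatten_iota add0n; apply: eq_big_nat => r _.
rewrite -{1}(mkseq_nth [::] (nth [::] T r)) count_flatten_iota add0n; apply/esym.
apply: (@sum_nat_widen _ _ (fun c => count a (box T r c))).
  by rewrite -nth_shape /ncols es -nth0; apply: part_nth.
by move=> c hc; rewrite /box nth_default.
Qed.

Lemma perm_uncrowd_b T : MVT lam T ->
  perm_eq (flatten (uncrowd_b T 0)) (mtab_entries T).
Proof.
move=> hT; apply: perm_trans (perm_mvt_rd hT).
rewrite perm_sym; apply: perm_trans (perm_tab_word _).
exact: ceq_perm (ceq_insertion _).
Qed.

End MVTWords.

(** * Highest weight elements *)

(** Where [P] holds on an initial segment of [[a, b)], the number [a + count] is the end of that
    segment. Applied to [level], which counts steps, and to [front], which counts columns. *)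
Lemma count_initial (P : pred nat) a b c : a <= b ->
  (forall d, a <= d -> d.+1 < b -> P d.+1 -> P d) ->
  (c < a + count P (iota a (b - a))) = (c < a) || ((c < b) && P c).
Proof.
move=> hab; have [k ->] : exists k, b = a + k by exists (b - a); lia.
rewrite addKn {hab b}; elim: k a => [|k IH] a hP /=.
  by rewrite !addn0; case: (ltnP c a).
have hP' : forall d, a.+1 <= d -> d.+1 < a.+1 + k -> P d.+1 -> P d.
  by move=> d h1 h2; apply: hP; lia.
have {}IH := IH a.+1 hP'; case hPa: (P a) => /=.
  rewrite addnA addn1 IH ltnS; case: (ltngtP c a) => //= [h|->].
    by rewrite addSnnS.
  by rewrite hPa; lia.
have hN d : a <= d -> d < a + k.+1 -> ~~ P d.
  elim: d => [|d IHd] h1 h2; first by rewrite -(_ : a = 0) ?hPa //; lia.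
  case: (ltngtP a d.+1) => h3; [|lia|by rewrite -h3 hPa].
  by apply/negP => /(hP d); rewrite (negbTE (IHd _ _)); lia.
have -> : count P (iota a.+1 k) = 0.
  apply/eqP; rewrite -leqn0 leqNgt -has_count; apply/hasPn => d.
  by rewrite mem_iota => hd; apply: hN; lia.
rewrite !addn0; case: (ltnP c a) => //= h.
by case: (ltnP c (a + k.+1)) => //= h2; rewrite (negbTE (hN _ _ _)).
Qed.

Lemma eq_from_ltn m m' : (forall j, (j < m) = (j < m')) -> m = m'.
Proof.
by move=> h; have := h m; have := h m'; rewrite !ltnn; lia.
Qed.

(** Induction from the right end of the word. A letter [x > r + 1] of row [r] needs a later partner
    [x - 1]; this lies in row [x - 2 >= r] by induction, where the reading order forbids a letter
    smaller than [x]. *)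
Lemma hw_labels n (w : seq (nat * (nat * nat))) : pairwise rd_ord w ->
  (forall p, p \in w -> p.2.1 < p.1 <= n) ->
  (forall i, 1 <= i < n -> eps i (letters w) = 0) ->
  forall p, p \in w -> p.1 = p.2.1.+1.
Proof.
elim: w => [|p w IH] //= /andP[/allP hp hw] hn he q; rewrite inE.
have IHw : forall p, p \in w -> p.1 = p.2.1.+1.
  apply: IH => // [q' hq'|i hi]; first by apply: hn; rewrite inE hq' orbT.
  by have := he i hi; lia.
case/orP=> [/eqP-> {q}|]; last exact: IHw.
case: p hp hn he => x [r c] /= hp hn he.
have /= /andP[h1 h2] := hn (x, (r, c)) (mem_head _ _).
apply/eqP; rewrite eqn_leq h1 andbT leqNgt; apply/negP => h3.
case: x h1 h2 h3 hp hn he => // x h1 h2 h3 hp hn he.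
have hi : 1 <= x < n by lia.
have : x \in letters w.
  by apply: (@eps0_mem_after x [::]); have := he _ hi; rewrite /= eqxx.
case/mapP=> -[y [r' c']] hq /= ey.
have /andP[_ /implyP /=] := hp _ hq; have /= := IHw _ hq.
by lia.
Qed.

Lemma eps_rev_iota i h : 0 < i ->
  eps i (rev (iota 1 h)) = 0 /\ phi i (rev (iota 1 h)) = (h == i).
Proof.
move=> hi; elim: h => [|h [IH1 IH2]]; first by case: i hi.
have -> : iota 1 h.+1 = rcons (iota 1 h) h.+1.
  by rewrite -[in LHS](addn1 h) iotaD -cats1.
rewrite rev_rcons /= IH1 IH2 eqSS.
by case: (h =P i) => _ /=; lia.
Qed.

Section HW.
Variables (n : nat) (lam : seq nat) (hlam : is_part lam).

Lemma mvt_row_lt T r c x : MVT lam T -> x \in box T r c -> r < x.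
Proof.
move=> hT; have [es hb _ _] := hT.
elim: r x => [|r IH] x hx.
  have [_ _ h0] := hb _ _ (box_in_diag es hx).
  by rewrite lt0n; apply/eqP => e; rewrite e (negbTE h0) in hx.
have hd : in_diag lam r c.
  exact: in_diagW hlam (leqnSn r) (leqnn c) (box_in_diag es hx).
have hm := box_min_mem (mvt_nil hT hd).
exact: leq_ltn_trans (IH _ hm) (mvt_col_lt hlam hT (ltnSn r) hm hx).
Qed.

Definition row_constant T : Prop := forall r c, box T r c = nseq (size (box T r c)) r.+1.

Definition hw_word T : Prop :=
  forall i, 1 <= i < n -> eps i (letters (mvt_rd T)) = 0.

Lemma mem_box_entries T x r c : MVT lam T -> x \in box T r c -> x \in mtab_entries T.
Proof.
move=> hT hx; rewrite -(perm_mem (perm_mvt_rd hlam hT)).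
by apply/mapP; exists (x, (r, c)); rewrite // (mem_mvt_rd_from hlam) // hx.
Qed.

Lemma hw_row_constant T : MVT_le n lam T -> hw_word T -> row_constant T.
Proof.
move=> [hT hle] hw r c; apply/all_pred1P/allP => x hx /=; apply/eqP.
apply: (@hw_labels n (mvt_rd T) _ _ hw (x, (r, c))).
- exact: (pairwise_mvt_rd_from hlam 0 hT).
- move=> [y [r' c']]; rewrite (mem_mvt_rd_from hlam) //= => hy.
  by rewrite (mvt_row_lt hT hy) hle // (mem_box_entries hT hy).
- by rewrite (mem_mvt_rd_from hlam) // hx.
Qed.

(** The [M(j,r)] of the overview. For a highest weight [T], [j + row_sum T j r] is the first plane
    column after row [r] of [mu_j]. *)
Definition row_sum T j r := \sum_(j <= c < ncols T) size (box T r c).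

Lemma box_nil T r c : shape T = lam -> ~~ in_diag lam r c -> box T r c = [::].
Proof.
move=> es hd; case e: (box T r c) => [//|x S].
by case/negP: hd; apply: (@box_in_diag lam T r c x); rewrite // e mem_head.
Qed.

Lemma count_rd_row T j r : MVT lam T -> row_constant T ->
  count_mem r.+1 (letters (mvt_rd_from T j)) = row_sum T j r.
Proof.
move=> hT hc; have [es _ _ _] := hT.
rewrite (count_rd_from hlam) //; apply: eq_big_nat => c _.
under eq_big_nat => r' _ do rewrite hc count_nseq /= eqSS.
case: (ltnP r (size T)) => hr; last first.
  rewrite box_nil // ?big1_seq // => [r' /andP[_]|].
    by rewrite mem_index_iota => h; rewrite (_ : (r' == r) = false) //; lia.
  by rewrite /in_diag -es nth_default ?size_map.
rewrite (bigD1_seq r) ?mem_index_iota ?iota_uniq //= eqxx mul1n big1 ?addn0 //.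
by move=> r' /negbTE ->.
Qed.

Lemma row_sum_rec T j r : MVT lam T ->
  row_sum T j r = size (box T r j) + row_sum T j.+1 r.
Proof.
move=> hT; have [es _ _ _] := hT.
case: (ltnP j (ncols T)) => hj; first by rewrite /row_sum big_ltn.
rewrite /row_sum !big_geq //; last by lia.
rewrite box_nil //; apply/negP => /(in_diag_ncols hlam); move: hj.
by rewrite /ncols es; lia.
Qed.

Lemma row_sum_out T j r : MVT lam T -> nth 0 lam r <= j -> row_sum T j r = 0.
Proof.
move=> [es _ _ _] hj; rewrite /row_sum big1_seq // => c /andP[_].
by rewrite mem_index_iota => /andP[hc _]; rewrite box_nil // /in_diag; lia.
Qed.

Lemma size_box_gt0 T r c : MVT lam T -> in_diag lam r c -> 0 < size (box T r c).
Proof. by move=> hT hd; case: (box T r c) (mvt_nil hT hd). Qed.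

Lemma row_sum_mono T j r : MVT lam T -> j < nth 0 lam r ->
  j.+1 + row_sum T j.+1 r <= j + row_sum T j r.
Proof.
by move=> hT hj; rewrite (row_sum_rec j r hT); have := size_box_gt0 hT hj; lia.
Qed.

Lemma row_sum_ge T j r : MVT lam T -> j <= nth 0 lam r ->
  nth 0 lam r <= j + row_sum T j r.
Proof.
move=> hT hj; have [k ek] : exists k, nth 0 lam r = j + k by exists (nth 0 lam r - j); lia.
elim: k j hj ek => [|k IH] j hj ek; first by lia.
have := IH j.+1; have := @row_sum_mono T j r hT; lia.
Qed.

(** The minima read [h, ..., 1], where every [i.+1] with [i > 0] is followed by [i]; so only the
    remaining entries count, and they form a weakly increasing word. *)
Lemma eps_col_row_constant T r j : MVT lam T -> row_constant T ->
  eps r.+1 (col_letters T j) = (size (box T r.+1 j)).-1.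
Proof.
move=> hT hc; have [es _ _ _] := hT.
rewrite /col_letters mvt_rd_colE letters_cat eps_cat.
set h := col_height T j.
have hin r' : (r' < h) = in_diag lam r' j by rewrite /h (col_heightE hlam).
have hmins : letters (mins (box T ^~ j) j (rev (iota 0 h))) = rev (iota 1 h).
  rewrite /letters -map_comp map_rev; congr rev.
  rewrite -[1]addn0 iotaDl; apply/eq_in_map => r'; rewrite mem_iota /= add0n hin => hr.
  by rewrite hc; case: (size _) (size_box_gt0 hT hr).
rewrite hmins; have [-> _] := eps_rev_iota h (ltn0Sn r); rewrite sub0n addn0.
have hF r' : letters (labelled r' j (behead (box T r' j))) =
             nseq (size (box T r' j)).-1 r'.+1.
  by rewrite letters_labelled hc size_nseq; case: (size _).
rewrite letters_flatten -map_comp (eq_map hF) eps_sorted; last first.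
  rewrite sorted_pairwise; last exact: leq_trans.
  apply: pairwise_flatten_iota => [r' _|r1 r2 _ hr _].
    rewrite -sorted_pairwise; last exact: leq_trans.
    by elim: (_.-1) => // -[|k] //= ->; rewrite leqnn.
  by apply/allrelP => x y /nseqP[-> _] /nseqP[-> _]; rewrite ltnS ltnW.
rewrite count_flatten_iota add0n.
under eq_big_nat => r' _ do rewrite count_nseq /= eqSS.
case: (ltnP r.+1 h) => hr; last first.
  have -> : box T r.+1 j = [::] by apply: box_nil => //; rewrite -hin -leqNgt.
  rewrite big1_seq // => r' /andP[_].
  by rewrite mem_index_iota => h1; rewrite (_ : (r' == r.+1) = false) //; lia.
rewrite (bigD1_seq r.+1) ?mem_index_iota ?iota_uniq //= eqxx mul1n big1 ?addn0 //.
by move=> r' /negbTE ->.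
Qed.

Lemma letters_rd_fromS T j : j < ncols T ->
  letters (mvt_rd_from T j) = col_letters T j ++ letters (mvt_rd_from T j.+1).
Proof.
by move=> hj; rewrite (@letters_rd_from_split T j j) ?leqnn // subnn.
Qed.

(** Columns are added from right to left. If nothing is uncancelled from column [j.+1] on, [phi]
    there equals [row_sum T j.+1 r - row_sum T j.+1 r.+1], and this must absorb the letters that
    column [j] leaves uncancelled, one fewer than the size of its box in row [r.+1]. *)
Lemma eps_rd_fromP T r : MVT lam T -> row_constant T ->
  eps r.+1 (letters (mvt_rd T)) = 0 <->
  forall j, in_diag lam r.+1 j -> row_sum T j r.+1 <= (row_sum T j.+1 r).+1.
Proof.
move=> hT hc; have [es _ _ _] := hT.
have key j : j < ncols T -> eps r.+1 (letters (mvt_rd_from T j.+1)) = 0 ->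
    eps r.+1 (letters (mvt_rd_from T j)) = 0 <->
    (in_diag lam r.+1 j -> row_sum T j r.+1 <= (row_sum T j.+1 r).+1).
  move=> hj h0; rewrite letters_rd_fromS // eps_cat h0 eps_col_row_constant //.
  have := phi_eps_count r.+1 (letters (mvt_rd_from T j.+1)).
  rewrite h0 !count_rd_row // (row_sum_rec j _ hT) => e.
  split=> [h hd|h]; first by have := size_box_gt0 hT hd; lia.
  case: (boolP (in_diag lam r.+1 j)) => hd; last by rewrite box_nil.
  by have := h hd; have := size_box_gt0 hT hd; lia.
have suf j : eps r.+1 (letters (mvt_rd T)) = 0 -> eps r.+1 (letters (mvt_rd_from T j)) = 0.
  elim: j => [//|j IH] /IH; case: (ltnP j (ncols T)) => hj.
    by rewrite letters_rd_fromS // eps_cat; lia.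
  by move=> _; rewrite /mvt_rd_from (_ : ncols T - j.+1 = 0) //; lia.
split=> [h j hd|h].
  have hj : j < ncols T by rewrite /ncols es; apply: in_diag_ncols hd.
  exact: ((key _ hj (suf _ h)).1 (suf _ h) hd).
have down k : eps r.+1 (letters (mvt_rd_from T (ncols T - k))) = 0.
  elim: k => [|k IH]; first by rewrite subn0 /mvt_rd_from subnn.
  case: (ltnP k (ncols T)) => hk; last first.
    have -> : ncols T - k.+1 = ncols T - k by lia.
    exact: IH.
  have ek : ncols T - k = (ncols T - k.+1).+1 by lia.
  have hlt : ncols T - k.+1 < ncols T by lia.
  by rewrite ek in IH; apply: ((key _ hlt IH).2 (h _)).
by have := down (ncols T); rewrite subnn.
Qed.

Lemma hw_suffix T j i : eps i (letters (mvt_rd T)) = 0 ->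
  eps i (letters (mvt_rd_from T j)) = 0.
Proof.
move=> h; case: (leqP j (ncols T)) => hj; last first.
  by rewrite /mvt_rd_from (_ : ncols T - j = 0) //; lia.
move: h; rewrite /mvt_rd /mvt_rd_from subn0 -{1}(subnKC hj) iotaD map_cat.
by rewrite flatten_cat letters_cat eps_cat add0n; lia.
Qed.

Lemma uncrowd_b_hw T j : MVT_le n lam T -> hw_word T ->
  uncrowd_b T j = yamanouchi 1 (shape (uncrowd_b T j)).
Proof.
move=> [hT hle] hw; rewrite /uncrowd_b -/(letters _).
set w := letters _.
have hp := perm_trans (ceq_perm (ceq_insertion w)) (perm_tab_word _).
apply: (@tableau_hw 1 n) => [|x|i hi]; first exact: tableau_insertion.
  rewrite -(perm_mem hp) => /mapP[[y [r c]]].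
  rewrite (mem_mvt_rd_from hlam) // => /andP[_ hy] ->.
  rewrite hle ?(mem_box_entries hT hy) // andbT.
  exact: leq_ltn_trans (leq0n r) (mvt_row_lt hT hy).
by rewrite -(ceq_eps i (ceq_insertion w)); apply/hw_suffix/hw.
Qed.

Lemma shape_uncrowd_b T j r : MVT_le n lam T -> hw_word T ->
  nth 0 (shape (uncrowd_b T j)) r = row_sum T j r.
Proof.
move=> hTn hw; have [hT _] := hTn; rewrite -(count_yamanouchi 1) -uncrowd_b_hw //.
rewrite -(count_rd_row j r hT (hw_row_constant hTn hw)) add1n.
have hp := perm_trans (ceq_perm (ceq_insertion (letters (mvt_rd_from T j)))) (perm_tab_word _).
by rewrite (permP hp).
Qed.

(* The step of the uncrowding process at which the box (r, c) appears is *)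
(* [level T r c - 1].                                                    *)
Definition level T r c :=
  count (fun j => c < j + row_sum T j r) (iota 0 (nth 0 lam r)).

Lemma level_le T r c : level T r c <= nth 0 lam r.
Proof. by rewrite -[leqRHS](size_iota 0) count_size. Qed.

Lemma levelP T r c j : MVT lam T -> nth 0 lam r <= c ->
  (j < level T r c) = (j <= c) && (c < j + row_sum T j r).
Proof.
move=> hT hc; rewrite /level.
have := @count_initial (fun j => c < j + row_sum T j r) 0 (nth 0 lam r) j (leq0n _).
rewrite add0n subn0 => ->; last first.
  by move=> d _ hd /= h; have := @row_sum_mono T d r hT; lia.
rewrite /=; case: (ltnP j (nth 0 lam r)) => hj /=.
  by rewrite (_ : j <= c) //; lia.
by rewrite row_sum_out // addn0; lia.
Qed.

(** The steps [j] run downwards while [j + row_sum T j r] weakly grows, so the box appears first at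
    [j = level - 1], receives [c - j] and keeps it. *)
Lemma uncrowd_F_hw T k r c : MVT_le n lam T -> hw_word T -> k <= ncols T ->
  nth 0 lam r <= c ->
  uncrowd_F T k r c =
  if ncols T - k < level T r c then Some (c.+1 - level T r c) else None.
Proof.
move=> hTn hw hk hc; have [hT _] := hTn; have [es _ _ _] := hT.
have hn : nth 0 lam r <= ncols T.
  by rewrite /ncols es -nth0; apply: part_nth.
elim: k hk => [|k IH] hk.
  by rewrite subn0 ltnNge (leq_trans (level_le T r c) hn).
rewrite /= (IH (ltnW hk)) shape_uncrowd_b // es hc andbT -levelP //.
case: ifP => // h; case: ifP => // h2; congr Some; lia.
Qed.

Lemma uncrowd_skew_entry T r c : MVT_le n lam T -> hw_word T ->
  in_skew (uncrowd T).1 lam r c ->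
  skew_entry lam (uncrowd T).2.2 r c = c.+1 - level T r c /\ 0 < level T r c.
Proof.
move=> hTn hw /andP[h1 h2]; have [hT _] := hTn; have [es _ _ _] := hT.
have hpos : 0 < level T r c.
  by rewrite levelP //= add0n -shape_uncrowd_b.
rewrite /skew_entry /entry /uncrowd /= es.
have hr : r < size (shape (uncrowd_b T 0)).
  by rewrite ltnNge; apply/negP => h; rewrite nth_default in h2.
rewrite /= in h2.
rewrite (nth_map 0) ?size_iota // nth_iota // add0n (nth_map 0) ?size_iota ?nth_iota; try lia.
by rewrite subnKC // uncrowd_F_hw // subnn hpos.
Qed.

Lemma colflag_hw T : MVT_le n lam T -> hw_word T ->
  colflag (uncrowd T).1 lam (uncrowd T).2.2.
Proof.
move=> hTn hw; have [hT _] := hTn; have [es _ _ _] := hT.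
have hmu r : nth 0 (uncrowd T).1 r = row_sum T 0 r by rewrite shape_uncrowd_b.
have hE r c (h : in_skew (uncrowd T).1 lam r c) := uncrowd_skew_entry hTn hw h.
split.
- by move=> r; rewrite hmu; have := @row_sum_ge T 0 r hT (leq0n _).
- rewrite /uncrowd [in LHS]/= {1}/shape -map_comp; apply: eq_map => r.
  by rewrite /= size_map size_iota es.
(* The entry is positive because [level] is at most [nth 0 lam r <= c], and below [c.+1] because
   [level] is positive. *)
- move=> r c h; have [-> h0] := hE _ _ h; have /andP[h1 _] := h.
  by have := level_le T r c; lia.
- move=> r c h h'; have [-> h0] := hE _ _ h; have [-> h0'] := hE _ _ h'.
  have /andP[h1 _] := h; have /andP[h1' _] := h'.
  suff : level T r c.+1 <= level T r c by have := level_le T r c; lia.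
  have := leqnn (level T r c.+1); rewrite -{1}(prednK h0') levelP //.
  move=> /andP[h2 h3]; rewrite -(prednK h0') levelP //.
  by have := level_le T r c.+1; lia.
- move=> r c h h'; have [-> h0] := hE _ _ h; have [-> h0'] := hE _ _ h'.
  have /andP[h1 _] := h; have /andP[h1' _] := h'.
  suff : level T r.+1 c < level T r c by have := level_le T r c; lia.
  have hl' := level_le T r.+1 c.
  have hl : nth 0 lam r.+1 <= nth 0 lam r by apply: part_nth.
  have := leqnn (level T r.+1 c); rewrite -{1}(prednK h0') levelP // => /andP[h2 h3].
  rewrite -{1}(prednK h0') levelP //.
  (* With [j = level T r.+1 c - 1], the highest weight condition gives [c < j + row_sum T j r.+1 <=
     j.+1 + row_sum T j.+1 r], that is, [j.+1 < level T r c]. *)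
  have hd : in_diag lam r.+1 (level T r.+1 c).-1 by rewrite /in_diag; lia.
  have hin : 1 <= r.+1 < n.
    have [_ hle] := hTn.
    have hm := box_min_mem (mvt_nil hT hd).
    have := mvt_row_lt hT hm; have := hle _ (mem_box_entries hT hm); lia.
  have := (eps_rd_fromP r hT (hw_row_constant hTn hw)).1 (hw _ hin) _ hd; lia.
Qed.

(** The entries give the levels. These give [j + row_sum T j r] as the first column from
    [nth 0 lam r] on that is outside [mu] or has level at most [j], and consecutive row sums differ
    by the size of a box. *)
Lemma hw_inj T T' : MVT_le n lam T -> MVT_le n lam T' -> hw_word T -> hw_word T' ->
  uncrowd T = uncrowd T' -> T = T'.
Proof.
move=> hTn hTn' hw hw' eu; have [hT _] := hTn; have [hT' _] := hTn'.
have [es _ _ _] := hT; have [es' _ _ _] := hT'.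
have hlev r c : nth 0 lam r <= c -> c < nth 0 (uncrowd T).1 r ->
    level T r c = level T' r c.
  move=> h1 h2; have h : in_skew (uncrowd T).1 lam r c by rewrite /in_skew h1.
  have h' := h; rewrite eu in h'.
  have [e1 p1] := uncrowd_skew_entry hTn hw h; have [e2 p2] := uncrowd_skew_entry hTn' hw' h'.
  have := level_le T r c; have := level_le T' r c.
  by move: e1; rewrite eu e2; lia.
have hmu r : nth 0 (uncrowd T).1 r = row_sum T 0 r by rewrite shape_uncrowd_b.
have hmu' r : nth 0 (uncrowd T).1 r = row_sum T' 0 r by rewrite eu shape_uncrowd_b.
have hle U j r : MVT lam U -> j <= nth 0 lam r -> j + row_sum U j r <= row_sum U 0 r.
  move=> hU; elim: j => [|j IH] hj; first by rewrite add0n.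
  by have := @row_sum_mono U j r hU hj; have := IH; lia.
have hN j r : j <= nth 0 lam r -> row_sum T j r = row_sum T' j r.
  move=> hj; apply/eqP; rewrite eqn_leq; apply/andP; split; rewrite leqNgt; apply/negP=> hlt.
  - set c := j + row_sum T' j r.
    have hc : nth 0 lam r <= c by apply: row_sum_ge.
    have hcm : c < nth 0 (uncrowd T).1 r.
      by rewrite hmu; apply: leq_trans (hle T j r hT hj); rewrite ltn_add2l.
    have : j < level T r c by rewrite levelP // leq_addr ltn_add2l.
    by rewrite hlev // levelP // ltnn andbF.
  - set c := j + row_sum T j r.
    have hc : nth 0 lam r <= c by apply: row_sum_ge.
    have hcm : c < nth 0 (uncrowd T).1 r.
      by rewrite hmu'; apply: leq_trans (hle T' j r hT' hj); rewrite ltn_add2l.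
    have : j < level T' r c by rewrite levelP // leq_addr ltn_add2l.
    by rewrite -hlev // levelP // ltnn andbF.
have hbox r c : in_diag lam r c -> box T r c = box T' r c.
  move=> hd; rewrite (hw_row_constant hTn hw) (hw_row_constant hTn' hw'); congr nseq.
  have := hN c r (ltnW hd); have := hN c.+1 r hd.
  by rewrite (row_sum_rec c r hT) (row_sum_rec c r hT'); lia.
apply: (@eq_from_nth _ [::]).
  by have := congr1 size es; rewrite -es' !size_map.
move=> r hr; apply: (@eq_from_nth _ [::]); first by rewrite -!nth_shape es es'.
by move=> c; rewrite -nth_shape es; apply: hbox.
Qed.

End HW.

Lemma colflag_ext lam mu F F' : colflag mu lam F -> colflag mu lam F' ->
  (forall r c, in_skew mu lam r c -> skew_entry lam F r c = skew_entry lam F' r c) ->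
  F = F'.
Proof.
move=> [_ es _ _ _] [_ es' _ _ _] h.
apply: (@eq_from_nth _ [::]).
  by have := congr1 size es; rewrite -es' !size_map.
move=> r hr; have hrm : r < size mu.
  by have := congr1 size es; rewrite !size_map size_iota => <-.
have hs : size (nth [::] F r) = nth 0 mu r - nth 0 lam r.
  by rewrite -nth_shape es (nth_map 0) ?size_iota // nth_iota.
have hs' : size (nth [::] F' r) = nth 0 mu r - nth 0 lam r.
  by rewrite -nth_shape es' (nth_map 0) ?size_iota // nth_iota.
apply: (@eq_from_nth _ 0); first by rewrite hs hs'.
move=> d; rewrite hs => hd; have := h r (nth 0 lam r + d).
by rewrite /in_skew /skew_entry /entry addKn; apply; lia.
Qed.

(** * The highest weight element of a flagged tableau *)

Section FromFlagged.
Variables (n : nat) (lam mu : seq nat) (F : filling).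
Hypotheses (hlam : is_part lam) (hmu : is_part mu) (hF : colflag mu lam F).
Hypothesis hn : size mu <= n.

(** The formulas of the highest weight case, solved backwards: [lv] is to become [level],
    [front j r] is to become [j + row_sum T j r], and [mult] is the box size that [row_sum_rec] then
    forces. The final successor accounts for the shift from [c] to [c.+1]. *)
Let lv r c := c.+1 - skew_entry lam F r c.
Let front j r := nth 0 lam r +
  count (fun c => j < lv r c) (iota (nth 0 lam r) (nth 0 mu r - nth 0 lam r)).
Let mult r c := (front c r - front c.+1 r).+1.
Let T : mtab :=
  [seq [seq nseq (mult r c) r.+1 | c <- iota 0 (nth 0 lam r)] | r <- iota 0 (size lam)].

Let hinc r : nth 0 lam r <= nth 0 mu r.
Proof. by case: hF => h _ _ _ _. Qed.

Let lv_gt0 r c : in_skew mu lam r c -> 0 < lv r c.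
Proof. by case: hF => _ _ h _ _ /h; rewrite /lv; lia. Qed.

(** Row [r] of [F] is positive and strictly increasing, so its entry in column [nth 0 lam r + d] is
    at least [d.+1]. *)
Let lv_le r c : in_skew mu lam r c -> lv r c <= nth 0 lam r.
Proof.
case: hF => _ _ hb hrow _ hs.
have [d ed] : exists d, c = nth 0 lam r + d.
  by exists (c - nth 0 lam r); move: hs; rewrite /in_skew; lia.
elim: d c ed hs => [|d IH] c ed hs.
  by have := hb _ _ hs; rewrite /lv; lia.
have hs' : in_skew mu lam r (nth 0 lam r + d) by move: hs; rewrite /in_skew; lia.
have ec : c = (nth 0 lam r + d).+1 by lia.
have := IH _ erefl hs'; have := hb _ _ hs'.
rewrite ec in hs *; have := hrow _ _ hs' hs; have := hb _ _ hs; rewrite /lv.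
move: (skew_entry _ _ _ _) (skew_entry _ _ _ _) => a b; lia.
Qed.

Let lv_row r c : in_skew mu lam r c -> in_skew mu lam r c.+1 -> lv r c.+1 <= lv r c.
Proof.
case: hF => _ _ _ hrow _ hs hs'; have := hrow _ _ hs hs'; rewrite /lv.
move: (skew_entry _ _ _ _) (skew_entry _ _ _ _) => a b; lia.
Qed.

Let lv_col r c : in_skew mu lam r c -> in_skew mu lam r.+1 c -> lv r.+1 c < lv r c.
Proof.
case: hF => _ _ hb _ hcol hs hs'.
have := hcol _ _ hs hs'; have := hb _ _ hs; have := hb _ _ hs'; rewrite /lv.
move: (skew_entry _ _ _ _) (skew_entry _ _ _ _) => a b; lia.
Qed.

Let frontP j r c :
  (c < front j r) = (c < nth 0 lam r) || ((c < nth 0 mu r) && (j < lv r c)).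
Proof.
rewrite /front count_initial // => d h1 h2 /= h.
apply: leq_trans h _; apply: lv_row; rewrite /in_skew; lia.
Qed.

Let front_mono j r : front j.+1 r <= front j r.
Proof. by rewrite leq_add2l; apply: sub_count => c /=; apply: ltnW. Qed.

Let front_ge j r : nth 0 lam r <= front j r.
Proof. exact: leq_addr. Qed.

Let front_lam r : front (nth 0 lam r) r = nth 0 lam r.
Proof.
apply: eq_from_ltn => c; rewrite frontP.
case: (ltnP c (nth 0 lam r)) => //= hc; case: (ltnP c (nth 0 mu r)) => //= hc'.
by apply/negbTE; rewrite -leqNgt; apply: lv_le; rewrite /in_skew hc.
Qed.

Let front0 r : front 0 r = nth 0 mu r.
Proof.
apply: eq_from_ltn => c; rewrite frontP; have := hinc r.
case: (ltnP c (nth 0 lam r)) => //= hc hi; first by apply/esym; lia.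
case: (ltnP c (nth 0 mu r)) => //= hc'.
by apply: lv_gt0; rewrite /in_skew hc.
Qed.

Let boxT r c : box T r c = if in_diag lam r c then nseq (mult r c) r.+1 else [::].
Proof.
rewrite /box /T /in_diag; case: (ltnP r (size lam)) => hr; last first.
  by rewrite !nth_default ?size_map ?size_iota.
rewrite (nth_map 0) ?size_iota // nth_iota // add0n.
case: (ltnP c (nth 0 lam r)) => hc; last by rewrite nth_default ?size_map ?size_iota.
by rewrite (nth_map 0) ?size_iota // nth_iota.
Qed.

Let shapeT : shape T = lam.
Proof.
rewrite /shape /T -map_comp -[RHS](mkseq_nth 0); apply: eq_map => r /=.
by rewrite size_map size_iota.
Qed.

Let mvtT : MVT lam T.
Proof.
split=> [|r c hd|r c hd|r c hd]; first exact: shapeT.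
- rewrite boxT hd /mult; split=> //.
    by elim: (_ - _) => //= k; rewrite leqnn.
  by rewrite mem_nseq.
- have hd' : in_diag lam r c by apply: in_diagW hlam (leqnn r) (leqnSn c) hd.
  rewrite !boxT hd hd' /mult /box_max /box_min /=.
  by elim: (_ - front c.+1 r).
- have hd' : in_diag lam r c by apply: in_diagW hlam (leqnSn r) (leqnn c) hd.
  rewrite !boxT hd hd' /mult /box_max /box_min /=.
  by elim: (front c r - _).
Qed.

Let size_lam : size lam <= size mu.
Proof.
rewrite leqNgt; apply/negP => h; have := hinc (size mu).
by rewrite [nth 0 mu _]nth_default // leqNgt part_nth_gt0 // h.
Qed.

Let mvt_leT : MVT_le n lam T.
Proof.
split=> // x; rewrite -(perm_mem (perm_mvt_rd hlam mvtT)) => /mapP[[y [r c]]].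
rewrite (mem_mvt_rd_from hlam) //= => hy ->.
have hd := box_in_diag shapeT hy; move: hy; rewrite boxT hd => /nseqP[-> _].
move: hd; rewrite /in_diag => /(leq_ltn_trans (leq0n c)).
by rewrite part_nth_gt0 // => h; apply: leq_trans (leq_trans h size_lam) hn.
Qed.

Let row_constantT : row_constant T.
Proof. by move=> r c; rewrite boxT; case: ifP => //; rewrite size_nseq. Qed.

Let row_sumT j r : j <= nth 0 lam r -> j + row_sum T j r = front j r.
Proof.
move=> hj; have [k ek] : exists k, nth 0 lam r = j + k by exists (nth 0 lam r - j); lia.
elim: k j hj ek => [|k IH] j hj ek.
  have ej : j = nth 0 lam r by lia.
  by rewrite (row_sum_out hlam mvtT) ?ej // front_lam addn0.
have hj1 : j < nth 0 lam r by lia.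
have := IH j.+1 hj1; rewrite (row_sum_rec hlam j r mvtT) boxT {1}/in_diag hj1 size_nseq.
have := front_mono j r; rewrite /mult; move: (front j r) (front j.+1 r) => a b; lia.
Qed.

Let hw_wordT : hw_word n T.
Proof.
move=> [|r] // _; apply/(eps_rd_fromP hlam r mvtT row_constantT) => j hd.
have hj : j < nth 0 lam r.+1 by [].
have hl : nth 0 lam r.+1 <= nth 0 lam r by apply: part_nth.
(* The inequality of [eps_rd_fromP] in terms of [front]. If it failed, [c = front j.+1 r] would
   satisfy [j < lv r.+1 c < lv r c], and [frontP] would give [c < front j.+1 r]. *)
suff : front j r.+1 <= front j.+1 r by rewrite -!row_sumT; lia.
rewrite leqNgt; apply/negP => h; move: (h); rewrite frontP.
have hc := front_ge j.+1 r; set c := front j.+1 r in h hc *.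
rewrite (_ : (c < nth 0 lam r.+1) = false) /=; last by lia.
case/andP=> h1 h2.
have hm : nth 0 mu r.+1 <= nth 0 mu r by apply: part_nth.
have hs : in_skew mu lam r c by rewrite /in_skew; lia.
have hs' : in_skew mu lam r.+1 c by rewrite /in_skew; lia.
have := lv_col hs hs' => h3.
have : c < front j.+1 r by rewrite frontP; apply/orP; right; lia.
by rewrite ltnn.
Qed.

Lemma hw_surj : exists T0, [/\ MVT_le n lam T0, hw_word n T0,
  (uncrowd T0).1 = mu & (uncrowd T0).2.2 = F].
Proof.
exists T; have emu : (uncrowd T).1 = mu.
  apply: part_eq => //; first by apply/tableau_part/tableau_insertion.
  by move=> r; rewrite (shape_uncrowd_b hlam 0 r mvt_leT hw_wordT) -front0 -row_sumT.
split=> //; have := colflag_hw hlam mvt_leT hw_wordT; rewrite emu => hF'.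
apply: (colflag_ext hF' hF) => r c hs.
have hs' : in_skew (uncrowd T).1 lam r c by rewrite emu.
have [-> _] := uncrowd_skew_entry hlam mvt_leT hw_wordT hs'.
have /andP[hc1 hc2] := hs.
suff -> : level lam T r c = lv r c.
  by case: hF => _ _ /(_ _ _ hs) h _ _; move: h; rewrite /lv; lia.
apply: eq_from_ltn => j; rewrite (levelP hlam j mvtT hc1).
case: (leqP j (nth 0 lam r)) => hj.
  by rewrite row_sumT // frontP hc2 ltnNge hc1 /= (leq_trans hj hc1).
rewrite (row_sum_out hlam mvtT) ?(ltnW hj) // addn0; have := lv_le hs; lia.
Qed.

End FromFlagged.

(** * The uncrowding isomorphism *)

Definition bounded (n : nat) (w : seq nat) : Prop := forall x, x \in w -> x <= n.

Lemma bounded_perm n u v : perm_eq u v -> bounded n u -> bounded n v.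
Proof. by move=> h hb x; rewrite -(perm_mem h); apply: hb. Qed.

Lemma bounded_word_e n i w w' : i < n -> word_e i w = Some w' ->
  bounded n w <-> bounded n w'.
Proof.
move=> hi /word_eP[w1 [w2 [-> -> _ _]]]; split=> h x;
  rewrite mem_cat inE => /or3P[hx|/eqP->|hx]; try lia;
  by apply: h; rewrite mem_cat inE hx ?orbT.
Qed.

Section Iso.
Variables (n : nat) (lam : seq nat) (hlam : is_part lam).

Lemma mvt_le_step i T T' : i < n -> MVT lam T -> MVT lam T' -> col_step i T T' ->
  (MVT_le n lam T <-> MVT_le n lam T').
Proof.
move=> hi hT hT' /col_step_word/(bounded_word_e hi) h; split=> -[_ hb]; split=> //.
  apply: bounded_perm (perm_mvt_rd hlam hT') _; apply/h.
  by apply: bounded_perm hb; rewrite perm_sym; apply: (perm_mvt_rd hlam hT).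
apply: bounded_perm (perm_mvt_rd hlam hT) _; apply/h.
by apply: bounded_perm hb; rewrite perm_sym; apply: (perm_mvt_rd hlam hT').
Qed.

Lemma mvt_le_e i T T' : 1 <= i < n -> MVT_le n lam T -> mvt_e i T = Some T' ->
  MVT_le n lam T' /\ col_step i T T'.
Proof.
move=> /andP[hi hin] hTn e; have [hT _] := hTn.
have := mvt_e_spec hlam hi hT; rewrite e => -[hT' st]; split=> //.
exact/(mvt_le_step hin hT hT' st).
Qed.

Lemma mvt_le_f i T T' : 1 <= i < n -> MVT_le n lam T -> mvt_f i T = Some T' ->
  MVT_le n lam T' /\ col_step i T' T.
Proof.
move=> /andP[hi hin] hTn e; have [hT _] := hTn.
have := mvt_f_spec hlam hi hT; rewrite e => -[hT' st]; split=> //.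
exact/(mvt_le_step hin hT' hT st).
Qed.

Lemma mvt_e_None i T : 0 < i -> MVT lam T ->
  mvt_e i T = None <-> eps i (letters (mvt_rd T)) = 0.
Proof.
move=> hi hT; have := mvt_e_spec hlam hi hT; case: mvt_e => [T' [_ st]|//].
split=> // h0; have := word_e_None i (letters (mvt_rd T)).
by rewrite (col_step_word st) h0.
Qed.

Lemma hw_wordP T : MVT lam T ->
  hw_word n T <-> (forall i, 1 <= i < n -> mvt_e i T = None).
Proof.
move=> hT; split=> h i hi; have /andP[hi0 _] := hi.
  by apply/mvt_e_None => //; apply: h.
by apply/mvt_e_None => //; apply: h.
Qed.

Lemma hw_word_or_e T : MVT lam T ->
  hw_word n T \/ exists i T', 1 <= i < n /\ mvt_e i T = Some T'.
Proof.
move=> hT; case: (pselect (hw_word n T)) => [h|h]; [by left | right].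
apply: contrapT => hN; apply: h; apply/hw_wordP => // i hi.
by case e: (mvt_e i T) => [T'|//]; case: hN; exists i, T'.
Qed.

Lemma col_step_sumn i T T' : col_step i T T' ->
  sumn (letters (mvt_rd T')) < sumn (letters (mvt_rd T)).
Proof. by move=> /col_step_word/word_e_sumn ->. Qed.

Lemma uncrowdE T : uncrowd T = ((uncrowd T).1, (uncrowd_b T 0, (uncrowd T).2.2)).
Proof. by []. Qed.

Lemma uncrowd_step_eq i T T' : 0 < i -> MVT lam T -> col_step i T T' ->
  uncrowd T' = ((uncrowd T).1, (uncrowd_b T' 0, (uncrowd T).2.2)).
Proof. by move=> hi hT st; rewrite uncrowdE; have [-> ->] := uncrowd_step hlam hi hT st. Qed.

Lemma uncrowd_colflag T : MVT_le n lam T -> colflag (uncrowd T).1 lam (uncrowd T).2.2.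
Proof.
have [m] := ubnP (sumn (letters (mvt_rd T))).
elim: m T => // m IH T hm hTn; have [hT _] := hTn.
case: (hw_word_or_e hT) => [hw|[i [T' [hi e]]]]; first exact: colflag_hw hTn hw.
have [hTn' st] := mvt_le_e hi hTn e; have /andP[hi0 _] := hi.
have [<- <-] := uncrowd_step hlam hi0 hT st; apply: IH => //.
exact: leq_trans (col_step_sumn st) hm.
Qed.

Lemma uncrowd_part T : is_part (uncrowd T).1.
Proof. exact/tableau_part/tableau_insertion. Qed.

Lemma SSYT_uncrowd_b T : MVT lam T -> SSYT (uncrowd T).1 (uncrowd_b T 0).
Proof.
move=> hT; apply/SSYT_tableau; first exact: uncrowd_part.
split=> //; first exact: tableau_insertion.
rewrite -(perm_mem (perm_tab_word _)).
by have := positive_mvt hlam 0 hT; rewrite -positive_insertion.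
Qed.

Lemma uncrowd_mem T : MVT_le n lam T -> elts (flagged_sum n lam) (uncrowd T).
Proof.
move=> hTn; have hF := uncrowd_colflag hTn; have [hT hb] := hTn.
split=> /=; first by split; [exact: uncrowd_part | case: hF].
split=> //; split; first exact: SSYT_uncrowd_b.
by apply: bounded_perm hb; rewrite perm_sym; apply: (perm_uncrowd_b hlam hT).
Qed.

Lemma uncrowd_inj T1 T2 : MVT_le n lam T1 -> MVT_le n lam T2 ->
  uncrowd T1 = uncrowd T2 -> T1 = T2.
Proof.
have [m] := ubnP (sumn (letters (mvt_rd T1))).
elim: m T1 T2 => // m IH T1 T2 hm h1 h2 eu; have [hT1 _] := h1; have [hT2 _] := h2.
have eb : uncrowd_b T1 0 = uncrowd_b T2 0 by case: eu.
case: (hw_word_or_e hT1) => [hw|[i [T1' [hi e1]]]].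
  (* Being of highest weight can be read off from [b_1], which the two tableaux share. *)
  apply: (hw_inj hlam h1 h2 hw _ eu); apply/hw_wordP => // i hi.
  have /andP[hi0 _] := hi; have := uncrowd_b_e hlam hi0 hT2.
  rewrite -eb (uncrowd_b_e hlam hi0 hT1) ((hw_wordP hT1).1 hw i hi) /=.
  by case: (mvt_e i T2).
have /andP[hi0 _] := hi; have := uncrowd_b_e hlam hi0 hT2.
rewrite -eb (uncrowd_b_e hlam hi0 hT1) e1 /=; case e2: (mvt_e i T2) => [T2'|//] [eb'].
have [h1' st1] := mvt_le_e hi h1 e1; have [h2' st2] := mvt_le_e hi h2 e2.
have eT : T1' = T2'.
  apply: IH => //; first exact: leq_trans (col_step_sumn st1) hm.
  by rewrite (uncrowd_step_eq hi0 hT1 st1) (uncrowd_step_eq hi0 hT2 st2) eu eb'.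
have := mvt_fe hlam hi0 hT1 e1; rewrite eT (mvt_fe hlam hi0 hT2 e2).
by case.
Qed.

Lemma ssyt_le_e i mu t t' : is_part mu -> 1 <= i < n -> SSYT_le n mu t ->
  ssyt_e i t = Some t' -> SSYT_le n mu t'.
Proof.
move=> hmu /andP[hi hin] [ht hb] e; split; first exact: ssyt_e_stable hi hmu ht e.
have /ssyt_eP[ew _] := e; apply: bounded_perm (perm_tab_word t') _.
apply/(bounded_word_e hin ew); apply: bounded_perm hb.
by rewrite perm_sym; apply: perm_tab_word.
Qed.

Lemma ssyt_le_f i mu t t' : is_part mu -> 1 <= i < n -> SSYT_le n mu t ->
  ssyt_f i t = Some t' -> SSYT_le n mu t'.
Proof.
move=> hmu /andP[hi hin] [ht hb] e; split; first exact: ssyt_f_stable hi hmu ht e.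
have /ssyt_fP[ew _] := e; apply: bounded_perm (perm_tab_word t') _.
apply/(bounded_word_e hin ew); apply: bounded_perm hb.
by rewrite perm_sym; apply: perm_tab_word.
Qed.

Lemma ssyt_hw mu t : is_part mu -> SSYT_le n mu t ->
  (forall i, 1 <= i < n -> ssyt_e i t = None) -> t = yamanouchi 1 mu.
Proof.
move=> hmu [/(SSYT_tableau _ hmu)[es ht h0] hb] h; rewrite -es.
apply: (@tableau_hw 1 n) => // [x hx|i hi].
  rewrite hb // andbT lt0n; apply: contra h0 => /eqP e; by rewrite -e.
by have := ssyt_e_word i t; rewrite h.
Qed.

(** The first column is strictly increasing. This supplies the bound on the number of rows that
    [hw_surj] asks for. *)
Lemma SSYT_le_size mu t : is_part mu -> SSYT_le n mu t -> size mu <= n.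
Proof.
move=> hmu [[es h0 _ hc] hb].
have hlow r : r < size mu -> r < entry t r 0.
  elim: r => [|r IH] hr; first by apply: h0; rewrite /in_diag part_nth_gt0.
  apply: leq_ltn_trans (IH (ltnW hr)) (hc _ _ _).
  by rewrite /in_diag part_nth_gt0.
case: (posnP (size mu)) => [->//|hm].
have hl : (size mu).-1 < size mu by rewrite prednK.
have := hlow _ hl; rewrite prednK // => /leq_trans; apply; apply: hb.
apply/flatten_nth_mem; exists (size mu).-1; apply: mem_nth.
by rewrite -nth_shape es part_nth_gt0.
Qed.

Lemma uncrowd_surj mu b F : is_part mu -> SSYT_le n mu b -> colflag mu lam F ->
  exists2 T, MVT_le n lam T & uncrowd T = (mu, (b, F)).
Proof.
move=> hmu hb hF; have [m] := ubnP (sumn (tab_word b)).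
elim: m b hb => // m IH b hb hm.
case: (pselect (forall i, 1 <= i < n -> ssyt_e i b = None)) => [h|h].
  have [T [hT hw e1 e2]] := hw_surj hlam hmu hF (SSYT_le_size hmu hb).
  exists T => //; rewrite uncrowdE e1 e2 (uncrowd_b_hw hlam 0 hT hw).
  have e1' : shape (uncrowd_b T 0) = mu by [].
  by rewrite e1' -(ssyt_hw hmu hb h).
have [i [hi [b' e]]] : exists i, 1 <= i < n /\ exists b', ssyt_e i b = Some b'.
  apply: contrapT => hN; apply: h => i hi; case e: (ssyt_e i b) => [b'|//].
  by case: hN; exists i; split=> //; exists b'.
have /andP[hi0 _] := hi.
have /ssyt_eP[ew es] := e.
have [|T' hT' eT'] := IH b' (ssyt_le_e hmu hi hb e).
  by move: hm; rewrite (word_e_sumn ew).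
have [hT'M _] := hT'.
(* The preimage of [e_i b] is lowered to a preimage of [b]: [f_i] is defined on [T'] because it is
   defined on its [b_1]. *)
have : ssyt_f i (uncrowd_b T' 0) = Some b.
  by case: eT' => _ -> _; apply/ssyt_fP; rewrite ew es.
rewrite (uncrowd_b_f hlam hi0 hT'M); case ef: (mvt_f i T') => [T|//] [eb].
have [hT st] := mvt_le_f hi hT' ef; exists T => //; have [hTM _] := hT.
have [] := uncrowd_step hlam hi0 hTM st; rewrite eT' => e1 e2.
by rewrite uncrowdE -e1 -e2 eb.
Qed.

Lemma uncrowd_wt T : MVT lam T -> ssyt_wt (uncrowd T).2.1 = mvt_wt T.
Proof. by move=> hT; apply/eq_seq_msetP; apply: (perm_uncrowd_b hlam hT). Qed.

Lemma uncrowd_iso :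
  crystal_iso n (MVTcrystal n lam) (flagged_sum n lam) uncrowd.
Proof.
split.
- move=> i T T' hi hT; split=> /= e; first by case: (mvt_le_e hi hT e).
  by case: (mvt_le_f hi hT e).
- move=> i [mu [b F]] y hi [/= [hmu hinc] [/= hb hF]]; split.
    case e: (ssyt_e i b) => [b'|] //= [<-]; split=> //=; split=> //=.
    exact: ssyt_le_e hmu hi hb e.
  case e: (ssyt_f i b) => [b'|] //= [<-]; split=> //=; split=> //=.
  exact: ssyt_le_f hmu hi hb e.
- split.
  + by move=> T hT; apply: uncrowd_mem.
  + by move=> T1 T2; rewrite !inE /= => h1 h2; apply: uncrowd_inj.
  + move=> [mu [b F]] [/= [hmu hinc] [/= hb hF]].
    by have [T hT eT] := uncrowd_surj hmu hb hF; exists T.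
- by move=> T [hT _]; apply: uncrowd_wt.
- move=> i T hi hTn; have [hT _] := hTn; have /andP[hi0 _] := hi; split.
    rewrite [cre _ _ _]/= -[X in ssyt_e i X]/(uncrowd_b T 0) (uncrowd_b_e hlam hi0 hT).
    rewrite /=; case e: (mvt_e i T) => [T'|//] /=.
    have [_ st] := mvt_le_e hi hTn e.
    by rewrite (uncrowd_step_eq hi0 hT st).
  rewrite [crf _ _ _]/= -[X in ssyt_f i X]/(uncrowd_b T 0) (uncrowd_b_f hlam hi0 hT).
  rewrite /=; case e: (mvt_f i T) => [T'|//] /=.
  have [[hT' _] st] := mvt_le_f hi hTn e.
  have [e1 e2] := uncrowd_step hlam hi0 hT' st.
  by rewrite (uncrowdE T') -e1 -e2.
Qed.

End Iso.

(** * Counting *)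

Local Open Scope mset_scope.
Local Open Scope classical_set_scope.
Local Open Scope nat_scope.

Lemma finite_seqs (A : choiceType) (D : set A) k : finite_set D ->
  finite_set [set s : seq A | size s <= k /\ forall x, x \in s -> D x].
Proof.
move=> hD; elim: k => [|k IH].
  apply: (@sub_finite_set _ _ [set [::]]); last exact: finite_set1.
  by move=> s /= [h _]; apply: size0nil; apply/eqP; rewrite -leqn0.
apply: (@sub_finite_set _ _ ([set [::]] `|`
  (fun p : A * seq A => p.1 :: p.2) @`
     (D `*` [set s : seq A | size s <= k /\ forall x, x \in s -> D x]))).
  move=> [|x s] /= [hs hb]; [by left | right].
  exists (x, s) => //=; split=> /=; first by apply: hb; rewrite mem_head.
  by split=> // y hy; apply: hb; rewrite inE hy orbT.
rewrite finite_setU; split; first exact: finite_set1.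
by apply: finite_image; apply: finite_setX.
Qed.

Lemma finite_bounded_seq N k :
  finite_set [set s : seq nat | size s <= k /\ bounded N s].
Proof.
have -> : [set s : seq nat | size s <= k /\ bounded N s] =
          [set s : seq nat | size s <= k /\ forall x, x \in s -> `I_N.+1 x] by [].
exact: finite_seqs.
Qed.

Lemma finite_reshape (A : choiceType) (D : set A) sh : finite_set D ->
  finite_set [set t : seq (seq A) | shape t = sh /\ forall x, x \in flatten t -> D x].
Proof.
move=> hD; apply: (@sub_finite_set _ _ (reshape sh @`
  [set s : seq A | size s <= sumn sh /\ forall x, x \in s -> D x])).
  move=> t /= [es hb]; exists (flatten t); last by rewrite -es flattenK.
  by rewrite size_flatten es.
by apply: finite_image; apply: finite_seqs.
Qed.

Lemma finite_fillings sh N :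
  finite_set [set t : filling | shape t = sh /\ bounded N (flatten t)].
Proof. exact: (@finite_reshape _ `I_N.+1 sh (finite_II _)). Qed.

Lemma mem_le_sumn (s : seq nat) x : x \in s -> x <= sumn s.
Proof. by elim: s => //= y s IH; rewrite inE => /orP[/eqP->|/IH]; lia. Qed.

Lemma nth_le_sumn (s : seq nat) r : nth 0 s r <= sumn s.
Proof.
case: (ltnP r (size s)) => h; last by rewrite nth_default.
by apply: mem_le_sumn; apply: mem_nth.
Qed.

Lemma finite_colflag mu lam : finite_set (colflag mu lam).
Proof.
apply: sub_finite_set (@finite_fillings
  [seq nth 0 mu r - nth 0 lam r | r <- iota 0 (size mu)] (sumn mu)).
move=> F /= [_ es hb _ _]; split=> // x /flatten_nth_mem[r /(nthP 0)[d hd <-]].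
have hr : r < size mu.
  have <- : size F = size mu by have := congr1 size es; rewrite !size_map size_iota.
  by rewrite ltnNge; apply/negP => h; rewrite nth_default in hd.
have hs : size (nth [::] F r) = nth 0 mu r - nth 0 lam r.
  by rewrite -nth_shape es (nth_map 0) ?size_iota // nth_iota.
rewrite hs in hd.
have hk : in_skew mu lam r (nth 0 lam r + d) by rewrite /in_skew; lia.
have := hb _ _ hk; rewrite /skew_entry addKn /entry => /andP[_ h].
apply: leq_trans (nth_le_sumn mu r); move: h; move: (nth 0 _ d) => y; lia.
Qed.

Lemma fincard_bij (A B : choiceType) (X : set A) (Y : set B) (f : A -> B) :
  finite_set X -> set_bij X Y f -> fincard X = fincard Y.
Proof.
move=> hX [hf hi hs].
have -> : Y = f @` X.
  by apply/seteqP; split=> [y /hs[x hx <-]|_ [x hx <-]]; [exists x | apply: hf].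
rewrite /fincard fset_set_image // card_in_imfset //= => x y.
by rewrite !in_fset_set // !inE => hx hy; apply: hi; rewrite inE.
Qed.

Lemma fincard_partition (A I : choiceType) (X : set A) (D : set I) (g : A -> I) :
  finite_set X -> finite_set D -> (forall x, X x -> D (g x)) ->
  fincard X = \sum_(i <- fset_set D) fincard [set x | X x /\ g x = i].
Proof.
move=> hX hD hg.
have hfib i : finite_set [set x | X x /\ g x = i].
  by apply: sub_finite_set hX => x [].
transitivity (\sum_(x <- fset_set X) \sum_(i <- fset_set D | g x == i) 1).
  rewrite -[LHS]sum1_size; apply: eq_big_seq => x; rewrite in_fset_set // inE.
  move=> hx; rewrite sum1_count; apply/esym.
  rewrite (eq_count (a2 := pred1 (g x))) => [|i]; last by rewrite /= eq_sym.
  rewrite count_uniq_mem ?fset_uniq //.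
  by rewrite in_fset_set // (_ : g x \in D) // inE; apply: hg.
rewrite (exchange_big_dep predT) //=; apply: eq_bigr => i _.
rewrite sum1_count -size_filter; apply: perm_size; apply: uniq_perm.
- by rewrite filter_uniq // fset_uniq.
- exact: fset_uniq.
move=> x; rewrite mem_filter !in_fset_set //; apply/andP/idP.
  by case=> /eqP e; rewrite !inE.
by rewrite !inE => -[hx <-]; rewrite eqxx.
Qed.

Lemma fincard_setX (A B : choiceType) (X : set A) (Y : set B) :
  finite_set X -> finite_set Y -> fincard (X `*` Y) = fincard X * fincard Y.
Proof.
move=> hX hY; have hXY := finite_setX hX hY.
rewrite /fincard -(size_allpairs (fun x y => (x, y))).
apply: perm_size; apply: uniq_perm; first exact: fset_uniq.
  by apply: allpairs_uniq; rewrite ?fset_uniq // => -[a b] [c d] _ _ [-> ->].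
move=> [x y]; rewrite in_fset_set //; apply/idP/allpairsP.
  rewrite inE => -[/= hx hy]; exists (x, y); rewrite !in_fset_set //.
  by split=> //; rewrite inE.
by case=> -[a b] [/=]; rewrite !in_fset_set // !inE => ha hb [-> ->].
Qed.

(** All letters [i.+1] precede the letters [i], and there are at most as many of them since row
    lengths weakly decrease. *)
Lemma eps_yamanouchi a i mu : is_part mu -> a <= i ->
  eps i (tab_word (yamanouchi a mu)) = 0.
Proof.
elim: mu a => [|m mu IH] a hmu hi //=.
have hmu' : is_part mu.
  move: hmu; rewrite /is_part inE negb_or => /andP[h /andP[_ ->]].
  by rewrite (path_sorted h).
rewrite tab_word_cons eps_cat eps_sorted; last first.
  by elim: (m) => // -[|k] //= ->; rewrite leqnn.
rewrite count_nseq /= (_ : (a == i.+1) = false) ?mul0n ?add0n; last by lia.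
move: hi; rewrite leq_eqVlt => /orP[/eqP ei|hi]; last by rewrite IH.
rewrite phi_sorted; last by elim: (m) => // -[|k] //= ->; rewrite leqnn.
rewrite count_nseq /= ei eqxx mul1n; apply/eqP; rewrite subn_eq0.
set u := tab_word _.
have hu x : x \in u -> i < x.
  by rewrite (perm_mem (perm_tab_word _)) => /mem_yamanouchi /andP[].
have hiu : i \notin u by apply/negP => /hu; rewrite ltnn.
have := phi_eps_count i u; rewrite (phi_notin hiu) (count_memPn hiu) addn0 add0n => <-.
rewrite (permP (perm_tab_word _)); have := count_yamanouchi i.+1 mu 0.
rewrite addn0 => ->.
have := @part_nth (m :: mu) 0 1 hmu (leq0n _); rewrite /=; by case: (mu).
Qed.

Lemma mset_wt_perm (s : seq nat) (m : {mset nat}) : seq_mset s = m -> perm_eq s m.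
Proof. by move=> <-; rewrite perm_sym perm_eq_seq_mset. Qed.

Lemma finite_MVT_wt lam (m : {mset nat}) :
  finite_set [set T | MVT lam T /\ mvt_wt T = m].
Proof.
apply: sub_finite_set (@finite_reshape _ _ lam (finite_bounded_seq (sumn m) (size m))).
move=> T /= [[es _ _ _] /mset_wt_perm hp]; split=> // A hA; split.
  rewrite -(perm_size hp) /mtab_entries size_flatten.
  by apply: mem_le_sumn; apply: map_f.
move=> x hx; apply: mem_le_sumn; rewrite -(perm_mem hp).
by apply/flattenP; exists A.
Qed.

Lemma finite_SSYT_wt mu (m : {mset nat}) :
  finite_set [set t | SSYT mu t /\ ssyt_wt t = m].
Proof.
apply: sub_finite_set (finite_fillings mu (sumn m)).
move=> t /= [[es _ _ _] /mset_wt_perm hp]; split=> // x hx.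
by apply: mem_le_sumn; rewrite -(perm_mem hp).
Qed.

(** * Copies of crystals and highest weight multiplicities *)

Section Copies.
Variables (n : nat) (lam : seq nat) (hlam : is_part lam).

(** Copies are numbered by the position of the flagged tableau in the enumeration of [colflag], so
    [nth] inverts the map. *)
Definition flag_index (u : seq nat * (filling * filling)) :
    seq nat * (nat * filling) :=
  (u.1, (index u.2.2 (fset_set (colflag u.1 lam)), u.2.1)).

Lemma copies_iso :
  crystal_iso n (MVTcrystal n lam)
    (crystal_sum (parts_above lam)
       (fun mu => crystal_copies (fincard (colflag mu lam)) (Bcrystal n mu)))
    (flag_index \o uncrowd).
Proof.
have [st1 _ [hf hinj hsurj] hwt hop] := @uncrowd_iso n lam hlam.
have memF mu F : (F \in fset_set (colflag mu lam)) = (F \in colflag mu lam).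
  by rewrite in_fset_set //; apply: finite_colflag.
split=> //.
- move=> i [mu [k b]] y hi [/= [hmu hinc] [/= hk hb]]; split.
    case e: (ssyt_e i b) => [b'|] //= [<-]; split=> //=; split=> //=.
    exact: ssyt_le_e hmu hi hb e.
  case e: (ssyt_f i b) => [b'|] //= [<-]; split=> //=; split=> //=.
  exact: ssyt_le_f hmu hi hb e.
- split.
  + move=> T /hf hu; have : forall u, elts (flagged_sum n lam) u ->
      elts (crystal_sum (parts_above lam) (fun mu =>
        crystal_copies (fincard (colflag mu lam)) (Bcrystal n mu))) (flag_index u).
      move=> [mu [b F]] [/= hmu [/= hb hF]]; split=> //=; split=> //=.
      by rewrite /fincard index_mem memF inE.
    by apply.
  + move=> T1 T2 h1 h2 /= e; apply: hinj => //.
    have := hf _ (set_mem h1); have := hf _ (set_mem h2); move: e.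
    case: (uncrowd T1) => mu1 [b1 F1]; case: (uncrowd T2) => mu2 [b2 F2].
    rewrite /flag_index /= => -[<- e <-] [_ [_ /= hF2]] [_ [_ /= hF1]].
    have := congr1 (nth [::] (fset_set (colflag mu1 lam))) e.
    by rewrite !nth_index ?memF ?inE // => ->.
  + move=> [mu [k b]] [/= hmu [/= hk hb]].
    set F := nth [::] (fset_set (colflag mu lam)) k.
    have hF : colflag mu lam F by apply: set_mem; rewrite -memF mem_nth.
    have [|T hT eT] := hsurj (mu, (b, F)); first by split.
    exists T => //=; rewrite eT /flag_index /= index_uniq //; exact: fset_uniq.
- move=> i T hi hT; have [he hff] := hop i T hi hT.
  have omap2 (o : option mtab) :
      omap (flag_index \o uncrowd) o = omap flag_index (omap uncrowd o) by case: o.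
  have hcre u : cre (crystal_sum (parts_above lam) (fun mu =>
        crystal_copies (fincard (colflag mu lam)) (Bcrystal n mu))) i (flag_index u)
      = omap flag_index (cre (flagged_sum n lam) i u).
    by case: u => mu [b F] /=; case: (ssyt_e i b).
  have hcrf u : crf (crystal_sum (parts_above lam) (fun mu =>
        crystal_copies (fincard (colflag mu lam)) (Bcrystal n mu))) i (flag_index u)
      = omap flag_index (crf (flagged_sum n lam) i u).
    by case: u => mu [b F] /=; case: (ssyt_f i b).
  by split; rewrite omap2; [rewrite -he; apply: hcre | rewrite -hff; apply: hcrf].
Qed.

Lemma yamanouchi_SSYT_le mu : is_part mu -> size mu <= n ->
  SSYT_le n mu (yamanouchi 1 mu).
Proof.
move=> hmu hs; split; last by move=> x /mem_yamanouchi; lia.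
have row a nu r : nth [::] (yamanouchi a nu) r = nseq (nth 0 nu r) (a + r).
  elim: nu a r => [|m nu IH] a [|r] //=; rewrite ?addn0 //.
  by rewrite IH addSnnS.
have ent r c : in_diag mu r c -> entry (yamanouchi 1 mu) r c = r.+1.
  by move=> hd; rewrite /entry row nth_nseq; move: hd; rewrite /in_diag => ->.
split; first exact: shape_yamanouchi.
- by move=> r c /ent ->.
- by move=> r c hd; rewrite !ent //; apply: in_diagW hmu (leqnn r) (leqnSn c) hd.
- by move=> r c hd; rewrite !ent //; apply: in_diagW hmu (leqnSn r) (leqnn c) hd.
Qed.

(** A highest weight [T] uncrowds to a Yamanouchi tableau, whose content is its shape; weight [mu]
    thus forces shape [mu], and only the flagged tableau is free. The bound on [size mu] keeps the
    Yamanouchi tableau within the alphabet. *)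
Lemma hw_numberE mu : is_part mu -> size mu <= n ->
  hw_number n lam mu = fincard (colflag mu lam).
Proof.
move=> hmu hs; rewrite /hw_number; set X := [set T | _].
have hX T : X T -> [/\ MVT_le n lam T, hw_word n T & uncrowd T =
    (mu, (yamanouchi 1 mu, (uncrowd T).2.2))].
  case=> -[hT hhw] hwt; have [hTM _] := hT.
  have hw : hw_word n T by apply/(hw_wordP n hlam).
  split=> //.
  have eb := uncrowd_b_hw hlam 0 hT hw.
  have emu : shape (uncrowd_b T 0) = mu.
    apply: part_eq => //; first exact: uncrowd_part.
    move=> j; rewrite -(count_yamanouchi 1) -eb -hwt /mvt_wt mset_seqE add1n.
    exact: (permP (perm_uncrowd_b hlam hTM)).
  have eu : uncrowd_b T 0 = yamanouchi 1 mu by rewrite eb emu.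
  have e1 : (uncrowd T).1 = mu by [].
  by rewrite [LHS]uncrowdE e1 eu.
have hbij : set_bij X (colflag mu lam) (fun T => (uncrowd T).2.2).
  split.
  - move=> T /hX[hT _ eu]; have := uncrowd_colflag hlam hT.
    by rewrite [(uncrowd T).1](congr1 fst eu).
  - move=> T1 T2; rewrite !inE => /hX[h1 _ e1] /hX[h2 _ e2] e.
    by apply: (uncrowd_inj hlam h1 h2); rewrite e1 e2 e.
  - move=> F hF.
    have [T hT eT] := uncrowd_surj hlam hmu (yamanouchi_SSYT_le hmu hs) hF.
    exists T; last by rewrite eT.
    have [hTM _] := hT.
    have eb : uncrowd_b T 0 = yamanouchi 1 mu by case: eT.
    split; first split=> //.
      move=> i hi; have /andP[hi0 _] := hi; have := uncrowd_b_e hlam hi0 hTM.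
      rewrite eb /=; case: (mvt_e i T) => //= T' /ssyt_eP[ew _].
      have := word_e_None i (tab_word (yamanouchi 1 mu)).
      by rewrite ew eps_yamanouchi.
    move=> j; rewrite /mvt_wt mset_seqE -(permP (perm_uncrowd_b hlam hTM)) eb.
    by rewrite -add1n count_yamanouchi.
apply: fincard_bij hbij.
apply: sub_finite_set (finite_MVT_wt lam (ssyt_wt (yamanouchi 1 mu))).
move=> T /hX[[hT _] _ eu]; split=> //.
by rewrite -(uncrowd_wt hlam hT) eu.
Qed.
End Copies.

(** * Coefficients of the power series *)

Lemma fps_sum_indicator (I : choiceType) (D : set I) (wt : I -> {mset nat})
    (k : I -> {poly int}) (K : {poly int}) (m : {mset nat}) :
  finite_set [set i | D i /\ wt i = m] ->
  (forall i, D i -> wt i = m -> k i = K) ->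
  (\sum_(i \in D) (k i * (m == wt i)%:R))%R =
  (K *+ fincard [set i | D i /\ wt i = m])%R.
Proof.
move=> hfin hk; rewrite -(@fsbig_widen _ _ _ _ [set i | D i /\ wt i = m]) /=.
- rewrite fsbig_finite //= (eq_big_seq (fun=> K)).
    by rewrite big_const_seq count_predT GRing.iter_addr_0.
  by move=> i; rewrite in_fset_set // inE => -[hD hw]; rewrite hw eqxx GRing.mulr1 hk.
- by move=> i [].
- move=> i [hD hn] /=; case: eqP => [e|_]; last by rewrite GRing.mulr0.
  by case: hn.
Qed.

Section WeakG.
Variables (lam : seq nat) (hlam : is_part lam) (m : {mset nat}).

Let mvt_wt_set := [set T | MVT lam T /\ mvt_wt T = m].
Let ssyt_wt_set mu := [set t | SSYT mu t /\ ssyt_wt t = m].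
Let part_set := [set mu | parts_above lam mu /\ sumn mu = size m].
Let alpha_pow : {poly int} := ('X ^+ (size m - sumn lam))%R.

Lemma weakG_coef : weakG lam m = (alpha_pow *+ fincard mvt_wt_set)%R.
Proof.
apply: fps_sum_indicator => [|T hT /mset_wt_perm/perm_size hs].
  exact: finite_MVT_wt.
by rewrite /mvt_size hs.
Qed.

Lemma schur_coef mu : schur mu m = ((fincard (ssyt_wt_set mu))%:R)%R.
Proof.
rewrite -(@fps_sum_indicator _ (SSYT mu) ssyt_wt (fun=> 1%R)) //; last first.
  exact: finite_SSYT_wt.
by apply: eq_fsbigr => t _; rewrite GRing.mul1r.
Qed.

(** The Schur coefficient vanishes unless [sumn mu = size m], and then the exponent of alpha is that
    of the coefficient of [weakG]. *)
Lemma weakG_term_coef mu :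
  weakG_term lam mu m =
  if sumn mu == size m
  then (alpha_pow *+ (fincard (ssyt_wt_set mu) * fincard (colflag mu lam)))%R else 0%R.
Proof.
rewrite /weakG_term /fps_scale schur_coef; case: eqP => [->|hs].
  by rewrite -GRing.mulrA -GRing.natrM GRing.mulr_natr mulnC.
rewrite (_ : ssyt_wt_set mu = set0); first by rewrite /fincard fset_set0 GRing.mulr0.
apply/seteqP; split=> // t [[es _ _ _] /mset_wt_perm/perm_size].
by rewrite size_flatten es.
Qed.

Lemma finite_part_set : finite_set part_set.
Proof.
apply: sub_finite_set (finite_bounded_seq (size m) (size m)).
move=> mu [[/andP[_ h0] _] <-]; split; last by move=> x; apply: mem_le_sumn.
by elim: mu h0 => //= x mu IH; rewrite inE negb_or => /andP[hx /IH]; lia.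
Qed.

Lemma weakG_term_supp mu : parts_above lam mu -> weakG_term lam mu m <> 0%R ->
  part_set mu.
Proof.
by move=> hmu; rewrite weakG_term_coef; case: eqP => // e _; split.
Qed.

Lemma weakG_fincard : fincard mvt_wt_set =
  \sum_(mu <- fset_set part_set) fincard (ssyt_wt_set mu) * fincard (colflag mu lam).
Proof.
(* No letter of the monomial exceeds the sum of its letters, so the crystal with [n = sumn m]
   contains every tableau of this weight. *)
have hle T : mvt_wt_set T -> MVT_le (sumn m) lam T.
  case=> hT /mset_wt_perm hp; split=> // x hx.
  by apply: mem_le_sumn; rewrite -(perm_mem hp).
rewrite (@fincard_partition _ _ _ part_set (fun T => (uncrowd T).1)); first last.
- move=> T h; have hT := hle T h; have hF := uncrowd_colflag hlam hT.
  case: h => hTM /mset_wt_perm/perm_size hs; split.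
    by split; [exact: uncrowd_part | case: hF].
  rewrite -hs -(perm_size (perm_uncrowd_b hlam hTM)) size_flatten.
  by [].
- exact: finite_part_set.
- exact: finite_MVT_wt.
apply: eq_big_seq => mu; rewrite in_fset_set; last exact: finite_part_set.
rewrite inE => -[[hmu hinc] hs].
rewrite -fincard_setX; [|exact: finite_SSYT_wt|exact: finite_colflag].
apply: (@fincard_bij _ _ _ _ (fun T => (uncrowd T).2)).
  by apply: sub_finite_set (finite_MVT_wt lam m) => T [].
split.
- move=> T [h e]; have hT := hle T h; have := uncrowd_colflag hlam hT.
  case: h => hTM hw; rewrite e => hF; split=> //; split.
    by have := SSYT_uncrowd_b hlam hTM; rewrite e.
  by rewrite -hw; apply: uncrowd_wt hlam T hTM.
- move=> T1 T2; rewrite !inE => -[h1 e1] [h2 e2] e.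
  apply: (uncrowd_inj hlam (hle _ h1) (hle _ h2)).
  by rewrite [LHS]surjective_pairing [RHS]surjective_pairing e1 e2 e.
- move=> [t F] [/= [ht hw] hF].
  have htn : SSYT_le (sumn m) mu t.
    split=> // x hx; apply: mem_le_sumn.
    by rewrite -(perm_mem (mset_wt_perm hw)).
  have [T [hT _] eT] := uncrowd_surj hlam hmu htn hF.
  exists T; last exact: (congr1 snd eT).
  split; last exact: (congr1 fst eT).
  by split=> //; rewrite -(uncrowd_wt hlam hT) eT.
Qed.

Lemma weakG_expansion :
  weakG lam m = fps_sum (parts_above lam) (weakG_term lam) m.
Proof.
rewrite weakG_coef weakG_fincard /fps_sum.
rewrite -(@fsbig_widen _ _ _ _ part_set) /=.
- rewrite fsbig_finite; last exact: finite_part_set.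
  rewrite -GRing.sumrMnr; apply: eq_big_seq => mu.
  rewrite in_fset_set; last exact: finite_part_set.
  by rewrite inE => -[_ e]; rewrite weakG_term_coef e eqxx.
- by move=> mu [].
- move=> mu [hmu hn] /=; apply: contrapT => h; apply: hn.
  exact: weakG_term_supp.
Qed.

End WeakG.

Theorem theorem3p17 (n : nat) (lam : seq nat) (hn : 2 <= n)
    (hlam : is_part lam) :
  [/\ crystal_iso n (MVTcrystal n lam) (flagged_sum n lam) uncrowd,
      exists psi,
        crystal_iso n (MVTcrystal n lam)
          (crystal_sum (parts_above lam)
             (fun mu => crystal_copies (fincard (colflag mu lam)) (Bcrystal n mu)))
          psi,
      forall mu, is_part mu -> size mu <= n ->
        hw_number n lam mu = fincard (colflag mu lam)
    & fps_summable (parts_above lam) (weakG_term lam) /\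
      weakG lam =1 fps_sum (parts_above lam) (weakG_term lam)].
Proof.
split.
- exact: uncrowd_iso.
- by exists (flag_index lam \o uncrowd); apply: copies_iso.
- by move=> mu; apply: hw_numberE.
- split=> [m|m]; last exact: weakG_expansion.
  apply: sub_finite_set (finite_part_set hlam m) => mu [].
  exact: weakG_term_supp.
Qed.
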